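(* Let $\mathfrak g$ be the $8$-dimensional real Lie algebra with basis $e_1,\dots,e_8$ and non-zero brackets $[e_5,e_k]=e_{k-4}$ for $k=6,7,8$, $[e_6,e_7]=-e_4$, $[e_6,e_8]=e_3$, $[e_7,e_8]=-e_2$. Let $\rho:\mathfrak g\to\mathrm{End}(\mathbb R^4)$ be the linear map with $\rho(e_k)=0$ for $k=2,\dots,8$ and, in a fixed basis $f_1,\dots,f_4$ of $\mathbb R^4$, $\rho(e_1)f_1=f_2$, $\rho(e_1)f_2=-f_1$, $\rho(e_1)f_3=-f_4$, $\rho(e_1)f_4=f_3$. On the $12$-dimensional Lie algebra $T_\rho\,\mathfrak g=\mathfrak g\ltimes_\rho\mathbb R^4$ consider the inner product $\tilde g$ for which $e_1,\dots,e_8,f_1,\dots,f_4$ is orthonormal and the endomorphisms $\tilde J_1,\tilde J_2,\tilde J_3=\tilde J_1\tilde J_2$ with $\tilde J_\alpha^2=-\mathrm{id}$ determined by $\tilde J_1e_1=e_2$, $\tilde J_1e_3=e_4$, $\tilde J_1e_5=e_6$, $\tilde J_1e_7=e_8$, $\tilde J_1f_1=f_2$, $\tilde J_1f_3=f_4$, $\tilde J_2e_1=e_3$, $\tilde J_2e_2=-e_4$, $\tilde J_2e_5=e_7$, $\tilde J_2e_6=-e_8$, $\tilde J_2f_1=f_3$, $\tilde J_2f_2=-f_4$. Let $S$ be the simply connected solvable Lie group with Lie algebra $T_\rho\,\mathfrak g$. Then $(T_\rho\,\mathfrak g,\{\tilde J_\alpha\},\tilde g)$ is a balanced HKT Lie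 algebra, and its hypercomplex structure $\{\tilde J_\alpha\}$ is not abelian. Moreover, there exists a lattice $\Gamma$ in $S$ such that the compact solvmanifold $\Gamma\backslash S$, with the structure induced by the corresponding left-invariant structure on $S$, is a balanced HKT manifold whose Obata connection has holonomy contained in $SL(3,\mathbb H)$, and $\Gamma\backslash S$ is not a nilmanifold.
   Context: For a representation $\rho$, $T_\rho\,\mathfrak g$ has bracket $[(X,V),(Y,W)]=([X,Y],\rho(X)W-\rho(Y)V)$. A hypercomplex structure is a triple of integrable complex structures with $J_1J_2=-J_2J_1=J_3$; on a Lie algebra it is abelian if $[J_\alpha X,J_\alpha Y]=[X,Y]$ for all $X,Y$ and $\alpha=1,2,3$. With a Riemannian metric (inner product) $g$ compatible with all $J_\alpha$ it is hyper-Hermitian. It is HKT if there is a connection $\nabla^B$ with $\nabla^Bg=0$, $\nabla^BJ_\alpha=0$ ($\alpha=1,2,3$) whose torsion $T^B$ is such that $c(X,Y,Z)=g(X,T^B(Y,Z))$ is a $3$-form; on a Lie algebra these notions refer to the left-invariant structure. An HKT structure is balanced if the Lee form $\theta(v)=-\frac12\sum_ic(J_\alpha v,e_i,J_\alpha e_i)$ ($\{e_i\}$ an orthonormal basis) vanishes; $\theta$ does not depend on $\alpha$. The Obata connection of a hypercomplex manifold is the unique torsion-free connection with $\nabla^OJ_\alpha=0$ for all $\alpha$. $SL(n,\mathbb H)$ is the group of quaternionic-linear automorphisms of $\mathbb H^n$ with real determinant $1$ (on $\mathbb R^{4n}$). A lattice is a discrete co-compact subgroup. A nilmanifold (solvmanifold)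 is a compact quotient of a nilpotent (solvable) Lie group by a co-compact discrete subgroup. *)

(* Defs.v *)
From HB Require Import structures.
From mathcomp Require Import all_boot all_order all_algebra.
From mathcomp Require Import all_classical all_reals all_analysis.

Set Implicit Arguments.
Unset Strict Implicit.
Unset Printing Implicit Defensive.
Import Order.TTheory GRing.Theory Num.Theory.
Import numFieldNormedType.Exports.
Local Open Scope classical_set_scope.
Local Open Scope ring_scope.

(* Vectors are columns: an endomorphism of R^n is a matrix acting on the left,
   so that A *m B is the composite "B, then A". *)

Fixpoint Ck_on (R : realType) (V W : normedModType R) (k : nat) (U : set V)
    (f : V -> W) : Prop :=
  match k with
  | 0%N => forall x, U x -> {for x, continuous f}
  | k'.+1 => (forall x, U x -> differentiable f x) /\
             (forall v, Ck_on k' U (fun x => 'D_v f x))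
  end.

(* Only meaningful for U open. *)
Definition smooth_on (R : realType) (V W : normedModType R) (U : set V)
    (f : V -> W) : Prop := forall k, Ck_on k U f.

Definition smooth_near (R : realType) (V W : normedModType R) (f : V -> W)
    (x : V) : Prop := exists U, [/\ open U, U x & smooth_on U f].

(* The atlas is indexed by the points: each x carries a chart
   [coord x : chart_dom x -> R^n] around x, with inverse [param x].  These charts
   cover M, so they determine the smooth structure; conversely an atlas yields
   such data by choosing one of its charts around every point. *)
HB.mixin Record isManifold (R : realType) (n : nat) (M : Type)
    of Topological M := {
  chart_dom : M -> set M;
  coord : M -> M -> 'cV[R]_n;
  param : M -> 'cV[R]_n -> M;
  manifold_hausdorff : hausdorff_space M;
  manifold_second_countable : @second_countable M;
  chart_dom_open : forall x, open (chart_dom x);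
  chart_dom_center : forall x, chart_dom x x;
  coord_image_open : forall x, open (coord x @` chart_dom x);
  coordK : forall x y, chart_dom x y -> param x (coord x y) = y;
  coord_continuous : forall x y, chart_dom x y -> {for y, continuous (coord x)};
  param_continuous : forall x w, (coord x @` chart_dom x) w ->
    {for w, continuous (param x)};
  transition_smooth : forall x y,
    smooth_on (coord x @` (chart_dom x `&` chart_dom y)) (coord y \o param x)
}.

#[short(type="manifoldType")]
HB.structure Definition Manifold (R : realType) (n : nat) :=
  {M of isManifold R n M & Topological M}.

(* The tangent space T_x M is R^n, identified through the chart at x.  All the
   tangent objects below (differentials, vector fields, tensor fields, Christoffel
   symbols) are expressed at each point x in that chart. *)

Section SmoothMaps.
Context (R : realType) (m n : nat) (M : manifoldType R m) (N : manifoldType R n).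

Definition smooth_at (f : M -> N) (x : M) : Prop :=
  {for x, continuous f} /\
  smooth_near (coord (f x) \o f \o param x) (coord x x).

Definition mdiff (f : M -> N) (x : M) (v : 'cV[R]_m) : 'cV[R]_n :=
  'D_v (coord (f x) \o f \o param x) (coord x x).

End SmoothMaps.

Definition local_diffeo (R : realType) (n : nat) (M N : manifoldType R n)
    (f : M -> N) : Prop :=
  forall x, exists (U : set M) (V : set N) (h : N -> M),
    [/\ open U, U x, open V,
        (forall y, U y -> [/\ V (f y), h (f y) = y & smooth_at f y]) &
        (forall z, V z -> [/\ U (h z), f (h z) = z & smooth_at h z])].

Definition simply_connected (R : realType) (T : topologicalType) : Prop :=
  let I : set R := `[0, 1]%classic in
  (forall x y : T, exists f : R -> T,
     [/\ {within I, continuous f}, f 0 = x & f 1 = y]) /\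
  (forall (x : T) (f : R -> T),
     {within I, continuous f} -> f 0 = x -> f 1 = x ->
     exists H : R * R -> T,
       [/\ {within I `*` I, continuous H},
           (forall t, I t -> H (0, t) = f t /\ H (1, t) = x) &
           (forall s, I s -> H (s, 0) = x /\ H (s, 1) = x)]).

Fact cancel_derivatives (V : zmodType) (a b c d : V) :
  a + c - (b + d) - (a - b) = c - d.
Proof.
by rewrite [- (b + d)]opprD addrACA [_ + _ + - (a - b)]addrAC subrr add0r.
Qed.

Section VectorFields.
Context (R : realType) (n : nat) (M : manifoldType R n).
Local Notation vec := 'cV[R]_n.
Implicit Types (X Y Z : M -> vec) (U : set M) (x y : M).

(* the components, in the chart at x, of the tangent vector v at y *)
Definition dcoord x y (v : vec) : vec := 'D_v (coord x \o param y) (coord y y).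

(* the vector field X read in the chart at x *)
Definition rep x X (w : vec) : vec := dcoord x (param x w) (X (param x w)).

Definition smooth_vf U X : Prop :=
  forall x, U x -> smooth_near (rep x X) (coord x x).

Definition smooth_fun U (f : M -> R) : Prop :=
  forall x, U x -> smooth_near (f \o param x : vec -> R) (coord x x).

Definition dfun (f : M -> R) x (v : vec) : R :=
  'D_v (f \o param x : vec -> R) (coord x x).

Definition vf_bracket X Y : M -> vec := fun x =>
  'D_(X x) (rep x Y) (coord x x) - 'D_(Y x) (rep x X) (coord x x).

(* An affine connection is given by its Christoffel symbols: G x is the bilinear
   map such that, in the chart at x and at the point x,
   nabla_v Y = D_v Y + G x v (Y x). *)
Definition nabla (G : M -> vec -> vec -> vec) X Y : M -> vec := fun x =>
  'D_(X x) (rep x Y) (coord x x) + G x (X x) (Y x).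

Definition torsion (G : M -> vec -> vec -> vec) X Y : M -> vec := fun x =>
  nabla G X Y x - nabla G Y X x - vf_bracket X Y x.

(* The derivative terms of the torsion cancel, see [torsionE]. *)
Definition torsion_tensor (G : M -> vec -> vec -> vec) x (u v : vec) : vec :=
  G x u v - G x v u.

Lemma torsionE G X Y x : torsion G X Y x = torsion_tensor G x (X x) (Y x).
Proof. exact: cancel_derivatives. Qed.

End VectorFields.

Definition is_bilinear (R : realType) (n : nat)
    (f : 'cV[R]_n -> 'cV[R]_n -> 'cV[R]_n) : Prop :=
  (forall a u v w, f (a *: u + v) w = a *: f u w + f v w) /\
  (forall a u v w, f w (a *: u + v) = a *: f w u + f w v).

Definition is_connection (R : realType) (n : nat) (M : manifoldType R n)
    (G : M -> 'cV[R]_n -> 'cV[R]_n -> 'cV[R]_n) : Prop :=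
  (forall x, is_bilinear (G x)) /\
  (forall (U : set M) X Y, open U -> smooth_vf U X -> smooth_vf U Y ->
     smooth_vf U (nabla G X Y)).

Section Holonomy.
Context (R : realType) (n : nat) (M : manifoldType R n).
Context (G : M -> 'cV[R]_n -> 'cV[R]_n -> 'cV[R]_n).

(* Curves are parametrized by [0, 1]; the values outside U are irrelevant. *)
Definition smooth_curve (c : R -> M) : Prop :=
  exists U : set R, [/\ open U, `[0, 1]%classic `<=` U &
    forall t, U t -> {for t, continuous c} /\
                     smooth_near (coord (c t) \o c : R -> 'cV[R]_n) t].

Definition velocity (c : R -> M) (t : R) : 'cV[R]_n :=
  derive1 (coord (c t) \o c) t.

(* V s is a tangent vector at c s *)
Definition parallel_along (c : R -> M) (V : R -> 'cV[R]_n) : Prop :=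
  forall t, t \in `[0, 1] ->
    derivable (fun s => dcoord (c t) (c s) (V s)) t 1 /\
    derive1 (fun s => dcoord (c t) (c s) (V s)) t + G (c t) (velocity c t) (V t) = 0.

(* Every v extends to a unique parallel field V along c (linear ODE), so B is the
   parallel transport from c 0 to c 1. *)
Definition transport_along (c : R -> M) (B : 'M[R]_n) : Prop :=
  forall v, exists V, [/\ parallel_along c V, V 0 = v & V 1 = B *m v].

(* Each step is one smooth piece of a piecewise smooth curve. *)
Inductive transport (x : M) : M -> 'M[R]_n -> Prop :=
| Transport_refl : transport x x 1%:M
| Transport_step (c : R -> M) (A B : 'M[R]_n) :
    smooth_curve c -> transport x (c 0) A -> transport_along c B ->
    transport x (c 1) (B *m A).

Definition holonomy (x : M) : set 'M[R]_n := [set A | transport x x A].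

End Holonomy.

Section Linear.
Context (R : realType) (n : nat).
Implicit Types (g : 'M[R]_n) (J : 'I_3 -> 'M[R]_n) (u v w : 'cV[R]_n).

Definition form g u v : R := (u^T *m g *m v) 0 0.

Definition inner_product g : Prop :=
  g^T = g /\ forall v, v != 0 -> 0 < form g v v.

(* J 0, J 1, J 2 stand for J_1, J_2, J_3. *)
Definition quaternion_relations J : Prop :=
  [/\ forall a, J a *m J a = - 1%:M, J 0 *m J 1 = J 2 & J 1 *m J 0 = - J 2].

Definition compatible J g : Prop :=
  forall a u v, form g (J a *m u) (J a *m v) = form g u v.

(* c(X, Y, Z) = g(X, T(Y, Z)) *)
Definition torsion_form g (T : 'cV[R]_n -> 'cV[R]_n -> 'cV[R]_n) u v w : R :=
  form g u (T v w).

(* Trilinearity is automatic for c = torsion_form g T with T bilinear. *)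
Definition alternating3 (c : 'cV[R]_n -> 'cV[R]_n -> 'cV[R]_n -> R) : Prop :=
  forall u v, [/\ c u u v = 0, c u v u = 0 & c v u u = 0].

Definition orthonormal_basis g (e : 'I_n -> 'cV[R]_n) : Prop :=
  forall i j, form g (e i) (e j) = (i == j)%:R.

Definition lee_form (c : 'cV[R]_n -> 'cV[R]_n -> 'cV[R]_n -> R)
    (Ja : 'M[R]_n) (e : 'I_n -> 'cV[R]_n) v : R :=
  - 2^-1 * \sum_i c (Ja *m v) (e i) (Ja *m e i).

Definition lee_form_vanishes g J c : Prop :=
  forall a e v, orthonormal_basis g e -> lee_form c (J a) e v = 0.

End Linear.

Definition nijenhuis (V : zmodType) (br : V -> V -> V) (J : V -> V) (X Y : V) : V :=
  br (J X) (J Y) - J (br (J X) Y) - J (br X (J Y)) - br X Y.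

Section LieAlgebra.
Context (R : realType) (n : nat).
Local Notation vec := 'cV[R]_n.
Implicit Types (br D : vec -> vec -> vec) (J : 'I_3 -> 'M[R]_n) (g : 'M[R]_n).

Definition is_lie_algebra br : Prop :=
  [/\ is_bilinear br, (forall x, br x x = 0) &
      (forall x y z, br x (br y z) + br y (br z x) + br z (br x y) = 0)].

Definition hypercomplex_lie br J : Prop :=
  quaternion_relations J /\
  (forall a X Y, nijenhuis br (mulmx (J a)) X Y = 0).

Definition abelian_hypercomplex br J : Prop :=
  forall a X Y, br (J a *m X) (J a *m Y) = br X Y.

Definition torsion_lie br D (X Y : vec) : vec := D X Y - D Y X - br X Y.

(* D is a left-invariant connection: D X Y stands for nabla_X Y. *)
Definition hkt_connection_lie br J g D : Prop :=
  [/\ is_bilinear D,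
      (forall X Y Z, form g (D X Y) Z + form g Y (D X Z) = 0),
      (forall a X Y, D X (J a *m Y) = J a *m D X Y) &
      alternating3 (torsion_form g (torsion_lie br D))].

Definition balanced_hkt_lie br J g : Prop :=
  [/\ is_lie_algebra br, hypercomplex_lie br J, inner_product g, compatible J g &
      exists2 D, hkt_connection_lie br J g D &
        lee_form_vanishes g J (torsion_form g (torsion_lie br D))].

Definition is_representation (m : nat) br (rho : vec -> 'M[R]_m) : Prop :=
  (forall a X Y, rho (a *: X + Y) = a *: rho X + rho Y) /\
  (forall X Y, rho (br X Y) = rho X *m rho Y - rho Y *m rho X).

(* The pair (X, V) is [col_mx X V]. *)
Definition semidirect (m : nat) br (rho : vec -> 'M[R]_m)
    (x y : 'cV[R]_(n + m)) : 'cV[R]_(n + m) :=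
  col_mx (br (usubmx x) (usubmx y))
         (rho (usubmx x) *m dsubmx y - rho (usubmx y) *m dsubmx x).

End LieAlgebra.

Section HKTManifold.
Context (R : realType) (n : nat) (M : manifoldType R n).
Local Notation vec := 'cV[R]_n.
Implicit Types (J : 'I_3 -> M -> 'M[R]_n) (g : M -> 'M[R]_n).
Implicit Types (G : M -> vec -> vec -> vec).

Definition actf (A : M -> 'M[R]_n) (X : M -> vec) : M -> vec :=
  fun x => A x *m X x.

Definition hypercomplex J : Prop :=
  [/\ (forall a (U : set M) X, open U -> smooth_vf U X -> smooth_vf U (actf (J a) X)),
      (forall x, quaternion_relations (J ^~ x)) &
      (forall a (U : set M) X Y x, open U -> smooth_vf U X -> smooth_vf U Y ->
         U x -> nijenhuis (@vf_bracket R n M) (actf (J a)) X Y x = 0)].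

Definition riemannian_metric g : Prop :=
  (forall x, inner_product (g x)) /\
  (forall (U : set M) X Y, open U -> smooth_vf U X -> smooth_vf U Y ->
     smooth_fun U (fun x => form (g x) (X x) (Y x))).

Definition parallel_metric G g : Prop :=
  forall (U : set M) X Y Z x, open U ->
    smooth_vf U X -> smooth_vf U Y -> smooth_vf U Z -> U x ->
    dfun (fun y => form (g y) (Y y) (Z y)) x (X x) =
    form (g x) (nabla G X Y x) (Z x) + form (g x) (Y x) (nabla G X Z x).

Definition parallel_structures G J : Prop :=
  forall a (U : set M) X Y x, open U -> smooth_vf U X -> smooth_vf U Y -> U x ->
    nabla G X (actf (J a) Y) x = J a x *m nabla G X Y x.

Definition hkt_connection J g G : Prop :=
  [/\ is_connection G, parallel_metric G g, parallel_structures G J &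
      forall x, alternating3 (torsion_form (g x) (torsion_tensor G x))].

Definition balanced_hkt J g : Prop :=
  [/\ hypercomplex J, riemannian_metric g,
      (forall x, compatible (J ^~ x) (g x)) &
      exists2 G, hkt_connection J g G &
        forall x, lee_form_vanishes (g x) (J ^~ x)
                    (torsion_form (g x) (torsion_tensor G x))].

Definition obata_connection J G : Prop :=
  [/\ is_connection G,
      (forall (U : set M) X Y x, open U -> smooth_vf U X -> smooth_vf U Y ->
         U x -> torsion G X Y x = 0) &
      parallel_structures G J].

End HKTManifold.

Section SLH.
Context (R : realType).

(* e_a |-> e_b, e_b |-> - e_a *)
Definition rot (n : nat) (a b : 'I_n) : 'M[R]_n := delta_mx b a - delta_mx a b.

(* left multiplication by i, j, k on the quaternions, in the basis 1, i, j, k *)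
Definition quat (a : 'I_3) : 'M[R]_4 :=
  if a == 0 then rot 0 1 + rot 2 3
  else if a == 1 then rot 0 2 + rot 3 1
  else rot 0 3 + rot 1 2.

(* the same on H^m = R^(4 m), the coordinates being grouped by four *)
Definition quatH (m : nat) (a : 'I_3) : 'M[R]_(4 * m) :=
  \matrix_(i, j) if (i %/ 4 == j %/ 4)%N
                 then quat a (inord (i %% 4)) (inord (j %% 4)) else 0.

Definition SLH (m : nat) : set 'M[R]_(4 * m) :=
  [set A | (forall a, A *m quatH m a = quatH m a *m A) /\ \det A = 1].

(* The inclusion is understood through a quaternionic basis P of T_x M. *)
Definition holonomy_in_SLH (m : nat) (M : manifoldType R (4 * m))
    (J : 'I_3 -> M -> 'M[R]_(4 * m))
    (G : M -> 'cV[R]_(4 * m) -> 'cV[R]_(4 * m) -> 'cV[R]_(4 * m)) : Prop :=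
  forall x, exists P : 'M[R]_(4 * m),
    [/\ P \in unitmx, (forall a, invmx P *m J a x *m P = quatH m a) &
        forall A, holonomy G x A -> SLH (invmx P *m A *m P)].

End SLH.

HB.mixin Record Manifold_isLieGroup (R : realType) (n : nat) (G : Type)
    of Manifold R n G & Group G := {
  lie_mul_continuous : continuous (fun z : G * G => (z.1 * z.2)%g);
  lie_mul_smooth : forall x y : G,
    smooth_near (fun w : 'cV[R]_n * 'cV[R]_n =>
                   coord (x * y)%g (param x w.1 * param y w.2)%g)
                (coord x x, coord y y);
  lie_inv_smooth : forall x : G, smooth_at (fun y : G => (y^-1)%g) x
}.

#[short(type="lieGroupType")]
HB.structure Definition LieGroup (R : realType) (n : nat) :=
  {G of Manifold_isLieGroup R n G & Manifold R n G & Group G}.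

Section GroupTheory.
Context (G : groupType).

Definition subgroup (H : set G) : Prop :=
  [/\ H 1%g, (forall x y, H x -> H y -> H (x * y)%g) &
      (forall x, H x -> H (x^-1)%g)].

Definition commutator_subgroup (A B : set G) : set G :=
  smallest subgroup [set z | exists x y, [/\ A x, B y & z = (commg x y)%g]].

Definition solvable_group : Prop :=
  exists k, iter k (fun H => commutator_subgroup H H) [set: G] = [set 1%g].

Definition nilpotent_group : Prop :=
  exists k, iter k (fun H => commutator_subgroup H [set: G]) [set: G] = [set 1%g].

End GroupTheory.

Section LieGroups.
Context (R : realType) (n : nat).

Definition discrete_subgroup (G : lieGroupType R n) (Gamma : set G) : Prop :=
  subgroup Gamma /\
  forall x, Gamma x -> exists U : set G, open U /\ U `&` Gamma = [set x].

(* p : G -> M exhibits M as the quotient Gamma \ G: the surjective local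
   diffeomorphism p determines the smooth structure of M. *)
Definition is_quotient (G : lieGroupType R n) (Gamma : set G)
    (M : manifoldType R n) (p : G -> M) : Prop :=
  [/\ (forall y, exists x, p x = y),
      (forall x y, p x = p y <-> exists2 c, Gamma c & y = (c * x)%g) &
      local_diffeo p].

(* Gamma is a lattice; co-compactness is read off its quotient M = Gamma \ G. *)
Definition lattice_quotient (G : lieGroupType R n) (Gamma : set G)
    (M : manifoldType R n) (p : G -> M) : Prop :=
  [/\ discrete_subgroup Gamma, is_quotient Gamma p & compact [set: M]].

(* As p is only required to be some realization of the quotient, this says that M
   is diffeomorphic to Gamma \ N. *)
Definition nilmanifold (M : manifoldType R n) : Prop :=
  exists (N : lieGroupType R n) (Gamma : set N) (p : N -> M),
    nilpotent_group N /\ lattice_quotient Gamma p.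

(* the differential at 1 of the left translation by x, applied to v in T_1 G *)
Definition left_inv (G : lieGroupType R n) (v : 'cV[R]_n) : G -> 'cV[R]_n :=
  fun x => mdiff (fun y : G => (x * y)%g) 1%g v.

(* phi : R^n -> T_1 G is an isomorphism from (R^n, br) to the Lie algebra of G *)
Definition is_lie_algebra_of (br : 'cV[R]_n -> 'cV[R]_n -> 'cV[R]_n)
    (G : lieGroupType R n) (phi : 'M[R]_n) : Prop :=
  phi \in unitmx /\
  forall u v, phi *m br u v =
              vf_bracket (@left_inv G (phi *m u)) (@left_inv G (phi *m v)) 1%g.

(* JM and gM are the structures induced on Gamma \ G by the left-invariant
   structures on G which extend J and g *)
Definition induced_structure (G : lieGroupType R n) (phi : 'M[R]_n)
    (M : manifoldType R n) (p : G -> M) (J : 'I_3 -> 'M[R]_n) (g : 'M[R]_n)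
    (JM : 'I_3 -> M -> 'M[R]_n) (gM : M -> 'M[R]_n) : Prop :=
  let push u x := mdiff p x (@left_inv G (phi *m u) x) in
  (forall a u x, JM a (p x) *m push u x = push (J a *m u) x) /\
  (forall u v x, form (gM (p x)) (push u x) (push v x) = form g u v).

End LieGroups.

Section Example.
Context (R : realType).

(* Indices are 1-based: [e k] is the index of e_k, and in R^12 = R^8 x R^4,
   [f k] is that of f_k. *)
Local Notation ix n k := (inord (k.-1)%N : 'I_n).
Local Notation e k := (ix 12 k).
Local Notation f k := (ix 12 (8 + k)%N).

Definition wedge (n : nat) (a b : 'I_n) (x y : 'cV[R]_n) : R :=
  x a 0 * y b 0 - x b 0 * y a 0.

Definition g_bracket (x y : 'cV[R]_8) : 'cV[R]_8 :=
  let w a b := wedge (ix 8 a) (ix 8 b) x y in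
  let b k : 'cV[R]_8 := delta_mx (ix 8 k) 0 in
  w 5 6 *: b 2 + w 5 7 *: b 3 + w 5 8 *: b 4
  - w 6 7 *: b 4 + w 6 8 *: b 3 - w 7 8 *: b 2.

Definition rho (x : 'cV[R]_8) : 'M[R]_4 :=
  x (ix 8 1) 0 *: (rot R (ix 4 1) (ix 4 2) + rot R (ix 4 4) (ix 4 3)).

Definition T_bracket : 'cV[R]_12 -> 'cV[R]_12 -> 'cV[R]_12 :=
  semidirect g_bracket rho.

Definition J1 : 'M[R]_12 :=
  rot R (e 1) (e 2) + rot R (e 3) (e 4) + rot R (e 5) (e 6) + rot R (e 7) (e 8)
  + rot R (f 1) (f 2) + rot R (f 3) (f 4).

(* J_2 e_2 = - e_4 is the same as J_2 e_4 = e_2 *)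
Definition J2 : 'M[R]_12 :=
  rot R (e 1) (e 3) + rot R (e 4) (e 2) + rot R (e 5) (e 7) + rot R (e 8) (e 6)
  + rot R (f 1) (f 3) + rot R (f 4) (f 2).

Definition Jt (a : 'I_3) : 'M[R]_12 :=
  if a == 0 then J1 else if a == 1 then J2 else J1 *m J2.

Definition gt : 'M[R]_12 := 1%:M.

End Example.

(* Main.v *)
From HB Require Import structures.
From mathcomp Require Import all_boot all_order all_algebra.
From mathcomp Require Import all_classical all_reals all_analysis.
From mathcomp Require Import ring lra.
Require Import Defs.
Set Implicit Arguments.
Unset Strict Implicit.
Unset Printing Implicit Defensive.
Import Order.TTheory GRing.Theory Num.Theory.
Import numFieldNormedType.Exports.
Local Open Scope classical_set_scope.
Local Open Scope ring_scope.

(** The algebra splits as T = (R e_1 + R^4) + h, where h is spanned by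
    e_2, ..., e_8 and e_1 acts on R^4 by a rotation; with u = (e_5, ..., e_8),
    the algebra h is a 2-step nilpotent extension of the u-space by the span of
    e_2, e_3, e_4. The whole structure is left-invariant, and everything is
    reduced to polynomial identities in the twelve coordinates.

    _The group._ On R^12 put x * y = x + A(x) y, where A(x) rotates R^4 by the
    angle x_0 and adds to the central coordinates a bilinear expression in the
    u-coordinates. As A(x * y) = A(x) A(y), this is a group law with affine left
    translations, and the columns of A form the left-invariant frame. If
    a(v) = dA_0(v), then a(v) w - a(w) v is the bracket of T. The points with
    coordinates in pi Z x Z^11 form a lattice [lattice], because A(x) is integral at
    these points. Its quotient [solvmfd] has the local inverses of the
    projection as charts, with affine changes of charts.

    _The structures on the quotient._ The frame is invariant under left
    translations, so it descends to the quotient; a vector field becomes a periodic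
    function xi from the group to R^12, and a bilinear product D on R^12 a
    connection [christoffel] with constant coefficients in the frame. Integrability,
    compatibility, torsion and Lee form are then those of the Lie algebra. The
    Bismut connection is given by g(D_x y, z) = - g(x, [y, z]) on g and by rho(x) y
    on R^4 [bismut]; the Obata connection by a quaternionic formula on g and
    again by rho(x) y on R^4 [obata]. The Obata connection is unique because a
    symmetric tensor T with T(x, J y) = J T(x, y) satisfies
    J_1 J_2 T(x, y) = T(J_2 x, J_1 y) = J_2 J_1 T(x, y) [obata_unique].

    _Holonomy._ In the frame, parallel transport along a curve with velocity mu
    solves eta' = - D(mu, eta) [parallel_along_sol]. This equation is triangular
    for the decomposition of R^12 into the three blocks (e_1, ..., e_4),
    (e_5, ..., e_8), (f_1, ..., f_4), with zero diagonal on the first two and a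
    skew one on the last. Hence its solutions are determined by their initial value,
    transport commutes with the J_alpha [transport_Jt], and it is block triangular
    with diagonal (1, 1, C) where C is orthogonal and quaternionic; such a C is a
    right multiplication by a unit quaternion, so that the determinant is 1
    [transport_det].

    _Not a nilmanifold._ Let q be a projection of a nilpotent Lie group N onto the
    quotient M by a discrete subgroup. In the lattice, c = pi e_1 inverts
    v = f_1 by conjugation. The plane spanned by e_1 and f_1 projects to M, and
    its lift P to N yields elements a, b of the discrete subgroup with
    a^-1 b a = b^-1. Then b^(2^k) belongs to the k-th term of the lower central
    series, so b^m = 1 for some m = 2^k > 0. Multiplication in N now gives a map
    (s, t) |-> q (P(s, 0) n_0^-1 P(0, t)) which is periodic in both directions, with
    periods pi and m, and whose restrictions to the axes are the projections of the
    axes. Lifting it to the simply connected group shows that c and v^m commute,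
    which is false [not_nilmanifold]. Both liftings come from [plane_lift]. *)

(** * Coordinates of column vectors *)

(** Coordinates are indexed by numbers, with value 0 out of range, so that no
    ordinal has to be built; the lock keeps [ring] from unfolding them. *)
HB.lock Definition co (R : realType) n (x : 'cV[R]_n) (k : nat) : R :=
  if insub k is Some i then x i 0 else 0.

HB.lock Definition vec (R : realType) n (f : nat -> R) : 'cV[R]_n := \col_(i < n) f i.

Section Coordinates.
Context (R : realType).
Implicit Types (n : nat) (f : nat -> R).

Lemma co_ord n (x : 'cV[R]_n) (i : 'I_n) : co x i = x i 0.
Proof. by rewrite co.unlock valK. Qed.

Lemma co_inord n (x : 'cV[R]_n.+1) k : (k <= n)%N -> x (inord k) 0 = co x k.
Proof. by move=> kn; rewrite -co_ord inordK. Qed.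

Lemma co_inj n (x y : 'cV[R]_n) :
  (forall k, (k < n)%N -> co x k = co y k) -> x = y.
Proof.
by move=> xy; apply/colP => i; rewrite -!co_ord; apply: xy.
Qed.

Lemma co_vec n f k : (k < n)%N -> co (vec n f) k = f k.
Proof. by move=> kn; rewrite (co_ord _ (Ordinal kn)) vec.unlock mxE. Qed.

Lemma coD n (x y : 'cV[R]_n) k : co (x + y) k = co x k + co y k.
Proof. by rewrite co.unlock; case: insub => [i|]; rewrite ?mxE ?addr0. Qed.

Lemma coZ n a (x : 'cV[R]_n) k : co (a *: x) k = a * co x k.
Proof. by rewrite co.unlock; case: insub => [i|]; rewrite ?mxE ?mulr0. Qed.

Lemma co0 n k : co (0 : 'cV[R]_n) k = 0.
Proof. by rewrite co.unlock; case: insub => [i|]; rewrite ?mxE. Qed.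

Lemma coN n (x : 'cV[R]_n) k : co (- x) k = - co x k.
Proof. by rewrite -scaleN1r coZ mulN1r. Qed.

Lemma co_delta n k l : (k <= n)%N -> (l <= n)%N ->
  co (delta_mx (inord k) 0 : 'cV[R]_n.+1) l = (l == k)%:R.
Proof.
move=> kn ln; rewrite -co_inord // mxE eqxx andbT; congr (_%:R); congr nat_of_bool.
by apply/eqP/eqP => [/(congr1 val)|->//]; rewrite /= !inordK.
Qed.

Lemma co_usub n m (x : 'cV[R]_(n + m)) k : (k < n)%N -> co (usubmx x) k = co x k.
Proof.
by move=> kn; rewrite (co_ord _ (Ordinal kn)) mxE -co_ord.
Qed.

Lemma co_dsub n m (x : 'cV[R]_(n + m)) k :
  (k < m)%N -> co (dsubmx x) k = co x (n + k).
Proof.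
by move=> kn; rewrite (co_ord _ (Ordinal kn)) mxE -co_ord.
Qed.

Lemma co_colu n m (x : 'cV[R]_n) (y : 'cV[R]_m) k :
  (k < n)%N -> co (col_mx x y) k = co x k.
Proof. by move=> kn; rewrite -[in RHS](col_mxKu x y) co_usub. Qed.

Lemma co_cold n m (x : 'cV[R]_n) (y : 'cV[R]_m) k :
  (k < m)%N -> co (col_mx x y) (n + k) = co y k.
Proof. by move=> kn; rewrite -[in RHS](col_mxKd x y) co_dsub. Qed.

Lemma rot_mul n (a b k : nat) (x : 'cV[R]_n.+1) :
  (a <= n)%N -> (b <= n)%N -> (k <= n)%N ->
  co (rot R (inord a : 'I_n.+1) (inord b) *m x) k =
  (k == b)%:R * co x a - (k == a)%:R * co x b.
Proof.
move=> an bn kn; rewrite /rot mulmxBl coD coN.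
have E c d : (c <= n)%N -> (d <= n)%N ->
    delta_mx (inord c) (inord d) *m x = co x d *: delta_mx (inord c) 0 :> 'cV[R]_n.+1.
  move=> cn dn; apply/colP => i; rewrite !mxE (bigD1 (inord d)) //= big1 => [|j jd].
    by rewrite !mxE !eqxx !andbT addr0 mulrC co_inord.
  by rewrite !mxE (negPf jd) andbF mul0r.
by rewrite !E // !coZ !co_delta // ![co x _ * _]mulrC.
Qed.

Lemma mx_ext m n (A B : 'M[R]_(m, n)) :
  (forall v : 'cV[R]_n, A *m v = B *m v) -> A = B.
Proof.
by move=> AB; apply/matrixP => i j; have /colP/(_ i) := AB (delta_mx j 0);
  rewrite -!colE !mxE.
Qed.

Definition mxof m n (f : 'cV[R]_n -> 'cV[R]_m) : 'M[R]_(m, n) :=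
  \matrix_(i, j) f (delta_mx j 0) i 0.

Lemma mxofE m n (f : 'cV[R]_n -> 'cV[R]_m) v :
  (forall a u w, f (a *: u + w) = a *: f u + f w) -> mxof f *m v = f v.
Proof.
move=> fl.
have f0 : f 0 = 0 by have := fl (-1) 0 0; rewrite scaleN1r addNr scaleN1r addNr.
have fs (I : seq 'I_n) :
    f (\sum_(j <- I) v j 0 *: delta_mx j 0) = \sum_(j <- I) v j 0 *: f (delta_mx j 0).
  by elim: I => [|j I IH]; rewrite ?big_nil // !big_cons fl IH.
have -> : v = \sum_j v j 0 *: delta_mx j 0.
  rewrite [LHS]matrix_sum_delta; apply: eq_bigr => j _.
  by rewrite big_ord1.
rewrite fs; apply/colP => i; rewrite !mxE summxE; apply: eq_bigr => j _.
rewrite !mxE mulrC; congr (_ * _).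
rewrite summxE (bigD1 j) //= big1 => [|k kj]; rewrite !mxE ?eqxx /= ?addr0 ?mulr1 //.
by rewrite eq_sym (negPf kj) mulr0.
Qed.

End Coordinates.

(** * The Lie algebra, its hypercomplex structure and two connections *)

Section LieAlgebraExample.
Context (R : realType).
Local Notation V := 'cV[R]_12.
Implicit Types (x y z u v w : V).

(* coordinatewise verification of an identity between vectors *)
Ltac by_coordinates :=
  apply: co_inj; do 12? [case=> [_|]]; last by [];
  do 3! rewrite ?(coD, coN, coZ, co0, co_vec) //=; ring.

(** The index 0 stands for e_1, the indices 1, 2, 3 for the centre e_2, e_3, e_4
    of the nilpotent summand, 4, ..., 7 for e_5, ..., e_8 and 8, ..., 11 for
    f_1, ..., f_4. *)
Definition bracket_co x y (k : nat) : R :=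
  match k with
  | 0 => 0
  | 1 => (co x 4 * co y 5 - co x 5 * co y 4) - (co x 6 * co y 7 - co x 7 * co y 6)
  | 2 => (co x 4 * co y 6 - co x 6 * co y 4) + (co x 5 * co y 7 - co x 7 * co y 5)
  | 3 => (co x 4 * co y 7 - co x 7 * co y 4) - (co x 5 * co y 6 - co x 6 * co y 5)
  | 4 => 0
  | 5 => 0
  | 6 => 0
  | 7 => 0
  | 8 => - co x 0 * co y 9 + co y 0 * co x 9
  | 9 => co x 0 * co y 8 - co y 0 * co x 8
  | 10 => co x 0 * co y 11 - co y 0 * co x 11
  | 11 => - co x 0 * co y 10 + co y 0 * co x 10
  | _ => 0 end.

Definition bracket x y : V := vec 12 (bracket_co x y).

Lemma T_bracketE x y : T_bracket x y = bracket x y.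
Proof.
apply: co_inj.
have W a b : (a <= 7)%N -> (b <= 7)%N ->
    wedge (inord a : 'I_8) (inord b) (usubmx (x : 'cV_(8 + 4))) (usubmx (y : 'cV_(8 + 4)))
    = co x a * co y b - co x b * co y a.
  by move=> a7 b7; rewrite /wedge !co_inord // !co_usub.
have rhoE (z : 'cV[R]_8) (t : 'cV[R]_4) k : (k <= 3)%N ->
    co (rho z *m t) k = co z 0 * ((k == 1)%:R * co t 0 - (k == 0)%:R * co t 1
      + ((k == 2)%:R * co t 3 - (k == 3)%:R * co t 2)).
  by move=> k3; rewrite /rho -scalemxAl coZ mulmxDl coD !rot_mul //= co_inord.
have L k : (k < 8)%N -> co (T_bracket x y) k =
    co (g_bracket (usubmx (x : 'cV_(8 + 4))) (usubmx (y : 'cV_(8 + 4)))) k.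
  by move=> k8; exact: (@co_colu R 8 4).
have L' k : (k < 4)%N -> co (T_bracket x y) (8 + k) =
    co x 0 * ((k == 1)%:R * co y 8 - (k == 0)%:R * co y 9
      + ((k == 2)%:R * co y 11 - (k == 3)%:R * co y 10)) -
    co y 0 * ((k == 1)%:R * co x 8 - (k == 0)%:R * co x 9
      + ((k == 2)%:R * co x 11 - (k == 3)%:R * co x 10)).
  move=> k8; apply: (etrans (@co_cold R 8 4 _ _ k k8)); rewrite coD coN !rhoE //.
  by rewrite !co_usub // !co_dsub.
do 8? [case=> [_|]]; try by
  rewrite L // /g_bracket !(coD, coN, coZ) !co_delta //= !W //= co_vec //=; ring.
case=> [_|]; first by rewrite (L' 0%N) // co_vec //=; ring.
case=> [_|]; first by rewrite (L' 1%N) // co_vec //=; ring.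
case=> [_|]; first by rewrite (L' 2%N) // co_vec //=; ring.
case=> [_|]; first by rewrite (L' 3%N) // co_vec //=; ring.
by [].
Qed.

Lemma rot_add a b x y k : (a <= 11)%N -> (b <= 11)%N -> (k <= 11)%N ->
  co (rot R (inord a) (inord b) *m x + y) k =
  (k == b)%:R * co x a - (k == a)%:R * co x b + co y k.
Proof. by move=> ? ? ?; rewrite coD rot_mul. Qed.

Definition J1_co x (k : nat) : R :=
  match k with
  | 0 => - co x 1
  | 1 => co x 0
  | 2 => - co x 3
  | 3 => co x 2
  | 4 => - co x 5
  | 5 => co x 4
  | 6 => - co x 7
  | 7 => co x 6
  | 8 => - co x 9
  | 9 => co x 8
  | 10 => - co x 11
  | 11 => co x 10
  | _ => 0
  end.

Definition J2_co x (k : nat) : R :=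
  match k with
  | 0 => - co x 2
  | 1 => co x 3
  | 2 => co x 0
  | 3 => - co x 1
  | 4 => - co x 6
  | 5 => co x 7
  | 6 => co x 4
  | 7 => - co x 5
  | 8 => - co x 10
  | 9 => co x 11
  | 10 => co x 8
  | 11 => - co x 9
  | _ => 0
  end.

Definition J3_co x (k : nat) : R :=
  match k with
  | 0 => - co x 3
  | 1 => - co x 2
  | 2 => co x 1
  | 3 => co x 0
  | 4 => - co x 7
  | 5 => - co x 6
  | 6 => co x 5
  | 7 => co x 4
  | 8 => - co x 11
  | 9 => - co x 10
  | 10 => co x 9
  | 11 => co x 8
  | _ => 0
  end.

Lemma J1E x : J1 R *m x = vec 12 (J1_co x).
Proof.
rewrite -[LHS]addr0 /J1 5!mulmxDl -!addrA.
apply: co_inj; do 12? [case=> [_|]]; last by [].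
all: rewrite !rot_add // co0 co_vec //=; ring.
Qed.

Lemma J2E x : J2 R *m x = vec 12 (J2_co x).
Proof.
rewrite -[LHS]addr0 /J2 5!mulmxDl -!addrA.
apply: co_inj; do 12? [case=> [_|]]; last by [].
all: rewrite !rot_add // co0 co_vec //=; ring.
Qed.

Definition Jact (a : 'I_3) x : V :=
  vec 12 (if a == 0 then J1_co x else if a == 1 then J2_co x else J3_co x).

Lemma JtE a x : Jt R a *m x = Jact a x.
Proof.
rewrite /Jt /Jact; case: ifP => _; first exact: J1E.
case: ifP => _; first exact: J2E.
by rewrite -mulmxA J2E J1E; by_coordinates.
Qed.

Lemma I3_ind (P : 'I_3 -> Prop) : P 0 -> P 1 -> P 2 -> forall a, P a.
Proof.
move=> P0 P1 P2 [[|[|[|//]]] k3].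
- by rewrite (_ : Ordinal _ = 0) //; exact: val_inj.
- by rewrite (_ : Ordinal _ = 1) //; exact: val_inj.
- by rewrite (_ : Ordinal _ = 2) //; exact: val_inj.
Qed.

Lemma quaternion_Jt : quaternion_relations (Jt R).
Proof.
have JJ a b v : Jt R a *m Jt R b *m v = Jact a (Jact b v).
  by rewrite -[LHS]mulmxA !JtE.
by split; [elim/I3_ind| |]; apply: mx_ext => v;
  rewrite JJ ?mulNmx ?mul1mx ?JtE /Jact /=; by_coordinates.
Qed.

Lemma bracket_bilinear : is_bilinear bracket.
Proof. by split=> a u v w; by_coordinates. Qed.

Lemma bracket_alternating x : bracket x x = 0.
Proof. by_coordinates. Qed.

Lemma jacobi x y z :
  bracket x (bracket y z) + bracket y (bracket z x) + bracket z (bracket x y) = 0.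
Proof. by_coordinates. Qed.

Lemma integrable_Jt a x y : nijenhuis bracket (mulmx (Jt R a)) x y = 0.
Proof.
by elim/I3_ind: a; rewrite /nijenhuis !JtE /Jact /=; by_coordinates.
Qed.

Lemma not_abelian_Jt : ~ abelian_hypercomplex bracket (Jt R).
Proof.
pose e (k : nat) : V := vec 12 (fun l => (l == k)%:R).
move=> /(_ 0 (e 0) (e 8)); rewrite !JtE /Jact /= => /(congr1 (fun v : V => co v 9%N)).
do 2 rewrite !co_vec //=; rewrite /e !co_vec //=; lra.
Qed.

Lemma form_gt_sum x y : form (gt R) x y = \sum_(k < 12) co x k * co y k.
Proof.
by rewrite /form /gt mulmx1 mxE; apply: eq_bigr => k _; rewrite mxE !co_ord.
Qed.

Lemma form_gtE x y : form (gt R) x y =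
  co x 0 * co y 0 + co x 1 * co y 1 + co x 2 * co y 2 + co x 3 * co y 3 +
  co x 4 * co y 4 + co x 5 * co y 5 + co x 6 * co y 6 + co x 7 * co y 7 +
  co x 8 * co y 8 + co x 9 * co y 9 + co x 10 * co y 10 + co x 11 * co y 11.
Proof. by rewrite form_gt_sum !big_ord_recr big_ord0 /= add0r. Qed.

Lemma inner_product_gt : inner_product (gt R).
Proof.
split=> [|v v0]; first by rewrite /gt trmx1.
rewrite form_gt_sum lt0r sumr_ge0 ?andbT => [|k _]; last by rewrite -expr2 sqr_ge0.
apply: contra v0 => /eqP /psumr_eq0P v0; apply/eqP/co_inj => k k12.
have := v0 _ (Ordinal k12) isT; rewrite co0 => vk.
by apply/eqP; rewrite -[_ == 0]orbb -mulf_eq0 vk // => i _; rewrite -expr2 sqr_ge0.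
Qed.

(* verification of a scalar identity in the coordinates *)
Ltac by_components :=
  rewrite ?form_gtE; do 3! rewrite ?(coD, coN, coZ, co0, co_vec) //=; ring.

Lemma compatible_gt : compatible (Jt R) (gt R).
Proof. by elim/I3_ind => u v; rewrite !JtE /Jact /=; by_components. Qed.

(** On g this solves g(D_x y, z) = - g(x, [y, z]), which is the Bismut connection
    of an abelian hyper-Hermitian structure; on R^4 it is rho(x) y. *)
Definition bismut_co x y (k : nat) : R :=
  match k with
  | 4 => co x 1 * co y 5 + co x 2 * co y 6 + co x 3 * co y 7
  | 5 => - (co x 1 * co y 4 - co x 2 * co y 7 + co x 3 * co y 6)
  | 6 => - (co x 1 * co y 7 + co x 2 * co y 4 - co x 3 * co y 5)
  | 7 => - (co x 2 * co y 5 - co x 1 * co y 6 + co x 3 * co y 4)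
  | 8 => - co x 0 * co y 9
  | 9 => co x 0 * co y 8
  | 10 => co x 0 * co y 11
  | 11 => - co x 0 * co y 10
  | _ => 0
  end.

(** Let the quaternions x', y' be the components of x and y on e_5, ..., e_8.
    The component on e_1, ..., e_4 is y' x' + y' conj(x') / 2, which is linear over
    the quaternions in y' and whose antisymmetrization is the bracket; the component
    on R^4 is rho(x) y. *)
Definition obata_co x y (k : nat) : R :=
  match k with
  | 0 => co y 4 * (3 / 2 * co x 4) - co y 5 * (2^-1 * co x 5)
    - co y 6 * (2^-1 * co x 6) - co y 7 * (2^-1 * co x 7)
  | 1 => co y 4 * (2^-1 * co x 5) + co y 5 * (3 / 2 * co x 4)
    + co y 6 * (2^-1 * co x 7) - co y 7 * (2^-1 * co x 6)
  | 2 => co y 4 * (2^-1 * co x 6) - co y 5 * (2^-1 * co x 7)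
    + co y 6 * (3 / 2 * co x 4) + co y 7 * (2^-1 * co x 5)
  | 3 => co y 4 * (2^-1 * co x 7) + co y 5 * (2^-1 * co x 6)
    - co y 6 * (2^-1 * co x 5) + co y 7 * (3 / 2 * co x 4)
  | 8 => - co x 0 * co y 9
  | 9 => co x 0 * co y 8
  | 10 => co x 0 * co y 11
  | 11 => - co x 0 * co y 10
  | _ => 0
  end.

(** The linear part of the left translation by x. The rotation is
    exp(x_0 rho(e_1)); the terms in x_4, ..., x_7 form a bilinear map with integral
    coefficients whose antisymmetrization is the bracket of the nilpotent summand. *)
Definition act_co x y (k : nat) : R :=
  match k with
  | 0 => co y 0
  | 1 => co y 1 + (co x 4 * co y 5 - co x 6 * co y 7)
  | 2 => co y 2 + (co x 4 * co y 6 + co x 5 * co y 7)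
  | 3 => co y 3 + (co x 4 * co y 7 - co x 5 * co y 6)
  | 4 => co y 4
  | 5 => co y 5
  | 6 => co y 6
  | 7 => co y 7
  | 8 => cos (co x 0) * co y 8 - sin (co x 0) * co y 9
  | 9 => sin (co x 0) * co y 8 + cos (co x 0) * co y 9
  | 10 => cos (co x 0) * co y 10 + sin (co x 0) * co y 11
  | 11 => - sin (co x 0) * co y 10 + cos (co x 0) * co y 11
  | _ => 0
  end.

(** The derivative of [act] in its first argument at 0: a left-symmetric product
    whose commutator is the bracket. *)
Definition dact_co x y (k : nat) : R :=
  match k with
  | 1 => co x 4 * co y 5 - co x 6 * co y 7
  | 2 => co x 4 * co y 6 + co x 5 * co y 7
  | 3 => co x 4 * co y 7 - co x 5 * co y 6
  | 8 => - co x 0 * co y 9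
  | 9 => co x 0 * co y 8
  | 10 => co x 0 * co y 11
  | 11 => - co x 0 * co y 10
  | _ => 0
  end.

Definition bismut x y : V := vec 12 (bismut_co x y).
Definition obata x y : V := vec 12 (obata_co x y).
Definition act x y : V := vec 12 (act_co x y).
Definition dact x y : V := vec 12 (dact_co x y).

Lemma bismut_bilinear : is_bilinear bismut.
Proof. by split=> a u v w; by_coordinates. Qed.

Lemma bismut_metric x y z :
  form (gt R) (bismut x y) z + form (gt R) y (bismut x z) = 0.
Proof. by_components. Qed.

Lemma bismut_Jt a x y : bismut x (Jt R a *m y) = Jt R a *m bismut x y.
Proof. by elim/I3_ind: a; rewrite !JtE /Jact /=; by_coordinates. Qed.

Lemma bismut_torsion : alternating3 (torsion_form (gt R) (torsion_lie bracket bismut)).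
Proof.
by move=> u v; rewrite /torsion_form /torsion_lie; split; by_components.
Qed.

Lemma obata_bilinear : is_bilinear obata.
Proof. by split=> a u v w; by_coordinates. Qed.

Lemma obata_torsion x y : obata x y - obata y x = bracket x y.
Proof.
apply: co_inj; do 12? [case=> [_|]]; last by [];
  do 3! rewrite ?(coD, coN, co_vec) //=; by field; rewrite ?pnatr_eq0.
Qed.

Lemma obata_Jt a x y : obata x (Jt R a *m y) = Jt R a *m obata x y.
Proof. by elim/I3_ind: a; rewrite !JtE /Jact /=; by_coordinates. Qed.

Lemma dact_bilinear : is_bilinear dact.
Proof. by split=> a u v w; by_coordinates. Qed.

Lemma dact_bracket x y : dact x y - dact y x = bracket x y.
Proof. by_coordinates. Qed.

Lemma act_linear x a u v : act x (a *: u + v) = a *: act x u + act x v.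
Proof. by_coordinates. Qed.

(** This is what makes x + act x y an associative product. *)
Lemma act_act x y v : act (x + act x y) v = act x (act y v).
Proof.
apply: co_inj; do 12? [case=> [_|]]; last by [];
  do 3! rewrite ?(coD, co_vec) //=; rewrite ?cosD ?sinD; ring.
Qed.

Lemma actN x v : act (- x) (act x v) = v.
Proof.
apply: co_inj; do 12? [case=> [_|]]; last by [];
  do 3! rewrite ?(coN, co_vec) //=; rewrite ?cosN ?sinN; try ring.
all: rewrite -[RHS]mul1r -(cos2Dsin2 (co x 0)); ring.
Qed.

Lemma act0 v : act 0 v = v.
Proof.
apply: co_inj; do 12? [case=> [_|]]; last by [];
  do 3! rewrite ?(co0, co_vec) //=; rewrite ?cos0 ?sin0; ring.
Qed.

End LieAlgebraExample.

(** * The Lee form, the standard quaternionic structure and the linear part of translations *)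

Section LeeForm.
Context (R : realType).
Local Notation V := 'cV[R]_12.
Implicit Types (x y z u v w : V).

Lemma g_bracketE (x y : 'cV[R]_8) :
  g_bracket x y = usubmx (T_bracket (col_mx x (0 : 'cV[R]_4)) (col_mx y (0 : 'cV[R]_4)) : 'cV_(8 + 4)).
Proof. by rewrite /T_bracket /semidirect !col_mxKu. Qed.

Lemma T_bracket_col (x y : 'cV[R]_8) :
  T_bracket (col_mx x (0 : 'cV[R]_4)) (col_mx y (0 : 'cV[R]_4)) =
  col_mx (g_bracket x y) (0 : 'cV[R]_4).
Proof.
by rewrite /T_bracket /semidirect !col_mxKu !col_mxKd !mulmx0 subr0.
Qed.

Lemma T_lie : is_lie_algebra (@T_bracket R).
Proof.
split=> [|x|x y z].
- by split=> a u v w; rewrite !T_bracketE; case: (bracket_bilinear R).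
- by rewrite T_bracketE bracket_alternating.
- by rewrite !T_bracketE jacobi.
Qed.

Lemma g_lie : is_lie_algebra (@g_bracket R).
Proof.
have [[lT rT] aT jT] := T_lie.
have colD a (x y : 'cV[R]_8) : col_mx (a *: x + y) (0 : 'cV[R]_4) =
    a *: col_mx x (0 : 'cV[R]_4) + col_mx y (0 : 'cV[R]_4).
  by rewrite scale_col_mx add_col_mx scaler0 addr0.
split=> [|x|x y z].
- by split=> a u v w; rewrite !g_bracketE colD (lT, rT) linearP.
- by rewrite g_bracketE aT linear0.
- have := jT (col_mx x (0 : 'cV[R]_4)) (col_mx y (0 : 'cV[R]_4)) (col_mx z (0 : 'cV[R]_4)).
  rewrite !T_bracket_col => /(congr1 (usubmx : 'cV[R]_(8 + 4) -> _)).
  by rewrite !linearD linear0 /= !col_mxKu.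
Qed.

Lemma rho_rep : is_representation (@g_bracket R) (@rho R).
Proof.
split=> [a X Y|X Y]; first by rewrite /rho !mxE scalerDl scalerA.
rewrite /rho -!scalemxAl -!scalemxAr !scalerA [X in _ *: _ - X *: _]mulrC subrr.
rewrite co_inord // /g_bracket !(coD, coN, coZ) !co_delta //= !mulr0 !(addr0, subr0).
by rewrite scale0r.
Qed.

Definition unit_vec (k : nat) : V := vec 12 (fun l => (l == k)%:R).

Lemma sum_unit_vec x : x = \sum_(k < 12) co x k *: unit_vec k.
Proof.
apply: co_inj => l l12.
rewrite [LHS](_ : _ = \sum_(k < 12) co (co x k *: unit_vec k) l).
  by elim/big_rec2: _ => [|i a b _ ->]; rewrite ?co0 ?coD.
rewrite (bigD1 (Ordinal l12)) //= coZ co_vec // eqxx mulr1 big1 ?addr0 // => i il.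
rewrite coZ co_vec // (_ : (l == i) = false) ?mulr0 //.
by apply/negbTE; apply: contra il => /eqP li; apply/eqP/val_inj.
Qed.

(** The matrix of an orthonormal basis is orthogonal, so that the trace of a
    bilinear form can be computed in the standard basis. *)
Lemma trace_onb (B : V -> V -> R) (e : 'I_12 -> V) :
  (forall a u v w, B (a *: u + v) w = a * B u w + B v w) ->
  (forall a u v w, B w (a *: u + v) = a * B w u + B w v) ->
  orthonormal_basis (gt R) e ->
  \sum_i B (e i) (e i) = \sum_(k < 12) B (unit_vec k) (unit_vec k).
Proof.
move=> Bl Br oe.
have Bl0 w : B 0 w = 0 by have := Bl (-1) 0 0 w; rewrite scaler0 addr0 mulN1r addNr.
have Br0 w : B w 0 = 0 by have := Br (-1) 0 0 w; rewrite scaler0 addr0 mulN1r addNr.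
have Bls (r : seq 'I_12) c d w : B (\sum_(k <- r) c k *: d k) w = \sum_(k <- r) c k * B (d k) w.
  by elim: r => [|k r IH]; rewrite ?big_nil // !big_cons Bl IH.
have Brs (r : seq 'I_12) c d w : B w (\sum_(k <- r) c k *: d k) = \sum_(k <- r) c k * B w (d k).
  by elim: r => [|k r IH]; rewrite ?big_nil // !big_cons Br IH.
pose P : 'M[R]_12 := \matrix_(i, j) e j i 0.
have PP : P *m P^T = 1%:M.
  apply: mulmx1C; apply/matrixP => i j; rewrite !mxE -(oe i j) form_gt_sum.
  by apply: eq_bigr => k _; rewrite !mxE !co_ord.
transitivity (\sum_i \sum_(k < 12) \sum_(l < 12) (P k i * P l i) * B (unit_vec k) (unit_vec l)).
  apply: eq_bigr => i _; rewrite {1}(sum_unit_vec (e i)) Bls; apply: eq_bigr => k _.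
  rewrite [B _ (e i)](_ : _ = \sum_(l < 12) co (e i) l * B (unit_vec k) (unit_vec l)).
    rewrite big_distrr /=; apply: eq_bigr => l _.
    by rewrite !mxE !co_ord mulrA.
  by rewrite {1}(sum_unit_vec (e i)) Brs.
rewrite exchange_big; apply: eq_bigr => k _; rewrite exchange_big /=.
have E l : \sum_i P k i * P l i * B (unit_vec k) (unit_vec l) = (k == l)%:R * B (unit_vec k) (unit_vec l).
  rewrite -big_distrl /=; congr (_ * _).
  have /matrixP/(_ k l) := PP; rewrite !mxE => <-.
  by apply: eq_bigr => i _; rewrite !mxE.
rewrite (bigD1 k) //= E eqxx mul1r big1 ?addr0 // => l lk.
by rewrite E eq_sym (negPf lk) mul0r.
Qed.

(** The torsion form: the opposite of the cyclic sum of g(u, [x, y]) on g. As a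
    polynomial in the coordinates it is evaluated on basis vectors by reduction. *)
Definition bismut_torsion_poly (u x y : nat -> R) : R :=
  - ((u 1) * ((x 4) * (y 5) - (x 5) * (y 4) - ((x 6) * (y 7) - (x 7) * (y 6)))
    + (u 2) * ((x 4) * (y 6) - (x 6) * (y 4) + ((x 5) * (y 7) - (x 7) * (y 5)))
    + (u 3) * ((x 4) * (y 7) - (x 7) * (y 4) - ((x 5) * (y 6) - (x 6) * (y 5)))
    + (x 1) * ((y 4) * (u 5) - (y 5) * (u 4) - ((y 6) * (u 7) - (y 7) * (u 6)))
    + (x 2) * ((y 4) * (u 6) - (y 6) * (u 4) + ((y 5) * (u 7) - (y 7) * (u 5)))
    + (x 3) * ((y 4) * (u 7) - (y 7) * (u 4) - ((y 5) * (u 6) - (y 6) * (u 5)))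
    + (y 1) * ((u 4) * (x 5) - (u 5) * (x 4) - ((u 6) * (x 7) - (u 7) * (x 6)))
    + (y 2) * ((u 4) * (x 6) - (u 6) * (x 4) + ((u 5) * (x 7) - (u 7) * (x 5)))
    + (y 3) * ((u 4) * (x 7) - (u 7) * (x 4) - ((u 5) * (x 6) - (u 6) * (x 5)))).

Lemma bismut_torsionE u x y :
  torsion_form (gt R) (torsion_lie (@bracket R) (@bismut R)) u x y =
  bismut_torsion_poly (co u) (co x) (co y).
Proof.
rewrite /torsion_form /torsion_lie form_gtE /bismut_torsion_poly.
do 3! rewrite ?(coD, coN, co_vec) //=; ring.
Qed.

Lemma bismut_torsion_poly_ext (u x x' y y' : nat -> R) : (forall k, (k < 12)%N -> x k = x' k) ->
  (forall k, (k < 12)%N -> y k = y' k) ->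
  bismut_torsion_poly u x y = bismut_torsion_poly u x' y'.
Proof. by move=> xx' yy'; rewrite /bismut_torsion_poly !xx' // !yy'. Qed.

(** In the trace over the basis vectors e_i only the terms - g(u, [e_i, J e_i])
    with i = 5, ..., 8 are left, and they cancel in pairs. *)
Lemma lee_gt : lee_form_vanishes (gt R) (Jt R)
  (torsion_form (gt R) (torsion_lie (@bracket R) (@bismut R))).
Proof.
move=> a e v oe; rewrite /lee_form.
pose B x y := torsion_form (gt R) (torsion_lie (@bracket R) (@bismut R)) (Jt R a *m v) x (Jt R a *m y).
have [bl br] := bracket_bilinear R; have [dl dr] := bismut_bilinear R.
have tl b x y z : torsion_lie (@bracket R) (@bismut R) (b *: x + y) z =
    b *: torsion_lie (@bracket R) (@bismut R) x z + torsion_lie (@bracket R) (@bismut R) y z.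
  by apply: co_inj => k _; rewrite /torsion_lie bl dl dr !(coD, coN, coZ); ring.
have tr b x y z : torsion_lie (@bracket R) (@bismut R) z (b *: x + y) =
    b *: torsion_lie (@bracket R) (@bismut R) z x + torsion_lie (@bracket R) (@bismut R) z y.
  by apply: co_inj => k _; rewrite /torsion_lie br dl dr !(coD, coN, coZ); ring.
have fr b x y z : form (gt R) z (b *: x + y) = b * form (gt R) z x + form (gt R) z y.
  by rewrite !form_gtE !(coD, coZ); ring.
rewrite (_ : \sum_i _ = \sum_i B (e i) (e i)) // (trace_onb _ _ oe); last first.
- by move=> b x y z; rewrite /B mulmxDr -scalemxAr /torsion_form tr fr.
- by move=> b x y z; rewrite /B /torsion_form tl fr.
rewrite (_ : \sum_(k < 12) _ = 0) ?mulr0 // /B.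
move: (Jt R a *m v) => u {B v oe e}.
pose d (k j : nat) : R := (j == k)%:R.
have unit_vecE k j : (j < 12)%N -> co (unit_vec k) j = d k j by move=> j12; rewrite co_vec.
elim/I3_ind: a.
- rewrite (eq_bigr (fun k : 'I_12 => bismut_torsion_poly (co u) (d k)
    (fun j => [:: - d k 1; d k 0; - d k 3; d k 2; - d k 5; 
      d k 4; - d k 7; d k 6; - d k 9; d k 8; - d k 11; d k 10]`_j))) => [|k _]; last first.
    rewrite bismut_torsionE; apply: bismut_torsion_poly_ext => [|j j12]; first exact: unit_vecE.
    by rewrite JtE /Jact co_vec //=; move: j j12; do 12? [case=> [_|]]; rewrite //= !unit_vecE.
  transitivity (\sum_(k < 12) [:: 0; 0; 0; 0; - co u 1; - co u 1; co u 1; co u 1; 0; 0; 0; 0]`_k).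
    apply: eq_bigr => -[k k12] _; move: k k12; do 12? [case=> [?|]]; last by [].
    all: rewrite /bismut_torsion_poly /d /=; try ring.
  by rewrite !big_ord_recr big_ord0 /=; ring.
- rewrite (eq_bigr (fun k : 'I_12 => bismut_torsion_poly (co u) (d k)
    (fun j => [:: - d k 2; d k 3; d k 0; - d k 1; 
      - d k 6; d k 7; d k 4; - d k 5; - d k 10; d k 11; d k 8; - d k 9]`_j))) => [|k _]; last first.
    rewrite bismut_torsionE; apply: bismut_torsion_poly_ext => [|j j12]; first exact: unit_vecE.
    by rewrite JtE /Jact co_vec //=; move: j j12; do 12? [case=> [_|]]; rewrite //= !unit_vecE.
  transitivity (\sum_(k < 12) [:: 0; 0; 0; 0; - co u 2; co u 2; - co u 2; co u 2; 0; 0; 0; 0]`_k).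
    apply: eq_bigr => -[k k12] _; move: k k12; do 12? [case=> [?|]]; last by [].
    all: rewrite /bismut_torsion_poly /d /=; try ring.
  by rewrite !big_ord_recr big_ord0 /=; ring.
- rewrite (eq_bigr (fun k : 'I_12 => bismut_torsion_poly (co u) (d k)
    (fun j => [:: - d k 3; - d k 2; d k 1; d k 0; 
      - d k 7; - d k 6; d k 5; d k 4; - d k 11; - d k 10; d k 9; d k 8]`_j))) => [|k _]; last first.
    rewrite bismut_torsionE; apply: bismut_torsion_poly_ext => [|j j12]; first exact: unit_vecE.
    by rewrite JtE /Jact co_vec //=; move: j j12; do 12? [case=> [_|]]; rewrite //= !unit_vecE.
  transitivity (\sum_(k < 12) [:: 0; 0; 0; 0; - co u 3; co u 3; co u 3; - co u 3; 0; 0; 0; 0]`_k).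
    apply: eq_bigr => -[k k12] _; move: k k12; do 12? [case=> [?|]]; last by [].
    all: rewrite /bismut_torsion_poly /d /=; try ring.
  by rewrite !big_ord_recr big_ord0 /=; ring.
Qed.

(** The matrices of the left multiplications by i, j, k, row by row. *)
Definition quat_table (a : 'I_3) : seq (seq R) :=
  if a == 0 then [:: [:: 0; -1; 0; 0]; [:: 1; 0; 0; 0]; [:: 0; 0; 0; -1]; [:: 0; 0; 1; 0]]
  else if a == 1 then [:: [:: 0; 0; -1; 0]; [:: 0; 0; 0; 1]; [:: 1; 0; 0; 0]; [:: 0; -1; 0; 0]]
  else [:: [:: 0; 0; 0; -1]; [:: 0; 0; -1; 0]; [:: 0; 1; 0; 0]; [:: 1; 0; 0; 0]].

Lemma quatE a i j : (i < 4)%N -> (j < 4)%N ->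
  quat R a (inord i) (inord j) = nth 0 (nth [::] (quat_table a) i) j.
Proof.
move=> i4 j4; rewrite /quat /quat_table; case: ifP => _; last case: ifP => _;
rewrite !mxE -!val_eqE /= !inordK //;
  by move: i i4 j j4; do 4? [case=> [_|]]; last (by []); do 4? [case=> [_|]]; last (by []);
  rewrite //= ?subr0 ?sub0r ?addr0 ?add0r ?oppr0.
Qed.

(** The basis e_1, ..., e_8, f_1, ..., f_4 is a quaternionic one. *)
Lemma quatH_Jt (a : 'I_3) : quatH R 3 a = Jt R a.
Proof.
apply: mx_ext => v; rewrite JtE; apply: co_inj => k k12.
rewrite (co_ord _ (Ordinal k12)) mxE /=.
transitivity (\sum_(j < 12) (if (k %/ 4 == j %/ 4)%N then
   nth 0 (nth [::] (quat_table a) (k %% 4)) (j %% 4) else 0) * co v j).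
  apply: eq_bigr => j _; rewrite mxE co_ord /=; case: ifP => // _.
  by rewrite quatE // ltn_mod.
move: k k12; do 12? [case=> [_|]]; last by [].
all: rewrite !big_ord_recr big_ord0 /= !mul0r !add0r ?addr0 /Jact co_vec //.
all: elim/I3_ind: a; rewrite /quat_table /=; ring.
Qed.

(** The group law will be x * y = x + A x *m y. *)
Definition A w : 'M[R]_12 := mxof (act w).

Lemma AE w v : A w *m v = act w v.
Proof. by apply: mxofE => a x y; exact: act_linear. Qed.

Lemma A_mul x y : A (x + A x *m y) = A x *m A y.
Proof. by apply: mx_ext => v; rewrite AE -mulmxA !AE act_act. Qed.

Lemma A_mulV x : A (- x) *m A x = 1%:M.
Proof. by apply: mx_ext => v; rewrite -mulmxA !AE actN mul1mx. Qed.

Lemma A_mulVr x : A x *m A (- x) = 1%:M.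
Proof. exact: mulmx1C (A_mulV x). Qed.

Lemma A0 : A 0 = 1%:M.
Proof. by apply: mx_ext => v; rewrite AE act0 mul1mx. Qed.

End LeeForm.

(** * Maps of class C^k on open sets *)

Section Ck.
Context (R : realType).
Implicit Types (V W X : normedModType R).

(** The difference of the two maps vanishes near x, hence is differentiable at x. *)
Lemma near_eq_differentiable V W (f g : V -> W) x :
  (\forall y \near x, f y = g y) -> differentiable f x -> differentiable g x.
Proof.
move=> fg df; pose h y := g y - f y.
have h0 : \forall y \near 0, h (y + x) = 0.
  have : \forall y \near x, h y = 0 by near=> y; rewrite /h -(near fg y) // subrr.
  by rewrite (near_shift 0) subr0.
have hx : h x = 0 by have := nbhs_singleton h0; rewrite add0r.
have hE : h \o shift x = cst (h x) + 0 +o_ 0 id.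
  apply/eqaddoP => e e0; near=> y.
  rewrite /= hx !fctE (near h0 y) //.
  rewrite [X in `|X|](_ : _ = 0); last by rewrite !add0r; exact: oppr0.
  by rewrite normr0 mulr_ge0 //; exact: ltW.
have dh : 'd h x = 0 :> (V -> W).
  apply: (@diff_unique _ _ _ h (@GRing.Linear.clone _ _ _ _ \0%R _)) => //.
  by move=> y; exact: cvg_cst.
have -> : g = f + h by apply/funext => y; rewrite !fctE /h addrC subrK.
apply: differentiableD => //; apply/diff_locallyP; rewrite dh; split=> //.
by move=> y; exact: cvg_cst.
Unshelve. all: by end_near. Qed.

Lemma derive_comp_linear V W X (L : {linear W -> X}) (f : V -> W) x v :
  continuous L -> differentiable f x ->
  'D_v (fun y => L (f y)) x = L ('D_v f x).
Proof.
move=> cL df; rewrite !deriveE //; last first.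
  by apply: differentiable_comp => //; exact: linear_differentiable.
rewrite diff_comp //=; last exact: linear_differentiable.
by rewrite diff_lin.
Qed.

Section OnOpen.
Variables (V : normedModType R) (U : set V).
Hypothesis Uo : open U.

Lemma near_open x (P : V -> Prop) : U x -> (forall y, U y -> P y) ->
  \forall y \near x, P y.
Proof. by move=> Ux UP; apply: filterS UP _; exact: open_nbhs_nbhs. Qed.

Lemma Ck_congr W k (f g : V -> W) :
  (forall x, U x -> f x = g x) -> Ck_on k U f -> Ck_on k U g.
Proof.
elim: k f g => [|k IH] f g fg /=.
  move=> cf x Ux; suff : g y @[y --> x] --> g x by [].
  rewrite -(fg x Ux); apply: cvg_trans (cf x Ux); apply: near_eq_cvg.
  by apply: near_open => // y Uy; exact: fg.
move=> [df Df]; split=> [x Ux|v].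
  by apply: near_eq_differentiable (df x Ux); exact: near_open.
apply: IH (Df v) => x Ux; apply: near_eq_derive; exact: near_open.
Qed.

Lemma Ck_pred W k (f : V -> W) : Ck_on k.+1 U f -> Ck_on k U f.
Proof.
elim: k f => [|k IH] f [df Df]; first by move=> x Ux; exact: differentiable_continuous (df x Ux).
by split=> // v; exact: IH (Df v).
Qed.

Lemma Ck_cst W k (c : W) : Ck_on k U (fun=> c).
Proof.
elim: k c => [|k IH] c /=; first by move=> x Ux; exact: cvg_cst.
split=> [x Ux|v]; first exact: differentiable_cst.
by apply: Ck_congr (IH 0) => x _; rewrite derive_cst.
Qed.

Lemma Ck_linear W k (L : {linear V -> W}) : continuous L -> Ck_on k U L.
Proof.
move=> cL; case: k => [|k] /=; first by move=> x _; exact: cL.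
split=> [x _|v]; first exact: linear_differentiable.
apply: Ck_congr (Ck_cst k (L v)) => x _.
by rewrite deriveE ?diff_lin //; exact: linear_differentiable.
Qed.

Lemma Ck_comp_linear W X k (L : {linear W -> X}) (f : V -> W) :
  continuous L -> Ck_on k U f -> Ck_on k U (fun x => L (f x)).
Proof.
move=> cL; elim: k f => [|k IH] f /=.
  move=> cf x Ux; apply: continuous_comp; [exact: cf|exact: cL].
move=> [df Df]; split=> [x Ux|v].
  by apply: differentiable_comp; [exact: df|exact: linear_differentiable].
apply: Ck_congr (IH _ (Df v)) => x Ux.
by rewrite derive_comp_linear //; exact: df.
Qed.

Lemma Ck_add W k (f g : V -> W) :
  Ck_on k U f -> Ck_on k U g -> Ck_on k U (fun x => f x + g x).
Proof.
elim: k f g => [|k IH] f g /=.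
  by move=> cf cg x Ux; apply: cvgD; [exact: cf|exact: cg].
move=> [df Df] [dg Dg]; split=> [x Ux|v].
  by apply: (@differentiableD _ _ _ f g); [exact: df|exact: dg].
apply: Ck_congr (IH _ _ (Df v) (Dg v)) => x Ux.
by rewrite (@deriveD _ _ _ f g) //; apply: diff_derivable; [exact: df|exact: dg].
Qed.

Lemma Ck_mul k (f g : V -> R) :
  Ck_on k U f -> Ck_on k U g -> Ck_on k U (fun x => f x * g x).
Proof.
elim: k f g => [|k IH] f g.
  by move=> cf cg x Ux; apply: cvgM; [exact: cf|exact: cg].
move=> Cf Cg; have [df Df] := Cf; have [dg Dg] := Cg; split=> [x Ux|v].
  by apply: (@differentiableM _ _ f g); [exact: df|exact: dg].
have := Ck_add (IH _ _ (Ck_pred Cf) (Dg v)) (IH _ _ (Ck_pred Cg) (Df v)).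
apply: Ck_congr => x Ux.
by rewrite (@deriveM _ _ f g) //; apply: diff_derivable; [exact: df|exact: dg].
Qed.

Lemma Ck_sin_cos k (L : {linear V -> R}) : continuous L ->
  Ck_on k U (fun x => sin (L x)) /\ Ck_on k U (fun x => cos (L x)).
Proof.
move=> cL; elim: k => [|k [IHs IHc]] /=.
  split=> x _; apply: continuous_comp; try exact: cL.
    exact: continuous_sin.
  exact: continuous_cos.
have ds y : differentiable (sin : R -> R) y.
  by apply/derivable1_diffP; exact: derivable_sin.
have dc y : differentiable (cos : R -> R) y.
  by apply/derivable1_diffP; exact: derivable_cos.
have dL x : differentiable L x by exact: linear_differentiable.
split; split=> [x _|v]; try by apply: differentiable_comp.
  have := Ck_mul (Ck_cst k (L v)) IHc; apply: Ck_congr => x _.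
  rewrite deriveE; last exact: differentiable_comp.
  rewrite (diff_comp (dL x) (ds _)) /= diff_lin //.
  rewrite deriv1E; last by apply/derivable1_diffP.
  by rewrite derive1E derive_val.
have := Ck_mul (Ck_cst k (- L v)) IHs; apply: Ck_congr => x _.
rewrite deriveE; last exact: differentiable_comp.
rewrite (diff_comp (dL x) (dc _)) /= diff_lin //.
rewrite deriv1E; last by apply/derivable1_diffP.
rewrite derive1E derive_val [RHS](_ : _ = L v * - sin (L x)) //.
by rewrite mulrN mulNr.
Qed.

End OnOpen.
End Ck.

(** * Maps that are smooth near a point *)

Section SmoothNear.
Context (R : realType).
Implicit Types (V W X : normedModType R).

Lemma Ck_sub V W k (U U' : set V) (f : V -> W) :
  U' `<=` U -> Ck_on k U f -> Ck_on k U' f.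
Proof.
move=> sU; elim: k f => [|k IH] f /=; first by move=> cf x /sU; exact: cf.
by move=> [df Df]; split=> [x /sU|v]; [exact: df|exact: IH].
Qed.

Lemma near_smooth_near V W (f : V -> W) x :
  smooth_near f x -> \forall y \near x, smooth_near f y.
Proof.
move=> [U [Uo Ux fU]]; near=> y; exists U; split=> //; near: y.
exact: open_nbhs_nbhs.
Unshelve. all: by end_near. Qed.

Lemma smooth_near_diff V W (f : V -> W) x : smooth_near f x -> differentiable f x.
Proof. by move=> [U [Uo Ux /(_ 1%N) [df _]]]; exact: df. Qed.

Lemma smooth_near_continuous V W (f : V -> W) x :
  smooth_near f x -> {for x, continuous f}.
Proof. by move=> /smooth_near_diff; exact: differentiable_continuous. Qed.

Lemma smooth_near_eq V W (f g : V -> W) x : (\forall y \near x, f y = g y) ->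
  smooth_near f x -> smooth_near g x.
Proof.
move=> fg; have : nbhs x [set y | f y = g y] := fg.
rewrite nbhsE => -[U' [U'o U'x] {}fg] [U [Uo Ux fU]].
have Io : open (U `&` U') by exact: openI.
exists (U `&` U'); split=> // k; apply: (@Ck_congr _ _ _ Io _ _ f) => [y [_ /fg]//|].
exact: Ck_sub (fU k).
Qed.

Lemma smooth_near_derive V W (f : V -> W) x v :
  smooth_near f x -> smooth_near ('D_v f) x.
Proof.
move=> [U [Uo Ux fU]]; exists U; split=> // k.
by have [_ /(_ v)] := fU k.+1.
Qed.

(** Smoothness is a local property, even though [smooth_on] takes iterated
    derivatives on the whole open set. *)
Lemma smooth_near_on V W (U : set V) (f : V -> W) :
  (forall x, U x -> smooth_near f x) -> smooth_on U f.
Proof.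
move=> fU k; elim: k f fU => [|k IH] f fU /=.
  by move=> x Ux; exact: smooth_near_continuous (fU x Ux).
split=> [x Ux|v]; first exact: smooth_near_diff (fU x Ux).
by apply: IH => x Ux; exact: smooth_near_derive (fU x Ux).
Qed.

Lemma smooth_near_all V W (f : V -> W) x : (forall k, Ck_on k setT f) -> smooth_near f x.
Proof. by move=> fT; exists setT; split=> //; exact: openT. Qed.

Lemma smooth_near_cst V W (c : W) (x : V) : smooth_near (fun=> c) x.
Proof. by apply: smooth_near_all => k; exact: Ck_cst openT _ _ _. Qed.

Lemma smooth_near_comp_linear V W X (L : W -> X) (f : V -> W) x :
  linear L -> continuous L -> smooth_near f x -> smooth_near (fun y => L (f y)) x.
Proof.
move=> linL cL [U [Uo Ux fU]]; exists U; split=> // k.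
pose LM := GRing.isLinear.Build _ _ _ _ _ linL.
pose Ll : {linear _ -> _} := HB.pack L LM.
exact: (@Ck_comp_linear _ _ _ Uo _ _ _ Ll).
Qed.

Lemma smooth_near_linear V W (L : V -> W) x :
  linear L -> continuous L -> smooth_near L x.
Proof.
move=> linL cL; apply: smooth_near_all => k.
pose LM := GRing.isLinear.Build _ _ _ _ _ linL.
pose Ll : {linear _ -> _} := HB.pack L LM.
exact: (@Ck_linear _ _ _ openT _ _ Ll).
Qed.

Lemma smooth_near_sin_cos V (L : V -> R) x :
  linear L -> continuous L ->
  smooth_near (fun y => sin (L y)) x /\ smooth_near (fun y => cos (L y)) x.
Proof.
move=> linL cL.
pose LM := GRing.isLinear.Build _ _ _ _ _ linL.
pose Ll : {linear _ -> _} := HB.pack L LM.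
by split; apply: smooth_near_all => k; have [] := @Ck_sin_cos _ _ _ openT k Ll cL.
Qed.

Lemma smooth_near_add V W (f g : V -> W) x :
  smooth_near f x -> smooth_near g x -> smooth_near (fun y => f y + g y) x.
Proof.
move=> [U [Uo Ux fU]] [U' [U'o U'x gU]].
have Io : open (U `&` U') by exact: openI.
exists (U `&` U'); split=> // k; apply: (Ck_add Io).
  exact: Ck_sub (fU k).
exact: Ck_sub (gU k).
Qed.

Lemma smooth_near_mul V (f g : V -> R) x :
  smooth_near f x -> smooth_near g x -> smooth_near (fun y => f y * g y) x.
Proof.
move=> [U [Uo Ux fU]] [U' [U'o U'x gU]].
have Io : open (U `&` U') by exact: openI.
exists (U `&` U'); split=> // k; apply: (Ck_mul Io).
  exact: Ck_sub (fU k).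
exact: Ck_sub (gU k).
Qed.

Lemma smooth_near_sum V W (I : Type) (r : seq I) (f : I -> V -> W) x :
  (forall i, smooth_near (f i) x) -> smooth_near (fun y => \sum_(i <- r) f i y) x.
Proof.
move=> fx; elim: r => [|i r IH].
  by rewrite (_ : (fun _ => _) = fun=> 0); [exact: smooth_near_cst|apply/funext => y; rewrite big_nil].
rewrite (_ : (fun _ => _) = fun y => f i y + \sum_(j <- r) f j y).
  exact: smooth_near_add.
by apply/funext => y; rewrite big_cons.
Qed.

Lemma entry_linear m n (i : 'I_m) (j : 'I_n) : linear (fun A : 'M[R]_(m, n) => A i j).
Proof. by move=> a A B; rewrite !mxE. Qed.

Lemma smooth_near_entry V m n (f : V -> 'M[R]_(m, n)) x i j :
  smooth_near f x -> smooth_near (fun y => f y i j) x.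
Proof.
have := @smooth_near_comp_linear V _ _ (fun A : 'M[R]_(m,n) => A i j) f x
  (@entry_linear m n i j) (@matrix_normedtype.coord_continuous _ _ _ i j).
by [].
Qed.

Lemma smooth_near_mx V m n (f : V -> 'M[R]_(m, n)) x :
  (forall i j, smooth_near (fun y => f y i j) x) -> smooth_near f x.
Proof.
move=> fx; rewrite (_ : f = fun y => \sum_i \sum_j f y i j *: delta_mx i j); last first.
  by apply/funext => y; rewrite -matrix_sum_delta.
apply: smooth_near_sum => i; apply: smooth_near_sum => j.
apply: (@smooth_near_comp_linear _ _ _ (fun a : R => a *: delta_mx i j)) => //.
  by move=> a b c; rewrite scalerDl scalerA.
exact: scalel_continuous.
Qed.

Lemma smooth_near_mulmx V m n p (f : V -> 'M[R]_(m, n)) (g : V -> 'M[R]_(n, p)) x :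
  smooth_near f x -> smooth_near g x -> smooth_near (fun y => f y *m g y) x.
Proof.
move=> fx gx; apply: smooth_near_mx => i j.
rewrite (_ : (fun _ => _) = fun y => \sum_k f y i k * g y k j).
  apply: smooth_near_sum => k.
  by apply: smooth_near_mul; apply: smooth_near_entry.
by apply/funext => y; rewrite mxE.
Qed.

Lemma derive_entry V m n (f : V -> 'M[R]_(m, n)) x v i j :
  differentiable f x -> 'D_v f x i j = 'D_v (fun y => f y i j) x.
Proof. by move=> df; rewrite derive_mx ?mxE //; exact: diff_derivable. Qed.

Lemma cV_sum_delta n (v : 'cV[R]_n) : v = \sum_i v i 0 *: delta_mx i 0.
Proof. by rewrite [LHS]matrix_sum_delta; apply: eq_bigr => i _; rewrite big_ord1. Qed.

(** The derivative along X is the combination of the partial derivatives whose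
    coefficients are the components of X. *)
Lemma smooth_near_dir n m p (f : 'cV[R]_n -> 'M[R]_(m, p)) (X : 'cV[R]_n -> 'cV[R]_n) x :
  smooth_near f x -> smooth_near X x -> smooth_near (fun y => 'D_(X y) f y) x.
Proof.
move=> fx Xx; apply: smooth_near_mx => i j.
apply: (@smooth_near_eq _ _ (fun y => \sum_k X y k 0 * 'D_(delta_mx k 0) f y i j)).
  have := near_smooth_near fx; apply: filterS => y fy.
  have df := smooth_near_diff fy.
  rewrite deriveE // [in RHS](cV_sum_delta (X y)) linear_sum summxE.
  by apply: eq_bigr => k _; rewrite linearZ mxE deriveE.
apply: smooth_near_sum => k; apply: smooth_near_mul; first exact: smooth_near_entry.
by apply: smooth_near_entry; exact: smooth_near_derive.
Qed.

End SmoothNear.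

(** * The solvable Lie group *)

Section Space.
Context (R : realType).

Lemma ball_co n (x y : 'cV[R]_n) e : ball x e y ->
  forall k, (k < n)%N -> `|co x k - co y k| < e.
Proof. by move=> [_ xy] k kn; have := xy (Ordinal kn) 0; rewrite -!co_ord. Qed.

(** The balls with rational centres and radii 1 / (n + 1) form a basis. *)
Lemma second_countable_cV n : @second_countable 'cV[R]_n.
Proof.
pose f (q : 'cV[rat]_n * nat) : set 'cV[R]_n := ball (map_mx ratr q.1 : 'cV[R]_n) q.2.+1%:R^-1.
exists (range f); first by apply: sub_countable (card_image_le _ _) _; first exact: countableP.
split=> [_ [q _ <-]|x A]; first by apply: ball_open; rewrite invr_gt0.
move=> /nbhs_ballP [e /= e0 eA].
have [N _ /(_ _ (leqnn N)) Ne] : \forall n \near \oo, n.+1%:R^-1 < e / 2 :> R.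
  by apply: near_infty_natSinv_lt (PosNum (divr_gt0 e0 (ltr0Sn R 1))).
have q i : {q : rat | ratr q \in `]x i 0 - N.+1%:R^-1, x i 0 + N.+1%:R^-1[}.
  apply: cid; apply: rat_in_itvoo; rewrite ltrD2l.
  by rewrite -subr_gt0 opprK addr_gt0 // invr_gt0.
have xq : f (\col_i sval (q i), N) x.
  split=> [|i j]; first by rewrite invr_gt0.
  rewrite (ord1 j) !mxE /=; case: (q i) => r /=; rewrite in_itv /= => rx.
  by rewrite /ball /= ltr_distlC; rewrite -ltr_distlC distrC ltr_distlC.
exists (f (\col_i sval (q i), N)); first by split=> //; exists (\col_i sval (q i), N).
move=> y yq; apply: eA; rewrite (splitr e).
apply: (@ball_triangle _ _ (map_mx ratr (\col_i sval (q i)) : 'cV[R]_n)).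
  by apply: ball_sym; apply: le_ball xq; exact: ltW.
by apply: le_ball yq; exact: ltW.
Qed.

Lemma second_countable_image (T Q : topologicalType) (f : T -> Q) :
  (forall y, exists x, f x = y) -> continuous f ->
  (forall U, open U -> open (f @` U)) -> @second_countable T -> @second_countable Q.
Proof.
move=> surj cf of_ [B cB [Bo Bb]].
exists ((fun U => f @` U) @` B); first exact: sub_countable (card_image_le _ _) cB.
split=> [_ [U BU <-]|y A Ay]; first by apply: of_; exact: Bo.
have [x xy] := surj y.
have : nbhs x (f @^-1` A) by apply: cf; rewrite xy.
move=> /Bb [U [BU Ux] UA]; exists (f @` U).
  by split; [exists U|exists x].
by move=> _ [z Uz <-]; exact: UA.
Qed.

End Space.

(** An alias of R^12, which carries the group law [smul]. *)
Definition solv (R : realType) : Type := 'cV[R]_12.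
HB.instance Definition _ (R : realType) := Topological.copy (solv R) 'cV[R]_12.

Section Group.
Context (R : realType).

Definition smul (x y : 'cV[R]_12) : 'cV[R]_12 := x + A x *m y.
Definition sinv (x : 'cV[R]_12) : 'cV[R]_12 := - (A (- x) *m x).

Lemma smulA : associative smul.
Proof. by move=> x y z; rewrite /smul A_mul mulmxDr addrA mulmxA. Qed.

Lemma smul0l : left_id 0 smul.
Proof. by move=> x; rewrite /smul A0 mul1mx add0r. Qed.

Lemma smul0r : right_id 0 smul.
Proof. by move=> x; rewrite /smul mulmx0 addr0. Qed.

Lemma A_sinv (x : 'cV[R]_12) : A (sinv x) = A (- x).
Proof.
have : A (- x) *m A x *m A (sinv x) = A (- x) .
  rewrite -mulmxA -A_mul /sinv.
  by rewrite mulmxN mulmxA A_mulVr mul1mx subrr A0 mulmx1.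
by rewrite A_mulV mul1mx.
Qed.

Lemma smulV : left_inverse 0 sinv smul.
Proof. by move=> x; rewrite /smul A_sinv /sinv addNr. Qed.

Lemma smulVr : right_inverse 0 sinv smul.
Proof. by move=> x; rewrite /smul /sinv mulmxN mulmxA A_mulVr mul1mx subrr. Qed.

HB.instance Definition _ := isGroup.Build (solv R) smulA smul0l smul0r smulV smulVr.

Lemma smooth_near_id (V : normedModType R) (x : V) : smooth_near id x.
Proof.
by apply: smooth_near_linear; [move=> a u v; reflexivity|move=> z; exact: cvg_id].
Qed.

Lemma open_setT_coord : open ((id : solv R -> 'cV[R]_12) @` setT).
Proof. by rewrite image_id; exact: openT. Qed.

Lemma solv_transition (x y : solv R) :
  smooth_on ((id : solv R -> 'cV[R]_12) @` (setT `&` setT))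
    ((id : solv R -> 'cV[R]_12) \o (id : 'cV[R]_12 -> solv R)).
Proof.
by apply: smooth_near_on => w _; exact: smooth_near_id.
Qed.

HB.instance Definition _ := @isManifold.Build R 12 (solv R)
  (fun _ => setT) (fun _ => id) (fun _ => id)
  (@norm_hausdorff _ 'cV[R]_12) (second_countable_cV R 12)
  (fun _ => openT) (fun _ => I) (fun _ => open_setT_coord)
  (fun _ _ _ => erefl) (fun _ _ _ => @cvg_id _ _) (fun _ _ _ => @cvg_id _ _)
  solv_transition.

Lemma co_linear n k : linear (fun x : 'cV[R]_n => co x k).
Proof. by move=> a x y; rewrite coD coZ. Qed.

Lemma co_continuous n k : continuous (fun x : 'cV[R]_n => co x k).
Proof.
case: (ltnP k n) => kn x.
  rewrite (_ : (fun _ => _) = fun y : 'cV[R]_n => y (Ordinal kn) 0).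
    exact: matrix_normedtype.coord_continuous.
  by apply/funext => y; rewrite (co_ord y (Ordinal kn)).
rewrite (_ : (fun _ => _) = fun=> 0); first exact: cst_continuous.
apply/funext => y; rewrite co.unlock; case: insubP => // i kn'.
by move: kn; rewrite leqNgt kn'.
Qed.

Lemma smooth_near_A (V : normedModType R) (f : V -> 'cV[R]_12) (x : V) :
  linear f -> continuous f -> smooth_near (fun y => A (f y)) x.
Proof.
move=> lf cf; apply: smooth_near_mx => i j.
have lk k : linear (fun y => co (f y) k) by move=> a y z; rewrite lf coD coZ.
have ck k : continuous (fun y => co (f y) k).
  by move=> y; exact: (@continuous_comp _ _ _ f (fun z : 'cV[R]_12 => co z k) y (cf y)
    (@co_continuous _ k _)).
have [ss sc] := smooth_near_sin_cos x (lk 0%N) (ck 0%N).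
pose v : 'cV[R]_12 := delta_mx j 0.
rewrite (_ : (fun y => _) = fun y => act_co (f y) v i); last first.
  by apply/funext => y; rewrite /A mxE -co_ord co_vec.
have sk k : smooth_near (fun y => co (f y) k) x by exact: smooth_near_linear.
have sz (c : R) (g : V -> R) : smooth_near g x -> smooth_near (fun y => g y * c) x.
  by move=> gx; apply: smooth_near_mul => //; exact: smooth_near_cst.
have sN (g : V -> R) : smooth_near g x -> smooth_near (fun y => - g y : R) x.
  move=> gx; rewrite (_ : (fun _ => _) = fun y => g y * -1); first exact: sz.
  by apply/funext => y; rewrite mulrN1.
have sB (g h : V -> R) : smooth_near g x -> smooth_near h x -> smooth_near (fun y => g y - h y : R) x.
  by move=> gx hx; apply: smooth_near_add => //; exact: sN.
case: i => k; do 12? [case: k => [?|k]]; last by [].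
all: rewrite /=.
all: repeat first [exact: smooth_near_cst | exact: sk | exact: ss | exact: sc
  | apply: sN | apply: sz | apply: sB | refine (smooth_near_add _ _)].
Qed.

Lemma smul_smooth (x y : 'cV[R]_12) :
  smooth_near (fun w : 'cV[R]_12 * 'cV[R]_12 => smul w.1 w.2) (x, y).
Proof.
apply: smooth_near_add.
  by apply: smooth_near_linear => // z; exact: cvg_fst.
apply: smooth_near_mulmx.
  by apply: smooth_near_A => // z; exact: cvg_fst.
by apply: smooth_near_linear => // z; exact: cvg_snd.
Qed.

Lemma smul_continuous : continuous (fun z : solv R * solv R => smul z.1 z.2 : solv R).
Proof. by case=> x y; exact: smooth_near_continuous (smul_smooth x y). Qed.

Lemma sinv_smooth (x : 'cV[R]_12) : smooth_near sinv x.
Proof.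
have -> : sinv = fun y => A (- y) *m (- y) by apply/funext => y; rewrite mulmxN.
apply: smooth_near_mulmx.
  apply: smooth_near_A; first by move=> a u v; rewrite opprD scalerN.
  by move=> z; exact: opp_continuous.
apply: smooth_near_linear; first by move=> a u v; rewrite opprD scalerN.
by move=> z; exact: opp_continuous.
Qed.

Lemma sinv_smooth_at (x : solv R) : smooth_at (fun y : solv R => (y^-1)%g) x.
Proof. by split; [exact: smooth_near_continuous (sinv_smooth x)|exact: sinv_smooth]. Qed.

HB.instance Definition _ := @Manifold_isLieGroup.Build R 12 (solv R)
  smul_continuous (fun x y => smul_smooth x y) sinv_smooth_at.

End Group.

(** * Derivatives in the left-invariant frame *)

Section Derivatives.
Context (R : realType).

Lemma is_derive_mulmx (V : normedModType R) m n p (f : V -> 'M[R]_(m, n)) (g : V -> 'M[R]_(n, p)) x v :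
  derivable f x v -> derivable g x v ->
  is_derive x v (fun y => f y *m g y) ('D_v f x *m g x + f x *m 'D_v g x).
Proof.
move=> /[dup] df /derivable_mxP dfe /[dup] dg /derivable_mxP dge.
have E i j : is_derive x v (fun y => (f y *m g y) i j)
    (('D_v f x *m g x + f x *m 'D_v g x) i j).
  rewrite (_ : (fun y => _) = \sum_(k < n) ((fun y => f y i k) * (fun y => g y k j))); last first.
    by apply/funext => y; rewrite fct_sumE mxE.
  have D k : is_derive x v ((fun y => f y i k) * (fun y => g y k j))
     (f x i k *: 'D_v (fun y => g y k j) x + g x k j *: 'D_v (fun y => f y i k) x).
    by apply: is_deriveM; apply: derivableP.
  apply: is_derive_eq.
  rewrite !mxE -big_split /=; apply: eq_bigr => k _.
  rewrite !derive_mx // !mxE addrC; congr (_ + _).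
  by rewrite mulrC.
have d : derivable (fun y => f y *m g y) x v.
  by apply/derivable_mxP => i j; by have [] := E i j.
apply: DeriveDef => //; rewrite derive_mx //.
by apply/matrixP => i j; rewrite mxE; have [_ ->] := E i j.
Qed.

Lemma A_differentiable (w : 'cV[R]_12) : differentiable (@A R) w.
Proof.
by apply: smooth_near_diff; apply: smooth_near_A; [move=> a u v; reflexivity|move=> z; exact: cvg_id].
Qed.

Lemma derive_A0 (y h : 'cV[R]_12) : 'D_y (@A R) 0 *m h = dact y h.
Proof.
have dA := @diff_derivable _ _ _ _ _ y (A_differentiable 0).
have [_] := @is_derive_mulmx _ _ _ _ _ (cst h) _ _ dA (derivable_cst _ _ _).
rewrite derive_cst mulmx0 addr0 => <-.
have cco k : continuous (fun w : 'cV[R]_12 => co w k) by exact: co_continuous.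
pose Lk k : {linear 'cV[R]_12 -> R} := HB.pack (fun w : 'cV[R]_12 => co w k)
  (GRing.isLinear.Build _ _ _ _ _ (@co_linear R 12 k)).
have dco k w : differentiable (fun w : 'cV[R]_12 => co w k) w.
  exact: (@linear_differentiable _ _ _ (Lk k) _ (cco k)).
have Eco k w : 'd (fun w : 'cV[R]_12 => co w k) w y = co y k.
  by rewrite (@diff_lin _ _ _ (Lk k) _ (cco k)).
have Dco k : is_derive (0 : 'cV[R]_12) y (fun w : 'cV[R]_12 => co w k) (co y k).
  by apply: DeriveDef; [exact: diff_derivable|rewrite deriveE // Eco].
have Dcst (r : R) : is_derive (0 : 'cV[R]_12) y (fun=> r) 0 by exact: is_derive_cst.
have Dadd f g (r s : R) : is_derive (0 : 'cV[R]_12) y f r -> is_derive (0 : 'cV[R]_12) y g s ->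
    is_derive (0 : 'cV[R]_12) y (fun w => f w + g w) (r + s) by exact: is_deriveD.
have Dopp f (r : R) : is_derive (0 : 'cV[R]_12) y f r ->
    is_derive (0 : 'cV[R]_12) y (fun w => - f w) (- r) by exact: is_deriveN.
have Dmul f (r s : R) : is_derive (0 : 'cV[R]_12) y f r ->
    is_derive (0 : 'cV[R]_12) y (fun w => f w * s) (r * s).
  move=> Df; have D := is_deriveM Df (is_derive_cst s 0 y).
  have D' : is_derive (0 : 'cV[R]_12) y (fun w => f w * s) _ := D.
  by apply: (is_derive_eq D'); rewrite scaler0 add0r mulrC.
have Dcomp (f : R -> R) : derivable f 0 1 ->
    is_derive (0 : 'cV[R]_12) y (fun w : 'cV[R]_12 => f (co w 0)) (co y 0 * derive1 f 0).
  move=> /derivable1_diffP df; have df' : differentiable f (co (0 : 'cV[R]_12) 0) by rewrite co0.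
  apply: DeriveDef; first by apply: diff_derivable; exact: differentiable_comp.
  rewrite deriveE; last exact: differentiable_comp.
  rewrite (diff_comp (dco _ _) df') /= Eco co0 deriv1E //.
  by apply/derivable1_diffP.
have Dcos : is_derive (0 : 'cV[R]_12) y (fun w : 'cV[R]_12 => cos (co w 0)) 0.
  have D := Dcomp _ (@derivable_cos R 0); apply: (is_derive_eq D).
  by rewrite derive1E derive_val sin0 oppr0 mulr0.
have Dsin : is_derive (0 : 'cV[R]_12) y (fun w : 'cV[R]_12 => sin (co w 0)) (co y 0).
  have D := Dcomp _ (@derivable_sin R 0); apply: (is_derive_eq D).
  by rewrite derive1E derive_val cos0 mulr1.
have Eh : (fun w => A w *m cst h w) = fun w => act w h by apply/funext => w; rewrite AE.
have D k : (k < 12)%N -> is_derive (0 : 'cV[R]_12) y (fun w : 'cV[R]_12 => co (act w h) k) (dact_co y h k).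
  move=> k12; rewrite (_ : (fun _ => _) = fun w => act_co w h k); last by apply/funext => w; rewrite co_vec.
  { move: k k12; do 12? [case=> [_|]]; last by [].
    all: rewrite /=; eapply is_derive_eq.
    all: try (repeat first [exact: Dcst | exact: Dco | exact: Dcos | exact: Dsin
      | eapply Dmul | eapply Dopp | eapply Dadd]).
    all: ring. }
have D' (i : 'I_12) (j : 'I_1) : is_derive (0 : 'cV[R]_12) y (fun w => act w h i j) (dact_co y h i).
  rewrite (ord1 j) (_ : (fun _ => _) = fun w => co (act w h) i); first exact: D.
  by apply/funext => w; rewrite co_ord.
rewrite Eh derive_mx; last by apply/derivable_mxP => i j; have [] := D' i j.
apply: co_inj => k k12; rewrite (co_ord _ (Ordinal k12)) mxE co_vec //.
by have [_ ->] := D' (Ordinal k12) 0.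
Qed.

(** A is a homomorphism, so A (w + A w *m y) = A w *m A y reduces the derivative
    at w to the one at 0. *)
Lemma derive_A (w u h : 'cV[R]_12) : 'D_u (@A R) w *m h = A w *m dact (A (- w) *m u) h.
Proof.
have dA v x := @diff_derivable _ _ _ _ _ v (A_differentiable x).
rewrite -derive_A0 mulmxA; congr (_ *m _).
set y := A (- w) *m u.
have [_] := is_derive_mulmx (derivable_cst (A w) 0 y) (dA y 0).
rewrite derive_cst mul0mx add0r /= => <-; rewrite /derive.
apply: (congr1 (fun F : R -> _ => lim (F t @[t --> 0^']))).
apply/funext => t /=; rewrite A0 mulmx1 addr0; congr (_ *: (_ - _)).
rewrite -A_mul addrC /y -scalemxAr; congr (A (_ + _ *: _)).
by rewrite mulmxA A_mulVr mul1mx.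
Qed.

Lemma derivable_A_comp (V : normedModType R) (k : V -> 'cV[R]_12) x v :
  differentiable k x -> derivable (fun y => A (k y)) x v.
Proof.
move=> dk; apply: diff_derivable; apply: differentiable_comp => //.
exact: A_differentiable.
Qed.

(** The product rule for a vector field with components h in the left-invariant
    frame A, along a curve or family k of points. *)
Lemma is_derive_frame (V : normedModType R) (k h : V -> 'cV[R]_12) x v :
  differentiable k x -> derivable h x v ->
  is_derive x v (fun y => A (k y) *m h y)
    (A (k x) *m (dact (A (- k x) *m 'D_v k x) (h x) + 'D_v h x)).
Proof.
move=> dk dh.
have EA : 'D_v (fun y => A (k y)) x = 'D_('D_v k x) (@A R) (k x).
  rewrite [LHS]deriveE; last by apply: differentiable_comp => //; exact: A_differentiable.
  rewrite [RHS]deriveE; last exact: A_differentiable.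
  rewrite (diff_comp dk (A_differentiable (k x))) /=.
  by rewrite [in RHS]deriveE.
have [d E] := is_derive_mulmx (@derivable_A_comp _ k x v dk) dh.
apply: DeriveDef => //; rewrite E EA derive_A mulmxDr; reflexivity.
Qed.

End Derivatives.

(** * Lie algebra, simple connectedness and solvability of the group *)

Section SolvFacts.
Context (R : realType).
Local Notation V := 'cV[R]_12.

Lemma derive_affine m n (c : 'cV[R]_m) (M : 'M[R]_(m, n)) (w v : 'cV[R]_n) :
  'D_v (fun y => c + M *m y) w = M *m v.
Proof.
have dM : derivable (fun y : 'cV[R]_n => M *m y) w v.
  have [] := is_derive_mulmx (@derivable_cst _ _ _ M w v) (@derivable_id _ _ w v).
  by [].
have := @deriveD _ _ _ (cst c) (fun y => M *m y) w v (@derivable_cst _ _ _ c w v) dM.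
rewrite derive_cst add0r => E; rewrite [LHS]E.
have [_] := is_derive_mulmx (@derivable_cst _ _ _ M w v) (@derivable_id _ _ w v).
by rewrite derive_cst mul0mx add0r derive_id => <-.
Qed.

Lemma left_invE (v : V) (x : solv R) : @left_inv R 12 (solv R) v x = A (x : V) *m v.
Proof. exact: derive_affine. Qed.

Lemma repE (x : solv R) (X : solv R -> V) : rep x X = X.
Proof.
apply/funext => w; rewrite /rep /dcoord.
exact: (@derive_id R V w (X w)).
Qed.

Lemma derive_frame (w u v : V) : 'D_u (fun y => A y *m v) w = A w *m dact (A (- w) *m u) v.
Proof.
have d : derivable (fun _ : V => v) w u by exact: derivable_cst.
have [_] := @is_derive_frame R V id (fun=> v) w u (@ex_diff _ _ _ _ _ _ _ (is_diff_id w)) d.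
by rewrite derive_cst addr0 derive_id => ->.
Qed.

Lemma vf_bracket_solv (X Y : solv R -> V) (x : solv R) :
  vf_bracket X Y x = 'D_(X x) (Y : V -> V) (x : V) - 'D_(Y x) (X : V -> V) (x : V).
Proof. by rewrite /vf_bracket !repE. Qed.

Lemma left_inv_bracket (u v : V) :
  vf_bracket (@left_inv R 12 (solv R) u) (@left_inv R 12 (solv R) v) 1%g = bracket u v.
Proof.
have E y : @left_inv R 12 (solv R) y = (fun x => A (x : V) *m y).
  by apply/funext => x; exact: left_invE.
apply: etrans (vf_bracket_solv _ _ _) _; rewrite !E -dact_bracket.
have D1 (a b : V) : 'D_(A (0 : V) *m a) (fun x : V => A x *m b) (0 : V) = dact a b.
  by rewrite derive_frame oppr0 A0 !mul1mx.
by congr (_ - _); exact: D1.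
Qed.

Lemma solv_lie_algebra : is_lie_algebra_of (@T_bracket R) (solv R) 1%:M.
Proof.
split=> [|u v]; first exact: unitmx1.
apply: etrans (mul1mx _) _; apply: etrans (T_bracketE u v) _.
apply: etrans (esym (left_inv_bracket u v)) _.
exact: (f_equal2 (fun a b : V => @vf_bracket R 12 (solv R) (left_inv a) (left_inv b) 1%g)
  (esym (mul1mx u)) (esym (mul1mx v))).
Qed.

(** Loops contract along straight lines. *)
Lemma solv_simply_connected : simply_connected R (solv R).
Proof.
split=> [x y|x f cf f0 f1].
  exists (fun t : R => ((1 - t) *: (x : V) + t *: (y : V) : solv R)); split.
  - apply: continuous_subspaceT => t; apply: (@cvgD _ V).
      apply: (@cvgZr_tmp _ V); apply: cvgB; [exact: cvg_cst|exact: cvg_id].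
    by apply: (@cvgZr_tmp _ V); exact: cvg_id.
  - by rewrite subr0 scale1r scale0r addr0.
  - by rewrite subrr scale0r scale1r add0r.
exists (fun z => ((1 - z.1) *: (f z.2 : V) + z.1 *: (x : V) : solv R)); split.
- apply/subspace_continuousP => z [z1 z2].
  have c1 : fst y @[y --> within (`[0, 1]%classic `*` `[0, 1]%classic) (nbhs z)] --> z.1.
    by apply: cvg_within_filter; exact: cvg_fst.
  apply: (@cvgD _ V); apply: (@cvgZ _ V).
  + by apply: cvgB c1; exact: cvg_cst.
  + move/subspace_continuousP: cf => /(_ _ z2) cf.
    apply: (cvg_comp _ _ _ cf) => B IB.
    have : nbhs z [set y | `[0, 1]%classic y.2 -> B y.2].
      have c2 : snd y @[y --> z] --> z.2 by exact: cvg_snd.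
      exact: (c2 _ IB).
    by apply: filterS => y IBy [_ /IBy].
  + exact: c1.
  + exact: cvg_cst.
- by move=> t _ /=; rewrite subr0 subrr !scale0r !scale1r add0r addr0.
- by move=> s _ /=; rewrite f0 f1 -scalerDl subrK scale1r.
Qed.

(** The elements whose coordinates e_1, e_5, ..., e_8 vanish; they act by
    translations, and the coordinates in question are homomorphisms to R, so that
    all the commutators are there. *)
Definition translations : set (solv R) :=
  [set x | forall k, k \in [:: 0; 4; 5; 6; 7]%N -> co (x : V) k = 0].

Lemma co_smul (x y : V) k : k \in [:: 0; 4; 5; 6; 7]%N ->
  co (smul x y) k = co x k + co y k.
Proof.
rewrite /smul coD AE !inE.
by move=> /or4P[/eqP->|/eqP->|/eqP->|/orP[]/eqP->]; rewrite co_vec.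
Qed.

Lemma co_sinv (x : V) k : k \in [:: 0; 4; 5; 6; 7]%N -> co (sinv x) k = - co x k.
Proof.
move=> hk; have := co_smul (sinv x) x hk; rewrite smulV co0 => /esym/eqP.
by rewrite addr_eq0 => /eqP.
Qed.

Lemma A_translations (x : V) : translations x -> A x = 1%:M.
Proof.
move=> kx; apply: mx_ext => v; rewrite AE mul1mx.
have [x0 x4 x5 x6 x7] : [/\ co x 0 = 0, co x 4 = 0, co x 5 = 0, co x 6 = 0 & co x 7 = 0].
  by split; apply: kx.
apply: co_inj; do 12? [case=> [_|]]; last by [].
all: by rewrite co_vec //= ?x0 ?x4 ?x5 ?x6 ?x7 ?cos0 ?sin0; ring.
Qed.

Lemma translations_subgroup : subgroup translations.
Proof.
split=> [k _|x y kx ky k hk|x kx k hk]; first exact: co0.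
- by rewrite [LHS](co_smul (x : V) y hk) kx // ky // addr0.
- by rewrite [LHS](co_sinv x hk) kx // oppr0.
Qed.

Lemma solv_solvable : solvable_group (solv R).
Proof.
exists 2%N; apply/seteqP; split=> [z|z ->]; last by move=> H [[]].
move=> Hz; apply: (Hz [set 1%g]); split.
  split=> // [x y -> ->|x ->]; first by rewrite mulg1.
  exact: invg1.
have sub : forall x, iter 1 (fun H : set (solv R) => commutator_subgroup H H) setT x -> translations x.
  move=> x Hx; apply: (Hx translations); split; first exact: translations_subgroup.
  move=> _ [a [b [_ _ ->]]] k hk.
  rewrite [LHS](_ : _ = co (smul (sinv a) (smul (sinv b) (smul a b))) k) //.
  by rewrite !co_smul // !co_sinv //; ring.
move=> _ [a [b [/sub ka /sub kb ->]]] /=.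
have ab : (a * b = b * a)%g.
  rewrite [LHS](_ : _ = (a : V) + (b : V)); last by rewrite [LHS]/(smul a b) /smul A_translations // mul1mx.
  by rewrite [RHS]/(smul b a) /smul A_translations // mul1mx addrC.
by rewrite /commg /conjg ab mulKg mulVg.
Qed.

End SolvFacts.

(** * Lifting maps of the plane through a quotient by a discrete subgroup *)

Lemma continuous_pair (T X Y : topologicalType) (f : T -> X) (g : T -> Y) :
  continuous f -> continuous g -> continuous (fun z => (f z, g z)).
Proof.
by move=> cf cg z; apply: (@cvg_pair _ _ _ _ (nbhs (f z)) (nbhs (g z)));
  [exact: cf|exact: cg].
Qed.

Section Cousin.
Context (R : realType).

(** Cousin's principle. The supremum of the t such that P a t is attained and is
    equal to b, since P holds on the small intervals around it. *)
Lemma cousin (P : R -> R -> Prop) (a b : R) : a <= b ->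
  (forall x y z, a <= x -> x <= y -> y <= z -> z <= b -> P x y -> P y z -> P x z) ->
  (forall x, a <= x <= b -> exists2 e, 0 < e &
    forall y z, a <= y -> y <= x -> x <= z -> z <= b -> z - y < e -> P y z) ->
  P a b.
Proof.
move=> ab Padd Ploc.
have Paa : P a a.
  have [|e e0] := Ploc a; first by rewrite lexx ab.
  by apply; rewrite ?lexx ?subrr.
pose S : set R := [set t | a <= t <= b /\ P a t].
have Sa : S a by split=> //; rewrite lexx ab.
have Sub : has_sup S by split; [exists a|exists b => t [/andP[]]].
set s := sup S.
have sS t : S t -> t <= s by move=> St; exact: ub_le_sup (Sub.2) _ St.
have as_ : a <= s by exact: sS.
have sb : s <= b by apply: ge_sup; [exists a|move=> t [/andP[]]].
have [|e e0 Pe] := Ploc s; first by rewrite as_ sb.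
have [t St ts] := @sup_adherent _ _ (e / 2) (divr_gt0 e0 (ltr0Sn _ 1)) Sub.
have [/andP[at_ tb] Pat] := St.
have ts' := sS _ St.
pose s' := Num.min b (s + e / 3).
have ss' : s <= s' by rewrite /s' le_min sb lerDl divr_ge0 // ltW.
have s'b : s' <= b by rewrite /s' ge_min lexx.
have s'e : s' <= s + e / 3 by rewrite /s' ge_min lexx orbT.
have Ps' : P a s'.
  apply: (Padd a t s') => //; first exact: le_trans ss'.
  apply: Pe => //; rewrite -/s in ts; lra.
have : s' <= s by apply: sS; split=> //; rewrite s'b (le_trans as_).
rewrite /s' ge_min => /orP[bs|]; last by move=> H; lra.
have bs' : s' = b by apply/eqP; rewrite eq_le s'b; lra.
by rewrite -bs'.
Qed.

End Cousin.

Section Lifting.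
Context (R : realType) (n : nat) (N : lieGroupType R n) (Gamma : set N)
  (M : manifoldType R n) (q : N -> M).
Hypothesis dG : discrete_subgroup Gamma.
Hypothesis qG : is_quotient Gamma q.

Lemma continuous_mulg (T : topologicalType) (F G : T -> N) :
  continuous F -> continuous G -> continuous (fun z => (F z * G z)%g).
Proof.
move=> cF cG z.
apply: (@continuous_comp _ _ _ (fun z => (F z, G z)) (fun z : N * N => (z.1 * z.2)%g)).
  exact: continuous_pair.
exact: lie_mul_continuous.
Qed.

Lemma continuous_invg (T : topologicalType) (F : T -> N) :
  continuous F -> continuous (fun z => (F z)^-1%g).
Proof.
move=> cF z; apply: (@continuous_comp _ _ _ F (fun y : N => y^-1%g)); first exact: cF.
by have [] := @lie_inv_smooth _ _ N (F z).
Qed.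

Lemma quotient_map_continuous : continuous q.
Proof.
move=> x; have [_ _ /(_ x) [U [V [h [Uo Ux _ qU _]]]]] := qG.
by have [_ _ []] := qU x Ux.
Qed.

Lemma local_section (m : M) : exists (V : set M) (h : M -> N),
  [/\ open V, V m & forall z, V z -> q (h z) = z /\ {for z, continuous h}].
Proof.
have [/(_ m) [x <-] _ /(_ x) [U [V [h [Uo Ux Vo qU hV]]]]] := qG.
exists V, h; split=> //; first by have [] := qU x Ux.
by move=> z /hV [_ -> []].
Qed.

(** The fibre of u over u a is closed, and open because Gamma is discrete, in the
    connected interval. *)
Lemma discrete_valued_constant (u : R -> N) (a b : R) : a <= b -> continuous u ->
  (forall y, a <= y <= b -> Gamma (u y)) -> u b = u a.
Proof.
move=> ab cu Gu.
have [_ /(_ _ (Gu a _)) [|U [Uo UG]]] := dG; first by rewrite lexx ab.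
pose I := `[a, b]%classic : set R.
have cI : connected I := @segment_connected _ a b.
have : I `&` (u @^-1` [set u a]) = I.
  apply: cI.
  - by exists a; split=> //; rewrite /I /= in_itv /= lexx ab.
  - exists (u @^-1` U); first by apply: open_comp => // *; exact: cu.
    apply/seteqP; split=> y [Iy uy]; split=> //.
      have : [set u a] (u y) := uy.
      by rewrite -UG => -[].
    have : (U `&` Gamma) (u y) by split=> //; apply: Gu; move: Iy; rewrite /I /= in_itv.
    by rewrite UG.
  - exists (u @^-1` [set u a]) => //.
    apply: (closed_comp (f := u)) => [y _|]; first exact: cu.
    exact: (accessible_closed_set1 (hausdorff_accessible (@manifold_hausdorff _ _ N))).
move=> /seteqP[_ /(_ b)]; case=> //.
by rewrite /I /= in_itv /= lexx ab.
Qed.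

Lemma lift_transition (x y : N) : q x = q y -> Gamma (y * x^-1)%g.
Proof.
have [_ qE _] := qG; move=> /qE [c Gc ->].
by rewrite mulgK.
Qed.

(** The quotient of two lifts has values in Gamma along the segment from the
    origin to z. *)
Lemma lift_unique (F G : R * R -> N) z : continuous F -> continuous G ->
  (forall t : R, 0 <= t <= 1 -> q (F (t * z.1, t * z.2)) = q (G (t * z.1, t * z.2))) ->
  (G z * (F z)^-1 = G (0, 0) * (F (0, 0))^-1)%g.
Proof.
move=> cF cG FG.
pose l (t : R) : R * R := (t * z.1, t * z.2).
have cl : continuous l.
  by apply: continuous_pair => t; apply: cvgM; first [exact: cvg_id|exact: cvg_cst].
have cFl : continuous (F \o l) by move=> t; apply: continuous_comp; [exact: cl|exact: cF].
have cGl : continuous (G \o l) by move=> t; apply: continuous_comp; [exact: cl|exact: cG].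
have := @discrete_valued_constant (fun t => (G (l t) * (F (l t))^-1)%g) 0 1 ler01.
rewrite /l !mul1r !mul0r -!surjective_pairing; apply.
  by apply: continuous_mulg => //; exact: continuous_invg.
by move=> t /FG /lift_transition.
Qed.

Lemma lift_unique_all (F G : R * R -> N) : continuous F -> continuous G ->
  (forall z, q (F z) = q (G z)) -> exists2 c, Gamma c & forall z, G z = (c * F z)%g.
Proof.
move=> cF cG FG; exists (G (0, 0) * (F (0, 0))^-1)%g; first exact: lift_transition.
by move=> z; rewrite -(lift_unique (z := z)) ?mulgVK // => t _; exact: FG.
Qed.

Definition liftable (f : R * R -> M) (a b c d : R) : Prop :=
  exists2 F : R * R -> N, continuous F &
    forall x y, a <= x <= b -> c <= y <= d -> q (F (x, y)) = f (x, y).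

(** On the common edge the two lifts differ by a constant element of Gamma, by
    which the first one is corrected. The group structure then glues them
    without a case distinction, as F1 (min x b, y) F (b, y)^-1 F2 (max x b, y). *)
Lemma liftable_glue f a b b' c d : a <= b -> b <= b' -> c <= d ->
  liftable f a b c d -> liftable f b b' c d -> liftable f a b' c d.
Proof.
move=> ab bb' cd [F1 cF1 qF1] [F2 cF2 qF2].
have [[G1 GM GV] _] := dG; have [_ qE _] := qG.
have cc (F : R * R -> N) (g h : R * R -> R) : continuous F -> continuous g -> continuous h ->
    continuous (fun z => F (g z, h z)).
  move=> cF cg ch z; apply: (@continuous_comp _ _ _ (fun z => (g z, h z)) F).
    exact: continuous_pair.
  exact: cF.
have c1 : continuous (fst : R * R -> R) by move=> z; exact: cvg_fst.
have c2 : continuous (snd : R * R -> R) by move=> z; exact: cvg_snd.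
have cb : continuous (fun _ : R * R => b) by move=> z; exact: cvg_cst.
have bab : a <= b <= b by rewrite ab lexx.
have bbb : b <= b <= b' by rewrite bb' lexx.
pose u y := (F2 (b, y) * (F1 (b, y))^-1)%g.
have uE y : c <= y <= d -> u y = u c.
  move=> /andP[cy yd]; apply: discrete_valued_constant => //.
    have cp : continuous (fun y : R => (b, y)).
      by apply: continuous_pair => t; [exact: cvg_cst|exact: cvg_id].
    apply: continuous_mulg; last apply: continuous_invg.
      by move=> t; apply: continuous_comp; [exact: cp|exact: cF2].
    by move=> t; apply: continuous_comp; [exact: cp|exact: cF1].
  move=> t /andP[ct ty]; apply: lift_transition.
  have ctd : c <= t <= d by rewrite ct (le_trans ty).
  by rewrite qF1 // qF2.
have Gu : Gamma (u c).
  by apply: lift_transition; rewrite qF1 ?qF2 // lexx cd.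
exists (fun z => (u c * F1 (Num.min z.1 b, z.2) * (F2 (b, z.2))^-1 * F2 (Num.max z.1 b, z.2)))%g.
  apply: continuous_mulg; first apply: continuous_mulg; first apply: continuous_mulg.
  - by move=> z; exact: cvg_cst.
  - by apply: cc => // z; apply: continuous_min; [exact: c1|exact: cb].
  - by apply: continuous_invg; exact: cc.
  - by apply: cc => // z; apply: continuous_max; [exact: c1|exact: cb].
move=> x y /andP[ax xb'] cyd /=; have [xb|/ltW bx] := leP x b.
  rewrite mulgVK; transitivity (q (F1 (x, y))); last by rewrite qF1 // ax xb.
  by apply/esym/qE; exists (u c).
by rewrite -(uE _ cyd) /u mulgVK mulgV mul1g qF2 // bx xb'.
Qed.

Lemma liftable_swap f a b c d :
  liftable (fun z => f (z.2, z.1)) c d a b -> liftable f a b c d.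
Proof.
move=> [F cF qF]; exists (fun z => F (z.2, z.1)) => [z|x y xab ycd].
  apply: (@continuous_comp _ _ _ (fun z : R * R => (z.2, z.1)) F); last exact: cF.
  by apply: continuous_pair => w; [exact: cvg_snd|exact: cvg_fst].
by rewrite qF.
Qed.

(** A local section of q is composed with f and with the retraction of the plane
    onto the rectangle. *)
Lemma liftable_local f x y : continuous f -> exists2 e, 0 < e &
  forall a b c d, a <= x -> x <= b -> c <= y -> y <= d -> b - a < e -> d - c < e ->
    liftable f a b c d.
Proof.
move=> cf; have [V [h [Vo Vf qh]]] := local_section (f (x, y)).
have : nbhs (x, y) (f @^-1` V) by apply: cf; exact: open_nbhs_nbhs.
move=> /nbhs_ballP [e /= e0 eV]; exists e => // a b c d ax xb cy yd ba dc.
pose k (z : R * R) : R * R := (Num.max a (Num.min b z.1), Num.max c (Num.min d z.2)).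
have ck : continuous k.
  have c1 : continuous (fst : R * R -> R) by move=> z; exact: cvg_fst.
  have c2 : continuous (snd : R * R -> R) by move=> z; exact: cvg_snd.
  have cm (g : R * R -> R) (u v : R) : continuous g ->
      continuous (fun z => Num.max u (Num.min v (g z))).
    move=> cg z; apply: (@continuous_max _ _ (fun=> u) (fun z => Num.min v (g z))).
      exact: cvg_cst.
    apply: (@continuous_min _ _ (fun=> v) g); first exact: cvg_cst.
    exact: cg.
  by apply: continuous_pair; exact: cm.
have kV z : V (f (k z)).
  have cl (u v w t : R) : u <= t -> t <= v -> v - u < e -> ball t e (Num.max u (Num.min v w)).
    move=> ut tv vu; rewrite /ball /= ltr_norml.
    have m1 : u <= Num.max u (Num.min v w) by rewrite le_max lexx.
    have m2 : Num.max u (Num.min v w) <= v by rewrite ge_max (le_trans ut) //= ge_min lexx.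
    by apply/andP; split; lra.
  by apply: eV; split; exact: cl.
exists (fun z => h (f (k z))) => [z|s t /andP[as_ sb] /andP[ct td]].
  apply: (@continuous_comp _ _ _ (fun z => f (k z)) h); last by have [] := qh _ (kV z).
  by apply: continuous_comp; [exact: ck|exact: cf].
have [-> _] := qh _ (kV (s, t)).
by rewrite /k /= (min_idPr sb) (min_idPr td) (max_idPr as_) (max_idPr ct).
Qed.

(** Cousin's principle is applied in the first direction, and its local
    hypothesis is proved by applying it in the second direction. *)
Lemma liftable_rect f a b c d : continuous f -> a <= b -> c <= d -> liftable f a b c d.
Proof.
move=> cf ab cd; apply: (cousin (P := fun a b => liftable f a b c d)) => //.
  by move=> x y z ax xy yz zb; exact: liftable_glue.
move=> x _.
pose P c d := exists2 e, 0 < e & forall a b, a <= x -> x <= b -> b - a < e -> liftable f a b c d.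
suff [e e0 H] : P c d by exists e => // y z _ yx xz _; exact: H.
apply: (cousin (P := P)) => // [u v w _ uv vw _ [e e0 He] [e' e'0 He']|y _].
  exists (Num.min e e'); first by rewrite lt_min e0.
  move=> s t sx xt; rewrite lt_min => /andP[ste ste'].
  have sw (g : R * R -> M) : (fun z : R * R => g (z.2, z.1)) = g \o (fun z => (z.2, z.1)) by [].
  apply: liftable_swap; apply: (liftable_glue uv vw (le_trans sx xt)); apply: liftable_swap.
    by rewrite (_ : (fun z => _) = f); [exact: He|apply/funext => -[]].
  by rewrite (_ : (fun z => _) = f); [exact: He'|apply/funext => -[]].
have [e e0 He] := liftable_local x y cf.
exists e => // u v _ uy yv _ vu; exists e => // s t sx xt ts.
exact: He.
Qed.

(** The lifts on the squares of half-side k with value n0 at the origin agree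
    where two of them are defined. *)
Lemma plane_lift (f : R * R -> M) (n0 : N) : continuous f -> q n0 = f (0, 0) ->
  exists F : R * R -> N, [/\ continuous F, (forall z, q (F z) = f z) & F (0, 0) = n0].
Proof.
move=> cf qn0; have [[G1 GM GV] _] := dG; have [_ qE _] := qG.
have H (k : nat) : exists F : R * R -> N, [/\ continuous F, F (0, 0) = n0 &
    forall x y, `|x| <= k%:R -> `|y| <= k%:R -> q (F (x, y)) = f (x, y)].
  have kk : - k%:R <= k%:R :> R by rewrite lerNl (le_trans _ (ler0n _ _)) // oppr_le0.
  have [F cF qF] := liftable_rect cf kk kk.
  have qF' x y : `|x| <= k%:R -> `|y| <= k%:R -> q (F (x, y)) = f (x, y).
    by rewrite !ler_norml; exact: qF.
  have G0 : Gamma (n0 * (F (0, 0))^-1)%g.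
    by apply: lift_transition; rewrite qF' ?normr0.
  exists (fun z => n0 * (F (0, 0))^-1 * F z)%g; split.
  - by apply: continuous_mulg => // z; exact: cvg_cst.
  - by rewrite mulgVK.
  - move=> x y xk yk; rewrite -qF' //; apply/esym/qE.
    by exists (n0 * (F (0, 0))^-1)%g.
have [F HF] := choice H.
have FE (j k : nat) z : `|z.1| <= j%:R -> `|z.2| <= j%:R -> (j <= k)%N -> F j z = F k z.
  move=> z1 z2 jk; have [cj j0 qj] := HF j; have [ck k0 qk] := HF k.
  have := @lift_unique (F j) (F k) z cj ck; rewrite j0 k0 mulgV => E.
  apply/esym; rewrite -[RHS]mul1g -E ?mulgVK // => t /andP[t0 t1].
  have le1 w : `|w| <= j%:R -> `|t * w| <= j%:R.
    by rewrite normrM (ger0_norm t0) => wj; rewrite (le_trans _ wj) // ler_piMl.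
  rewrite qj ?le1 // qk // (le_trans (le1 _ _)) // ?ler_nat //.
have FE' (j k : nat) z : `|z.1| <= j%:R -> `|z.2| <= j%:R ->
    `|z.1| <= k%:R -> `|z.2| <= k%:R -> F j z = F k z.
  by move=> *; case: (leqP j k) => [jk|/ltnW kj]; [exact: FE|apply/esym; exact: FE].
pose K (z : R * R) := (Num.bound `|z.1| + Num.bound `|z.2|)%N.
have zK z : `|z.1| <= (K z)%:R /\ `|z.2| <= (K z)%:R.
  rewrite /K natrD; split.
    by rewrite (le_trans (ltW (archi_boundP (normr_ge0 _)))) // lerDl.
  by rewrite (le_trans (ltW (archi_boundP (normr_ge0 _)))) // lerDr.
exists (fun z => F (K z) z); split.
- move=> z; have [ck _ _] := HF (K z).+1; have [z1 z2] := zK z.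
  have E : \forall w \near z, F (K z).+1 w = F (K w) w.
    have : nbhs z (ball z 1) by exact: nbhsx_ballx.
    apply: filterS => w [w1 w2]; have [k1 k2] := zK w.
    have le1 (s t : R) : ball s 1 t -> `|s| <= (K z)%:R -> `|t| <= (K z).+1%:R.
      rewrite /ball /= -natr1 => st sk.
      rewrite (_ : t = s - (s - t)); last by rewrite subKr.
      by rewrite (le_trans (ler_normB _ _)) // lerD // ltW.
    by apply: FE' => //; [exact: le1 w1 _|exact: le1 w2 _].
  have := ck z; rewrite /continuous_at [F (K z).+1 z](nbhs_singleton E).
  by apply: cvg_trans; apply: near_eq_cvg; exact: E.
- by move=> [x y]; have [_ _ ->] := HF (K (x, y)); have [] := zK (x, y).
- by have [_ -> _] := HF (K (0, 0)).
Qed.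

End Lifting.

(** * The lattice *)

Section Lattice.
Context (R : realType).
Local Notation V := 'cV[R]_12.

(** The rotation has period 2 pi. With pi instead of 2 pi, the generator pi e_1
    of the lattice acts on R^4 by - 1, and the lattice is not nilpotent. *)
Definition period (k : nat) : R := if k == 0%N then pi else 1.

Definition lattice : set (solv R) :=
  [set x | forall k, (k < 12)%N -> co (x : V) k / period k \is a Num.int].

Lemma period_ge1 k : 1 <= period k.
Proof. by rewrite /period; case: ifP => // _; have := pi_ge2 R; lra. Qed.

(** The linear part of the left translation by an element of the lattice is
    integral. *)
Lemma cos_sin_int (a : R) : a / pi \is a Num.int -> cos a \is a Num.int /\ sin a = 0.
Proof.
have pi0 : pi != 0 :> R by rewrite gt_eqF // pi_gt0.
have H (n : nat) : cos (n%:R * pi : R) \is a Num.int /\ sin (n%:R * pi : R) = 0.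
  elim: n => [|n [IHc IHs]]; first by rewrite mul0r cos0 sin0 rpred1.
  by rewrite -natr1 mulrDl mul1r cosDpi sinDpi IHs oppr0 rpredN.
move=> /intrP [m am].
have -> : a = m%:~R * pi by rewrite -am mulfVK.
case: (intP m) => [|n|n]; first by rewrite mul0r cos0 sin0 rpred1.
  by rewrite -pmulrn; exact: H.
rewrite mulrNz mulNr cosN sinN -pmulrn.
by have [? ->] := H n.+1; rewrite oppr0.
Qed.

Lemma lattice_int (x : V) k : lattice x -> (0 < k < 12)%N -> co x k \is a Num.int.
Proof.
by move=> Lx /andP[k0 k12]; have := Lx k k12; rewrite /period gtn_eqF // divr1.
Qed.

Lemma lattice_mul (x y : V) : lattice x -> lattice y -> lattice (smul x y).
Proof.
move=> Lx Ly; have [cx sx] := cos_sin_int (Lx 0%N isT).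
have ix k : (0 < k < 12)%N -> co x k \is a Num.int by exact: lattice_int.
have iy k : (0 < k < 12)%N -> co y k \is a Num.int by exact: lattice_int.
have x0 := Lx 0%N isT; have y0 := Ly 0%N isT.
case=> [_|]; first by rewrite /smul coD AE co_vec // mulrDl rpredD.
do 11? [case=> [_|]]; last by [].
all: rewrite /period /= divr1 /smul coD AE co_vec //= ?sx.
all: by do ?[apply: rpredD|apply: rpredM|rewrite rpredN|rewrite rpred0|exact: ix|exact: iy|exact: cx].
Qed.

Lemma lattice_inv (x : V) : lattice x -> lattice (sinv x).
Proof.
move=> Lx; have [cx sx] := cos_sin_int (Lx 0%N isT).
have ix k : (0 < k < 12)%N -> co x k \is a Num.int by exact: lattice_int.
have x0 := Lx 0%N isT.
case=> [_|]; first by rewrite /sinv coN AE co_vec // mulNr rpredN.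
do 11? [case=> [_|]]; last by [].
all: rewrite /period /= divr1 /sinv coN AE co_vec //= ?coN ?cosN ?sinN ?sx.
all: by do ?[apply: rpredD|apply: rpredM|rewrite rpredN|rewrite rpred0|exact: ix|exact: cx].
Qed.

Lemma lattice_subgroup : subgroup lattice.
Proof.
split=> [k k12|x y|x]; [|exact: lattice_mul|exact: lattice_inv].
by rewrite [co _ k](co0 R 12 k) mul0r rpred0.
Qed.

Lemma lattice_small (r : R) k : r / period k \is a Num.int -> `|r| < 1 -> r = 0.
Proof.
move=> ri r1; have p1 := period_ge1 k; have p0 : 0 < period k by lra.
have := @norm_intr_ge1 _ _ ri; rewrite mulf_eq0 invr_eq0 (gt_eqF p0) orbF.
case: eqVneq => // _ /(_ isT); rewrite normf_div (gtr0_norm p0) ler_pdivlMr //; lra.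
Qed.

Lemma lattice_separated (x y : V) : lattice x -> lattice y -> ball x 1 y -> x = y.
Proof.
move=> Lx Ly /ball_co xy; apply: co_inj => k k12; apply/eqP; rewrite -subr_eq0; apply/eqP.
apply: (@lattice_small _ k); last exact: xy.
by rewrite mulrBl rpredB // ?Lx // Ly.
Qed.

Lemma lattice_discrete : discrete_subgroup lattice.
Proof.
split=> [|x Lx]; first exact: lattice_subgroup.
exists (ball (x : V) 1); split; first exact: (@ball_open _ V).
apply/seteqP; split=> [y [xy Ly]|_ ->]; last by split=> //; exact: ballxx.
by apply/esym; exact: lattice_separated.
Qed.

(** If c is not 0, one of the coordinates of c x - x is a nonzero multiple of the
    period: first one of e_1, e_5, ..., e_8, and when they vanish any other one. *)
Lemma lattice_free (c x y : V) w : lattice c -> ball w 2^-1 x -> ball w 2^-1 y ->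
  y = smul c x -> y = x.
Proof.
move=> Lc /ball_co wx /ball_co wy yE.
have xy k : (k < 12)%N -> `|co y k - co x k| < 1.
  move=> k12; rewrite -(subrKA (co w k)) (le_lt_trans (ler_normD _ _)) //.
  by have := wx k k12; have := wy k k12; rewrite distrC => ? ?; lra.
have c0 k : (k < 12)%N -> co (act c x) k = co x k -> co c k = 0.
  move=> k12 ax; apply: (@lattice_small _ k); first exact: Lc.
  by have := xy k k12; rewrite yE /smul coD AE ax addrK.
have z0 : co c 0 = 0 by apply: c0; rewrite // co_vec.
have z4 : co c 4 = 0 by apply: c0; rewrite // co_vec.
have z5 : co c 5 = 0 by apply: c0; rewrite // co_vec.
have z6 : co c 6 = 0 by apply: c0; rewrite // co_vec.
have z7 : co c 7 = 0 by apply: c0; rewrite // co_vec.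
have Ac : A c = 1%:M.
  apply: (@A_translations R) => k; rewrite !inE.
  by move=> /or4P[/eqP->|/eqP->|/eqP->|/orP[]/eqP->].
suff : c = 0 by move=> c_0; rewrite yE c_0 smul0l.
by apply: co_inj => k k12; rewrite co0 c0 // -AE Ac mul1mx.
Qed.

(** A subset of which no two points are at distance less than 1 is closed. *)
Lemma lattice_closed : closed lattice.
Proof.
move=> g clg; have [c [Lc gc]] : exists c : V, lattice c /\ ball (g : V) 4^-1 c.
  have [c [Lc gc]] := clg _ (@nbhsx_ballx _ V g 4^-1 ltac:(by rewrite invr_gt0)).
  by exists c.
have [-> //|gNc] := eqVneq (g : V) c.
pose U : set V := ball (g : V) 4^-1 `&` ~` [set c].
have : nbhs (g : V) U.
  apply: filterI; first by apply: nbhsx_ballx; rewrite invr_gt0.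
  apply: open_nbhs_nbhs; split; last by move/eqP: gNc.
  apply: closed_openC.
  exact: (accessible_closed_set1 (hausdorff_accessible (@norm_hausdorff _ V))).
move=> /clg [c' [Lc' [gc' c'c]]]; exfalso; apply: c'c.
apply: lattice_separated => //.
apply: (@le_ball _ _ _ (4^-1 + 4^-1)); first lra.
by apply: (@ball_triangle _ _ (g : V)) => //; exact: ball_sym.
Qed.

(** The coordinates e_1, e_5, ..., e_8 of c * x are additive in c; they are reduced
    by c', which determines A c and hence what is to be subtracted from the other
    coordinates. *)
Lemma fundamental_domain (x : V) :
  exists2 c : V, lattice c & forall k, (k < 12)%N -> 0 <= co (smul c x) k <= 4.
Proof.
pose fl (r : R) : R := (Num.floor r)%:~R.
have fli r : fl r \is a Num.int by exact: intr_int.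
have flr r : 0 <= r - fl r <= 1.
  have := floor_itv r; rewrite intrD -/(fl r) => /andP[].
  by move=> *; apply/andP; split; lra.
pose c' : V := vec 12 (fun k => match k with
  | 0 => - fl (co x 0 / pi) * pi | 4 => - fl (co x 4) | 5 => - fl (co x 5)
  | 6 => - fl (co x 6) | 7 => - fl (co x 7) | _ => 0 end).
pose c : V := vec 12 (fun k => if k \in [:: 0; 4; 5; 6; 7]%N then co c' k
  else - fl (co (act c' x) k)).
have ac : act c x = act c' x.
  have e k : k \in [:: 0; 4; 5; 6; 7]%N -> co c k = co c' k.
    move=> hk; have k12 : (k < 12)%N.
      by move: hk; rewrite !inE => /or4P[/eqP->|/eqP->|/eqP->|/orP[]/eqP->].
    by rewrite co_vec // hk.
  apply: co_inj => k k12; rewrite !co_vec // /act_co.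
  by move: k k12; do 12? [case=> [_|]]; last by []; rewrite //= ?e.
have pi0 : 0 < pi :> R by exact: pi_gt0.
have pi4 : pi <= 4 :> R by have := @pihalf_02 R; lra.
exists c => [k k12|k k12].
  rewrite co_vec //; case: ifP => hk; last first.
    rewrite /period; case: ifP => [/eqP k0|_]; first by rewrite k0 in hk.
    by rewrite divr1 rpredN.
  move: hk; rewrite !inE => /or4P[/eqP->|/eqP->|/eqP->|/orP[]/eqP->];
    rewrite co_vec //= /period /= ?divr1 ?rpredN //.
  by rewrite mulfK ?gt_eqF // rpredN.
rewrite /smul coD AE ac co_vec //; case: ifP => hk; last first.
  by have := flr (co (act c' x) k); rewrite addrC => /andP[? ?]; apply/andP; split; lra.
move: hk; rewrite !inE => /or4P[/eqP->|/eqP->|/eqP->|/orP[]/eqP->];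
  rewrite !co_vec //=.
- have := flr (co x 0 / pi); set r := co x 0 / pi => /andP[r0 r1].
  have -> : co x 0 = r * pi by rewrite /r mulfVK // gt_eqF.
  by apply/andP; split; nra.
- by have := flr (co x 4) => /andP[? ?]; apply/andP; split; lra.
- by have := flr (co x 5) => /andP[? ?]; apply/andP; split; lra.
- by have := flr (co x 6) => /andP[? ?]; apply/andP; split; lra.
- by have := flr (co x 7) => /andP[? ?]; apply/andP; split; lra.
Qed.

End Lattice.

(** * The compact quotient *)

Section Orbits.
Context (R : realType).
Local Notation V := 'cV[R]_12.

Definition orbit_rel (x y : solv R) : bool :=
  `[< exists2 c : V, lattice c & (y : V) = smul c x >].

Lemma orbit_rel_equiv : equiv_class_of orbit_rel.
Proof.
have [G1 GM GV] := @lattice_subgroup R.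
split=> [x|x y|y x z].
- by apply/asboolP; exists 0 => //; rewrite smul0l.
- have sym (a b : solv R) : orbit_rel a b -> orbit_rel b a.
    move=> /asboolP [c Lc bE]; apply/asboolP; exists (sinv c); first exact: lattice_inv.
    by rewrite bE smulA smulV smul0l.
  by apply/idP/idP; exact: sym.
- move=> /asboolP [c Lc yE] /asboolP [d Ld zE]; apply/asboolP.
  by exists (smul d c); [exact: lattice_mul|rewrite zE yE smulA].
Qed.

Canonical orbit_equiv := EquivRelPack orbit_rel_equiv.

End Orbits.

Definition solvmfd (R : realType) : Type := quotient_topology {eq_quot (@orbit_equiv R)}%qT.
HB.instance Definition _ (R : realType) :=
  Topological.copy (solvmfd R) (quotient_topology {eq_quot (@orbit_equiv R)}%qT).

Section Quotient.
Context (R : realType).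
Local Notation V := 'cV[R]_12.
Local Notation S := (solv R).
Local Notation Q := (solvmfd R).

Definition prj (x : S) : Q := \pi_({eq_quot (@orbit_equiv R)}%qT)%qT x.
Definition rpr (y : Q) : S := repr (y : {eq_quot (@orbit_equiv R)}%qT).

Lemma rprK y : prj (rpr y) = y.
Proof. exact: reprK. Qed.

Lemma prj_eq (x y : S) : prj x = prj y <-> exists2 c : V, lattice c & (y : V) = smul c x.
Proof.
split=> [/eqquotP/asboolP //|H].
by apply/eqquotP/asboolP.
Qed.

Lemma prj_smul (c x : V) : lattice c -> prj (smul c x) = prj x.
Proof. by move=> Lc; apply/esym/prj_eq; exists c. Qed.

Lemma prj_continuous : continuous prj.
Proof. exact: (@pi_continuous S {eq_quot (@orbit_equiv R)}%qT). Qed.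

Lemma smul_left_continuous (c : V) : continuous (smul c).
Proof.
move=> x; apply: (@continuous_comp _ _ _ (fun y : V => (c, y)) (fun z : V * V => smul z.1 z.2)).
  by apply: continuous_pair => y; [exact: cst_continuous|exact: cvg_id].
exact: smooth_near_continuous (smul_smooth c x).
Qed.

(** The saturation of an open set is a union of its translates. *)
Lemma prj_open (U : set V) : open U -> open (prj @` U).
Proof.
move=> Uo; suff : open (prj @^-1` (prj @` U) : set V) by [].
rewrite openE => x [u Uu /prj_eq [c Lc xE]].
have ux : u = smul (sinv c) x by rewrite xE smulA smulV smul0l.
have : nbhs (x : V) (smul (sinv c) @^-1` U).
  by apply: smul_left_continuous; rewrite -ux; exact: open_nbhs_nbhs.
apply: filterS => y /= Uy; exists (smul (sinv c) y) => //.
by apply: prj_smul; exact: lattice_inv.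
Qed.

(** The chart around the orbit of a: the inverse of the projection on the ball of
    radius 1/2, where it is injective by [lattice_free]. *)
Definition sect (a : V) (z : Q) : V :=
  xget 0 [set w : V | ball a 2^-1 w /\ prj w = z].

Lemma sect_prj (a w : V) : ball a 2^-1 w -> sect a (prj w) = w.
Proof.
move=> aw; rewrite /sect; case: xgetP => [w' _ [aw' /prj_eq [c Lc wE]]|/(_ w)]; last first.
  by move=> H; exfalso; apply: H.
by apply/esym; apply: lattice_free Lc aw' aw wE.
Qed.

Definition chart_ball (a : V) : set Q := prj @` ball a 2^-1.

Lemma chart_ball_open a : open (chart_ball a).
Proof. by apply: prj_open; apply: ball_open; rewrite invr_gt0. Qed.

Lemma sect_in (a : V) z : chart_ball a z -> ball a 2^-1 (sect a z) /\ prj (sect a z) = z.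
Proof. by move=> [w aw <-]; rewrite sect_prj. Qed.

Lemma ball_half (a : V) : ball a 2^-1 a.
Proof. by apply: ballxx; rewrite invr_gt0. Qed.

Lemma sect_image a : sect a @` chart_ball a = ball a 2^-1.
Proof.
apply/seteqP; split=> [_ [z /sect_in[az _] <-] //|w aw].
by exists (prj w); [exists w|rewrite sect_prj].
Qed.

Lemma sect_continuous a z : chart_ball a z -> {for z, continuous (sect a)}.
Proof.
move=> az; have [bz zE] := sect_in az.
move=> B; rewrite nbhsE => -[W [Wo Wz] WB].
suff : nbhs z (prj @` (W `&` ball a 2^-1)).
  by apply: filterS => _ [w [Ww aw] <-]; apply: WB; rewrite sect_prj.
apply: open_nbhs_nbhs; split.
  by apply: prj_open; apply: openI => //; apply: ball_open; rewrite invr_gt0.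
by exists (sect a z).
Qed.

(** In these charts the identity of the quotient is a translation by an element
    of the lattice. *)
Lemma sect_near (a w : V) : chart_ball a (prj w) -> exists c : V,
  [/\ lattice c, sect a (prj w) = smul c w &
      \forall w' \near w, sect a (prj w') = smul c w'].
Proof.
move=> aw; have [bw /esym/prj_eq [c Lc sE]] := sect_in aw.
exists c; split=> //.
have : nbhs w (smul c @^-1` ball a 2^-1).
  apply: smul_left_continuous; rewrite -sE.
  by apply: open_nbhs_nbhs; split=> //; apply: ball_open; rewrite invr_gt0.
apply: filterS => w' bw'; rewrite -[in LHS](prj_smul w' Lc).
exact: sect_prj.
Qed.

Lemma smooth_near_smul (c w : V) : smooth_near (smul c) w.
Proof.
apply: smooth_near_add; first exact: smooth_near_cst.
apply: smooth_near_mulmx; first exact: smooth_near_cst.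
exact: smooth_near_id.
Qed.

Lemma smooth_near_sect (a w : V) :
  chart_ball a (prj w) -> smooth_near (fun w' => sect a (prj w')) w.
Proof.
move=> /sect_near [c [_ _ E]].
apply: smooth_near_eq (smooth_near_smul c w).
by apply: filterS E => w' ->.
Qed.

(** If all the neighbourhoods of the orbits of a and b meet, then b a^-1 is a
    limit of elements of the lattice, which is closed. *)
Lemma solvmfd_hausdorff : hausdorff_space Q.
Proof.
move=> y z yz; rewrite -(rprK y) -(rprK z); apply/prj_eq.
set a : V := rpr y; set b : V := rpr z.
exists (smul b (sinv a)); last by rewrite -smulA smulV smul0r.
apply: lattice_closed => B Bn.
have cd : {for (a, b), continuous (fun w : V * V => smul w.2 (sinv w.1))}.
  have l2 : linear (snd : V * V -> V) by move=> k u v; reflexivity.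
  have l1 : linear (fun w : V * V => - w.1).
    by move=> k u v; rewrite [(_ + _).1]/(k *: u.1 + v.1) opprD scalerN.
  have c2 : continuous (snd : V * V -> V) by move=> w; exact: cvg_snd.
  have c1 : continuous (fun w : V * V => - w.1) by move=> w; apply: cvgN; exact: cvg_fst.
  apply: smooth_near_continuous.
  rewrite (_ : (fun w => _) = fun w : V * V => w.2 + A w.2 *m (A (- w.1) *m - w.1)); last first.
    by apply/funext => w; rewrite /smul /sinv !mulmxN.
  apply: smooth_near_add; first exact: smooth_near_linear.
  apply: smooth_near_mulmx; first exact: smooth_near_A.
  by apply: smooth_near_mulmx; [exact: smooth_near_A|exact: smooth_near_linear].
have [[U W] /= [Ua Wb] UWB] := cd _ Bn.
move: Ua Wb; rewrite !nbhsE => -[U' [U'o U'a] U'U] [W' [W'o W'b] W'W].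
have [t [[u U'u <-] [w W'w /esym/prj_eq [c Lc wE]]]] : (prj @` U') `&` (prj @` W') !=set0.
  apply: yz; apply: open_nbhs_nbhs; split; try exact: prj_open.
    by exists a => //; exact: rprK.
  by exists b => //; exact: rprK.
exists c; split=> //.
have := UWB (u, w) (conj (U'U _ U'u) (W'W _ W'w)).
by rewrite /= wE -smulA smulVr smul0r.
Qed.

Lemma prj_surj y : exists x, prj x = y.
Proof. by exists (rpr y); exact: rprK. Qed.

Lemma solvmfd_second_countable : @second_countable Q.
Proof.
apply: (@second_countable_image V Q prj prj_surj prj_continuous prj_open).
exact: second_countable_cV.
Qed.

Lemma chart_ball_center y : chart_ball (rpr y) y.
Proof. by exists (rpr y); [exact: ball_half|exact: rprK]. Qed.

Lemma sect_image_open y : open (sect (rpr y) @` chart_ball (rpr y)).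
Proof. by rewrite sect_image; apply: ball_open; rewrite invr_gt0. Qed.

Lemma sect_transition (x y : Q) :
  smooth_on (sect (rpr x) @` (chart_ball (rpr x) `&` chart_ball (rpr y)))
            (sect (rpr y) \o prj).
Proof.
apply: smooth_near_on => w [z [xz yz] <-].
have [_ zE] := sect_in xz.
by apply: smooth_near_sect; rewrite zE.
Qed.

HB.instance Definition _ := @isManifold.Build R 12 Q
  (fun y => chart_ball (rpr y)) (fun y => sect (rpr y)) (fun _ => prj)
  solvmfd_hausdorff solvmfd_second_countable
  (fun y => @chart_ball_open (rpr y)) chart_ball_center sect_image_open
  (fun x y xy => (sect_in xy).2) (fun x y => @sect_continuous (rpr x) y)
  (fun _ _ _ => @prj_continuous _) sect_transition.

Lemma coord_center (y : Q) : coord y y = (rpr y : V).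
Proof. by rewrite /coord /= -[X in sect _ X]rprK sect_prj //; exact: ball_half. Qed.

Lemma prj_smooth_at (x : S) : smooth_at prj x.
Proof.
split; first exact: prj_continuous.
by apply: smooth_near_sect; exact: chart_ball_center.
Qed.

Lemma sect_smooth_at (a : V) (z : Q) : chart_ball a z -> smooth_at (sect a : Q -> S) z.
Proof.
move=> az; split; first exact: sect_continuous.
rewrite coord_center.
by apply: (@smooth_near_sect a (rpr z)); rewrite rprK.
Qed.

Lemma prj_local_diffeo : local_diffeo prj.
Proof.
move=> x; exists (ball (x : V) 2^-1), (chart_ball x), (sect x); split.
- by apply: (@ball_open _ V); rewrite invr_gt0.
- exact: ball_half.
- exact: chart_ball_open.
- move=> y xy; split; first by exists y.
    exact: sect_prj.
  exact: prj_smooth_at.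
- by move=> z xz; have [bz zE] := sect_in xz; split=> //; exact: sect_smooth_at.
Qed.

Lemma solvmfd_compact : compact [set: Q].
Proof.
pose box : set 'rV[R]_12 := [set v | forall i, `[0, 4]%classic (v ord0 i)].
have cbox : compact box.
  pose C (i : 'I_12) : set R := `[0, 4]%classic.
  have := @rV_compact _ _ C. move=> H; apply: H => i. exact: segment_compact.
have ct : continuous (fun v : 'rV[R]_12 => (v^T : S)).
  move=> v; apply: (@smooth_near_continuous _ _ V).
  apply: smooth_near_mx => i j.
  rewrite (_ : (fun _ => _) = fun v : 'rV[R]_12 => v j i); last by apply/funext => w; rewrite mxE.
  by apply: smooth_near_entry; exact: smooth_near_id.
have -> : [set: Q] = (prj \o (fun v : 'rV[R]_12 => (v^T : S))) @` box.
  apply/seteqP; split=> // y _; have [c Lc cb] := fundamental_domain (rpr y).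
  exists (smul c (rpr y))^T => [i|/=]; last by rewrite trmxK prj_smul // rprK.
  by rewrite mxE /= in_itv /= (_ : ord0 = 0) ?(ord1 ord0) // -co_ord; exact: cb.
apply: continuous_compact => //; apply: continuous_subspaceT => v.
by apply: continuous_comp; [exact: ct|exact: prj_continuous].
Qed.

Lemma solvmfd_quotient : is_quotient (@lattice R : set S) prj.
Proof.
split; [exact: prj_surj| |exact: prj_local_diffeo].
by move=> x y; split=> [/prj_eq //|H]; apply/prj_eq.
Qed.

Lemma solvmfd_lattice_quotient : lattice_quotient (@lattice R : set S) prj.
Proof.
by split; [exact: lattice_discrete|exact: solvmfd_quotient|exact: solvmfd_compact].
Qed.

End Quotient.

(** * Vector fields and connections on the quotient *)

Section Frame.
Context (R : realType).
Local Notation V := 'cV[R]_12.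
Local Notation Q := (solvmfd R).
Implicit Types (X Y Z : Q -> V) (x y : Q) (U : set Q).

(** The left-invariant frame at y, read in the chart at y. *)
Definition frame y : 'M[R]_12 := A (rpr y : V).
Definition coframe y : 'M[R]_12 := A (- (rpr y : V)).

Lemma frameK y : coframe y *m frame y = 1%:M.
Proof. exact: A_mulV. Qed.

Lemma coframeK y : frame y *m coframe y = 1%:M.
Proof. exact: A_mulVr. Qed.

Lemma frameKv y (v : V) : coframe y *m (frame y *m v) = v.
Proof. by rewrite mulmxA frameK mul1mx. Qed.

Lemma coframeKv y (v : V) : frame y *m (coframe y *m v) = v.
Proof. by rewrite mulmxA coframeK mul1mx. Qed.

Definition fcomp X y : V := coframe y *m X y.
(** The components of X in the frame, as a function on the group. It is periodic
    under the lattice, which acts on the left. *)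
Definition xi X (w : V) : V := fcomp X (prj w).

Lemma xi_rpr X x : xi X (rpr x) = fcomp X x.
Proof. by rewrite /xi rprK. Qed.

Lemma xi_smul X (c w : V) : lattice c -> xi X (smul c w) = xi X w.
Proof. by move=> Lc; rewrite /xi prj_smul. Qed.

Lemma derive_sect (a : V) (y : Q) (v : V) : chart_ball a y ->
  'D_v (fun w => sect a (prj w)) (rpr y) = A (sect a y) *m (coframe y *m v).
Proof.
move=> ay; have ay' : chart_ball a (prj (rpr y)) by rewrite rprK.
have [c [Lc cE near_c]] := sect_near ay'.
rewrite (near_eq_derive v near_c) derive_affine mulmxA; congr (_ *m _).
by rewrite -{1}(rprK y) cE /smul A_mul -mulmxA coframeK mulmx1.
Qed.

(** The left-hand side is the differential of a left translation by some c in the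
    lattice, and A c = A (sect (rpr x) y) *m A (- rpr y). *)
Lemma dcoordE x y (v : V) : chart_ball (rpr x) y ->
  dcoord x y v = A (sect (rpr x) y) *m (coframe y *m v).
Proof. by move=> xy; rewrite /dcoord coord_center; exact: derive_sect. Qed.

Lemma repE_near x X : \forall w \near (rpr x : V), rep x X w = A w *m xi X w.
Proof.
have : nbhs (rpr x : V) (ball (rpr x : V) 2^-1) by apply: nbhsx_ballx; rewrite invr_gt0.
apply: filterS => w xw; rewrite /rep dcoordE; last by exists w.
by rewrite sect_prj.
Qed.

Lemma smooth_near_A_id (w : V) : smooth_near (@A R) w.
Proof. by apply: smooth_near_A; [move=> a u v; reflexivity|move=> z; exact: cvg_id]. Qed.

Lemma smooth_near_A_opp (w : V) : smooth_near (fun w => @A R (- w)) w.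
Proof.
apply: smooth_near_A; first by move=> a u v; rewrite opprD scalerN.
by move=> z; exact: opp_continuous.
Qed.

Lemma smooth_vfE U X :
  smooth_vf U X <-> forall x, U x -> smooth_near (xi X) (rpr x : V).
Proof.
split=> sX x Ux; have := sX x Ux; rewrite coord_center => sx.
  have : smooth_near (fun w => A (- w) *m rep x X w) (rpr x : V).
    by apply: smooth_near_mulmx => //; exact: smooth_near_A_opp.
  apply: smooth_near_eq; have := repE_near x X; apply: filterS => w ->.
  by rewrite mulmxA A_mulV mul1mx.
have : smooth_near (fun w => A w *m xi X w) (rpr x : V).
  by apply: smooth_near_mulmx => //; exact: smooth_near_A_id.
by apply: smooth_near_eq; have := repE_near x X; apply: filterS => w ->.
Qed.

Lemma derive_rep x X (u : V) : differentiable (xi X) (rpr x : V) ->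
  'D_u (rep x X) (rpr x : V) =
  frame x *m (dact (coframe x *m u) (fcomp X x) + 'D_u (xi X) (rpr x : V)).
Proof.
move=> dX; rewrite (near_eq_derive u (repE_near x X)).
have [_ ->] := is_derive_frame (@ex_diff _ _ _ _ _ _ _ (is_diff_id (rpr x : V)))
  (@diff_derivable _ _ _ _ _ u dX).
by rewrite derive_id xi_rpr.
Qed.

(** The left-invariant connection whose value on frame fields is D. The term in
    [dact] is the derivative of the frame, so that nabla_X Y has the components
    X (xi Y) + D (xi X) (xi Y). *)
Definition christoffel (D : V -> V -> V) y (u v : V) : V :=
  frame y *m (D (coframe y *m u) (coframe y *m v) - dact (coframe y *m u) (coframe y *m v)).

Lemma nablaE D X Y x : differentiable (xi Y) (rpr x : V) ->
  nabla (christoffel D) X Y x =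
  frame x *m ('D_(X x) (xi Y) (rpr x : V) + D (fcomp X x) (fcomp Y x)).
Proof.
move=> dY; rewrite /nabla coord_center derive_rep // /christoffel -mulmxDr; congr (_ *m _).
by rewrite -/(fcomp X x) -/(fcomp Y x) [LHS]addrC addrA subrK addrC.
Qed.

Lemma vf_bracketE X Y x : differentiable (xi X) (rpr x : V) -> differentiable (xi Y) (rpr x : V) ->
  vf_bracket X Y x =
  frame x *m (bracket (fcomp X x) (fcomp Y x) + 'D_(X x) (xi Y) (rpr x : V) - 'D_(Y x) (xi X) (rpr x : V)).
Proof.
move=> dX dY; have EX := derive_rep (X x) dY; have EY := derive_rep (Y x) dX.
rewrite -[rpr x]coord_center in EX EY.
apply: etrans (f_equal2 (fun a b => a - b) EX EY) _; rewrite coord_center.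
rewrite -mulmxBr; congr (_ *m _).
by rewrite -dact_bracket -/(fcomp X x) -/(fcomp Y x) opprD addrACA addrA.
Qed.

Lemma torsion_tensorE D x (u v : V) :
  torsion_tensor (christoffel D) x u v =
  frame x *m torsion_lie (@bracket R) D (coframe x *m u) (coframe x *m v).
Proof.
rewrite /torsion_tensor /christoffel -mulmxBr /torsion_lie -dact_bracket; congr (_ *m _).
by apply: co_inj => k _; rewrite !(coD, coN); ring.
Qed.

(** Derivatives along the frame are also invariant under the lattice. *)
Lemma derive_periodic m n (f : V -> 'M[R]_(m, n)) (c w u : V) :
  (forall z, f (smul c z) = f z) ->
  'D_(A c *m u) f (smul c w) = 'D_u f w.
Proof.
move=> fc; rewrite /derive.
apply: (congr1 (fun F : R -> _ => lim (F t @[t --> 0^']))).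
apply/funext => t /=; rewrite fc -[in RHS]fc; congr (_ *: (f _ - _)).
by rewrite /smul mulmxDr -scalemxAr addrCA.
Qed.

(** At every w the formula [nablaE] is available in the chart at the orbit of w;
    [derive_periodic] transports it to w. *)
Lemma xi_nabla D U X Y (x : Q) : open U -> smooth_vf U X -> smooth_vf U Y -> U x ->
  \forall w \near (rpr x : V), xi (nabla (christoffel D) X Y) w =
    'D_(A w *m xi X w) (xi Y) w + D (xi X w) (xi Y w).
Proof.
move=> Uo sX sY Ux.
have : nbhs (rpr x : V) ((@prj R) @^-1` U : set V).
  by apply: prj_continuous; rewrite rprK; exact: open_nbhs_nbhs.
apply: filterS => w Uw; have dY := smooth_near_diff ((smooth_vfE U Y).1 sY _ Uw).
apply: etrans (congr1 (mulmx (coframe (prj w))) (nablaE D X dY)) _.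
apply: etrans (frameKv _ _) _; apply: (f_equal2 +%R); last by [].
have [c Lc wE] := (prj_eq (rpr (prj w)) w).1 (rprK _).
rewrite -(@derive_periodic _ _ (xi Y) c (rpr (prj w))) => [|z]; last exact: xi_smul.
have Aw : A w = A c *m frame (prj w) by rewrite [in LHS]wE /smul A_mul.
by rewrite -wE /xi /fcomp Aw -mulmxA coframeKv.
Qed.

End Frame.

(** * The balanced HKT structure and the Obata connection *)

Section Geometry.
Context (R : realType).
Local Notation V := 'cV[R]_12.
Local Notation Q := (solvmfd R).
Implicit Types (X Y Z : Q -> V) (x y : Q) (U : set Q).

Definition JM (a : 'I_3) (y : Q) : 'M[R]_12 := frame y *m Jt R a *m coframe y.
Definition gM (y : Q) : 'M[R]_12 := (coframe y)^T *m coframe y.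

Lemma form_gM y (u v : V) :
  form (gM y) u v = form (gt R) (coframe y *m u) (coframe y *m v).
Proof. by rewrite /form /gM /gt mulmx1 trmx_mul !mulmxA. Qed.

Lemma JM_coframe a y (v : V) : coframe y *m (JM a y *m v) = Jt R a *m (coframe y *m v).
Proof. by rewrite /JM -!mulmxA frameKv. Qed.

Lemma JM_frame a y (v : V) : JM a y *m (frame y *m v) = frame y *m (Jt R a *m v).
Proof. by rewrite /JM -!mulmxA frameKv. Qed.

Lemma coframe_inj y (u v : V) : coframe y *m u = coframe y *m v -> u = v.
Proof. by move=> uv; rewrite -(coframeKv y u) uv coframeKv. Qed.

Lemma fcomp_actf a X y : fcomp (actf (JM a) X) y = Jt R a *m fcomp X y.
Proof. exact: JM_coframe. Qed.

Lemma xi_actf a X : xi (actf (JM a) X) = fun w => Jt R a *m xi X w.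
Proof. by apply/funext => w; rewrite /xi fcomp_actf. Qed.

Lemma smooth_actf a U X : smooth_vf U X -> smooth_vf U (actf (JM a) X).
Proof.
rewrite !smooth_vfE => sX x Ux; rewrite xi_actf.
by apply: smooth_near_mulmx; [exact: smooth_near_cst|exact: sX].
Qed.

Lemma derive_mulmxl m n p (B : 'M[R]_(m, n)) (f : V -> 'M[R]_(n, p)) (w u : V) :
  differentiable f w -> 'D_u (fun z => B *m f z) w = B *m 'D_u f w.
Proof.
move=> df; have [_ ->] := is_derive_mulmx (@derivable_cst _ _ _ B w u) (@diff_derivable _ _ _ _ _ u df).
by rewrite derive_cst mul0mx add0r.
Qed.

Lemma quaternion_JM y : quaternion_relations (JM ^~ y).
Proof.
have JJ a b : JM a y *m JM b y = frame y *m (Jt R a *m Jt R b) *m coframe y.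
  rewrite /JM -!mulmxA; congr (_ *m (_ *m _)).
  by rewrite mulmxA frameK mul1mx.
have [J2 J12 J21] := quaternion_Jt R; split=> [a||].
- by rewrite JJ J2 mulmxN mulNmx mulmx1 coframeK.
- by rewrite JJ J12.
- by rewrite JJ J21 mulmxN mulNmx.
Qed.

Lemma Jt_sqr a (v : V) : Jt R a *m (Jt R a *m v) = - v.
Proof. by have [J2 _ _] := quaternion_Jt R; rewrite mulmxA J2 mulNmx mul1mx. Qed.

(** J is constant in the frame, so the derivatives of the components cancel, and
    the Nijenhuis tensor of the Lie algebra remains. *)
Lemma integrable_JM a U X Y x : open U -> smooth_vf U X -> smooth_vf U Y -> U x ->
  nijenhuis (@vf_bracket R 12 Q) (actf (JM a)) X Y x = 0.
Proof.
move=> Uo /smooth_vfE sX /smooth_vfE sY Ux.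
have dX := smooth_near_diff (sX x Ux); have dY := smooth_near_diff (sY x Ux).
have dJ Z : differentiable (xi Z) (rpr x : V) ->
    differentiable (xi (actf (JM a) Z)) (rpr x : V).
  move=> dZ; rewrite xi_actf.
  apply: (@differentiable_comp _ _ _ _ (xi Z) (mulmx (Jt R a))) => //.
  apply: linear_differentiable => w; apply: smooth_near_continuous.
  by apply: smooth_near_mulmx; [exact: smooth_near_cst|exact: smooth_near_id].
have dJX := dJ _ dX; have dJY := dJ _ dY.
rewrite [LHS](_ : _ = vf_bracket (actf (JM a) X) (actf (JM a) Y) x
  - JM a x *m vf_bracket (actf (JM a) X) Y x - JM a x *m vf_bracket X (actf (JM a) Y) x
  - vf_bracket X Y x) //.
rewrite (vf_bracketE dJX dJY) (vf_bracketE dJX dY) (vf_bracketE dX dJY) (vf_bracketE dX dY).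
rewrite !xi_actf !fcomp_actf !derive_mulmxl //.
rewrite !JM_frame -!mulmxBr; apply: (@coframe_inj x); rewrite frameKv mulmx0.
have NI := integrable_Jt a (fcomp X x) (fcomp Y x).
rewrite !(mulmxBr, mulmxDr) !Jt_sqr -[RHS]NI /nijenhuis.
by apply: co_inj => k _; rewrite !(coD, coN); ring.
Qed.

Lemma hypercomplex_JM : hypercomplex JM.
Proof.
split=> [a U X _|y|a U X Y x]; first exact: smooth_actf.
  exact: quaternion_JM.
exact: integrable_JM.
Qed.

Lemma form_entry (u v : V) : form (gt R) u v = \sum_k u k 0 * v k 0.
Proof. by rewrite form_gt_sum; apply: eq_bigr => k _; rewrite !co_ord. Qed.

Lemma riemannian_gM : riemannian_metric gM.
Proof.
have [_ gt0] := inner_product_gt R; split=> [y|U X Y _ /smooth_vfE sX /smooth_vfE sY x Ux].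
  split=> [|v v0]; first by rewrite /gM trmx_mul trmxK.
  rewrite form_gM; apply: gt0; apply: contra v0 => /eqP v0; apply/eqP.
  by apply: (@coframe_inj y); rewrite v0 mulmx0.
rewrite coord_center (_ : _ \o _ = fun w => \sum_k xi X w k 0 * xi Y w k 0); last first.
  by apply/funext => w; rewrite /= form_gM form_entry.
apply: smooth_near_sum => k; apply: smooth_near_mul; apply: smooth_near_entry.
  exact: sX.
exact: sY.
Qed.

Lemma compatible_gM y : compatible (JM ^~ y) (gM y).
Proof. by move=> a u v; rewrite !form_gM !JM_coframe compatible_gt. Qed.

Section Connection.
Variable D : V -> V -> V.
Hypothesis bD : is_bilinear D.

Lemma bilinear_entries (u v : V) :
  D u v = \sum_i \sum_j (u i 0 * v j 0) *: D (delta_mx i 0) (delta_mx j 0).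
Proof.
have [Dl Dr] := bD.
have Dl0 w : D 0 w = 0 by have := Dl (-1) 0 0 w; rewrite scaler0 addr0 scaleN1r addNr.
have Dr0 w : D w 0 = 0 by have := Dr (-1) 0 0 w; rewrite scaler0 addr0 scaleN1r addNr.
have Dls (r : seq 'I_12) c (d : 'I_12 -> V) w :
    D (\sum_(k <- r) c k *: d k) w = \sum_(k <- r) c k *: D (d k) w.
  by elim: r => [|k r IH]; rewrite ?big_nil // !big_cons Dl IH.
have Drs (r : seq 'I_12) c (d : 'I_12 -> V) w :
    D w (\sum_(k <- r) c k *: d k) = \sum_(k <- r) c k *: D w (d k).
  by elim: r => [|k r IH]; rewrite ?big_nil // !big_cons Dr IH.
rewrite {1}(cV_sum_delta u) Dls; apply: eq_bigr => i _.
rewrite {1}(cV_sum_delta v) Drs scaler_sumr; apply: eq_bigr => j _.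
by rewrite scalerA.
Qed.

Lemma smooth_near_bilinear (f g : V -> V) (w : V) :
  smooth_near f w -> smooth_near g w -> smooth_near (fun z => D (f z) (g z)) w.
Proof.
move=> sf sg.
rewrite (_ : (fun z => _) = fun z => \sum_i \sum_j
  (f z i 0 * g z j 0) *: D (delta_mx i 0) (delta_mx j 0)); last first.
  by apply/funext => z; rewrite bilinear_entries.
apply: smooth_near_sum => i; apply: smooth_near_sum => j.
apply: smooth_near_mx => k l.
rewrite (_ : (fun z => _) = fun z => f z i 0 * g z j 0 * D (delta_mx i 0) (delta_mx j 0) k l); last first.
  by apply/funext => z; rewrite mxE.
apply: smooth_near_mul; last exact: smooth_near_cst.
by apply: smooth_near_mul; exact: smooth_near_entry.
Qed.

Lemma christoffel_bilinear y : is_bilinear (christoffel D y).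
Proof.
have [Dl Dr] := bD; have [il ir] := dact_bilinear R.
split=> a u v w; rewrite /christoffel [coframe y *m (_ + _)]mulmxDr -scalemxAr ?(Dl, il) ?(Dr, ir);
  rewrite scalemxAr -mulmxDr; congr (_ *m _);
  by apply: co_inj => k _; rewrite !(coD, coN, coZ); ring.
Qed.

Lemma christoffel_connection : is_connection (christoffel D).
Proof.
split=> [y|U X Y Uo sX sY]; first exact: christoffel_bilinear.
apply/smooth_vfE => x Ux.
have X1 := (smooth_vfE U X).1 sX x Ux; have Y1 := (smooth_vfE U Y).1 sY x Ux.
apply: (smooth_near_eq (f := fun w => 'D_(A w *m xi X w) (xi Y) w + D (xi X w) (xi Y w))).
  by have := xi_nabla D Uo sX sY Ux; apply: filterS => w ->.
apply: smooth_near_add; last exact: smooth_near_bilinear.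
apply: smooth_near_dir => //; apply: smooth_near_mulmx => //.
exact: smooth_near_A_id.
Qed.

Lemma derive_form (f g : V -> V) (w u : V) : differentiable f w -> differentiable g w ->
  'D_u (fun z => form (gt R) (f z) (g z)) w =
  form (gt R) ('D_u f w) (g w) + form (gt R) (f w) ('D_u g w).
Proof.
move=> df dg.
have de (h : V -> V) k : differentiable h w -> derivable (fun z => h z k 0) w u.
  by move=> dh; have /derivable_mxP := @diff_derivable _ _ _ _ _ u dh; apply.
rewrite (_ : (fun z => _) = \sum_(k < 12) ((fun z => f z k 0) * (fun z => g z k 0))); last first.
  by apply/funext => z; rewrite fct_sumE form_entry.
rewrite derive_sum => [|k]; last by apply: derivableM; exact: de.
rewrite !form_entry -big_split /=; apply: eq_bigr => k _.
rewrite deriveM; [|exact: de|exact: de].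
rewrite !derive_entry // addrC; congr (_ + _).
by rewrite mulrC.
Qed.

Lemma christoffel_metric :
  (forall u v w, form (gt R) (D u v) w + form (gt R) v (D u w) = 0) ->
  parallel_metric (christoffel D) gM.
Proof.
move=> mD U X Y Z x _ _ /smooth_vfE sY /smooth_vfE sZ Ux.
have dY := smooth_near_diff (sY x Ux); have dZ := smooth_near_diff (sZ x Ux).
rewrite /dfun coord_center !form_gM !nablaE // !frameKv.
rewrite (_ : _ \o _ = fun w => form (gt R) (xi Y w) (xi Z w)); last first.
  by apply/funext => w; rewrite /= form_gM.
rewrite derive_form // !xi_rpr -/(fcomp Z x) -/(fcomp Y x).
have fD (a b c : V) : form (gt R) (a + b) c = form (gt R) a c + form (gt R) b c.
  by rewrite !form_gtE !coD; ring.
have fD' (a b c : V) : form (gt R) c (a + b) = form (gt R) c a + form (gt R) c b.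
  by rewrite !form_gtE !coD; ring.
by rewrite fD fD' addrACA mD addr0.
Qed.

Lemma christoffel_structures :
  (forall a u v, D u (Jt R a *m v) = Jt R a *m D u v) ->
  parallel_structures (christoffel D) JM.
Proof.
move=> JD a U X Y x _ _ sY Ux.
have sJY := smooth_actf a sY; move/smooth_vfE in sY; move/smooth_vfE in sJY.
have dY := smooth_near_diff (sY x Ux); have dJY := smooth_near_diff (sJY x Ux).
rewrite !nablaE // JM_frame; congr (_ *m _).
by rewrite mulmxDr fcomp_actf JD xi_actf derive_mulmxl.
Qed.

Lemma christoffel_torsion_form x u v w :
  torsion_form (gM x) (torsion_tensor (christoffel D) x) u v w =
  torsion_form (gt R) (torsion_lie (@bracket R) D) (coframe x *m u) (coframe x *m v) (coframe x *m w).
Proof. by rewrite /torsion_form form_gM torsion_tensorE frameKv. Qed.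

End Connection.

Lemma balanced_hkt_M : balanced_hkt JM gM.
Proof.
split.
- exact: hypercomplex_JM.
- exact: riemannian_gM.
- exact: compatible_gM.
exists (christoffel (@bismut R)).
  split.
  - exact: christoffel_connection (bismut_bilinear R).
  - exact: christoffel_metric (@bismut_metric R).
  - exact: christoffel_structures (@bismut_Jt R).
  - by move=> x u v; rewrite !christoffel_torsion_form; apply: bismut_torsion.
move=> x a e v oe.
rewrite -[RHS](lee_gt a (e := fun i => coframe x *m e i) (coframe x *m v)).
  rewrite /lee_form; congr (_ * _); apply: eq_bigr => i _.
  by rewrite christoffel_torsion_form !JM_coframe.
by move=> i j; rewrite -form_gM; exact: oe.
Qed.

Lemma obata_M : obata_connection JM (christoffel (@obata R)).
Proof.
split.
- exact: christoffel_connection (obata_bilinear R).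
- move=> U X Y x _ _ _ _; rewrite torsionE torsion_tensorE /torsion_lie.
  by rewrite obata_torsion subrr mulmx0.
- exact: christoffel_structures (@obata_Jt R).
Qed.

Lemma smooth_frame_field (u : V) : smooth_vf setT (fun y : Q => frame y *m u).
Proof.
apply/smooth_vfE => x _; apply: smooth_near_eq (smooth_near_cst u _).
by near=> w; rewrite /xi /fcomp frameKv.
Unshelve. all: by end_near. Qed.

(** The difference T of the two connections is symmetric and satisfies
    T (u, J v) = J T (u, v). Hence T (J_1 u, J_2 v) is equal to J_1 J_2 T (u, v) and
    to J_2 J_1 T (u, v), which are opposite. *)
Lemma obata_unique G : obata_connection JM G ->
  forall x u v, G x u v = christoffel (@obata R) x u v.
Proof.
move=> [_ tG jG] x; have [_ tO jO] := obata_M.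
set O := christoffel (@obata R) in tO jO *.
pose F u y : V := frame y *m (coframe x *m u).
have FE u : F u x = u by exact: coframeKv.
have sF u : smooth_vf setT (F u) by exact: smooth_frame_field.
pose T u v := G x u v - O x u v.
have Tsym u v : T u v = T v u.
  have := tG setT (F u) (F v) x openT (sF u) (sF v) I.
  have := tO setT (F u) (F v) x openT (sF u) (sF v) I.
  rewrite !torsionE /torsion_tensor !FE => /eqP; rewrite subr_eq0 => /eqP Ouv.
  by move=> /eqP; rewrite subr_eq0 => /eqP Guv; rewrite /T Ouv Guv.
have cancel (d d' p q r s : V) : d + p = d' + q -> d + r = d' + s -> p - r = q - s.
  move=> pq rs; have -> : p = d' + q - d by rewrite -pq addrC addKr.
  have -> : r = d' + s - d by rewrite -rs addrC addKr.
  by apply: co_inj => k _; rewrite !(coD, coN); ring.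
have TJ a u v : T u (JM a x *m v) = JM a x *m T u v.
  have := jG a setT (F u) (F v) x openT (sF u) (sF v) I.
  have := jO a setT (F u) (F v) x openT (sF u) (sF v) I.
  rewrite /nabla /actf !FE !mulmxDr => EO EG.
  rewrite mulmxN.
  exact: cancel EG EO.
have TE u v : G x u v - O x u v = T u v by [].
clearbody T.
have TJ' a u v : T (JM a x *m u) v = JM a x *m T u v by rewrite Tsym TJ Tsym.
move=> u v; apply/eqP; rewrite -subr_eq0 TE; apply/eqP.
have [J2 J12 J21] := quaternion_JM x.
have E : JM 0 x *m (JM 1 x *m T u v) = JM 1 x *m (JM 0 x *m T u v).
  by rewrite -(TJ 1 u v) -(TJ' 0 u _) (TJ 1 _ v) (TJ' 0 u v).
move: E; rewrite (mulmxA (JM 0 x)) (mulmxA (JM 1 x)) J12 J21 mulNmx => E.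
have : JM 2 x *m T u v = 0.
  apply: co_inj => k _; rewrite co0; have := congr1 (fun z : V => co z k) E.
  by rewrite coN; lra.
by move=> /(congr1 (mulmx (JM 2 x))); rewrite mulmx0 (mulmxA (JM 2 x)) J2 mulNmx mul1mx => /eqP;
  rewrite oppr_eq0 => /eqP.
Qed.

Lemma pushE (u : V) (x : solv R) :
  mdiff (@prj R) x (@left_inv R 12 (solv R) (1%:M *m u) x) = frame (prj x) *m u.
Proof.
have [c [Lc cE near_c]] := sect_near (chart_ball_center (prj x)).
have E : 'D_(A (x : V) *m u) (fun w : V => sect (rpr (prj x)) (prj w)) (x : V) = frame (prj x) *m u.
  rewrite (near_eq_derive _ near_c) derive_affine mulmxA /frame.
  by rewrite -[rpr (prj x)]coord_center [coord _ _]cE /smul A_mul.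
by rewrite left_invE mul1mx -E.
Qed.

Lemma induced_M : induced_structure (1%:M : 'M[R]_12) (@prj R) (@Jt R) (gt R) JM gM.
Proof.
split=> [a u x|u v x].
  apply: etrans (congr1 (mulmx (JM a (prj x))) (pushE u x)) _.
  exact: etrans (JM_frame a (prj x) u) (esym (pushE _ x)).
apply: etrans (f_equal2 (form (gM (prj x))) (pushE u x) (pushE v x)) _.
by rewrite form_gM !frameKv.
Qed.

End Geometry.

(** * The holonomy of the Obata connection *)

Section Quaternions.
Context (R : realType).

(** Laplace expansion for a matrix given by a function of natural numbers, which
    lets the minors be computed by reduction. *)
Lemma det_first_row n (F : nat -> nat -> R) :
  \det (\matrix_(i < n.+1, j < n.+1) F i j) =
  \sum_(j < n.+1) F 0%N j * ((-1) ^+ j * \det (\matrix_(i < n, k < n) F i.+1 (bump j k))).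
Proof.
rewrite (expand_det_row _ ord0); apply: eq_bigr => j _; rewrite mxE /cofactor add0n.
by congr (_ * (_ * \det _)); apply/matrixP => i k; rewrite !mxE.
Qed.

(** This is the matrix of the right multiplication by a + b i + c j + d k. *)
Lemma det_right_mult (a b c d : R) :
  \det (\matrix_(i < 4, j < 4) nth 0 (nth [::]
    [:: [:: a; - b; - c; - d]; [:: b; a; d; - c]; [:: c; - d; a; b]; [:: d; c; - b; a]] i) j) =
  (a ^+ 2 + b ^+ 2 + c ^+ 2 + d ^+ 2) ^+ 2.
Proof.
pose F i j := nth 0 (nth [::]
  [:: [:: a; - b; - c; - d]; [:: b; a; d; - c]; [:: c; - d; a; b]; [:: d; c; - b; a]] i) j.
have D3 j := @det_first_row 2 (fun i k => F i.+1 (bump j k)).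
have D2 j l := @det_first_row 1 (fun i k => F i.+2 (bump j (bump l k))).
have D1 j l m := @det_first_row 0 (fun i k => F i.+3 (bump j (bump l (bump m k)))).
rewrite (@det_first_row 3 F) !big_ord_recr big_ord0 /= !D3 !big_ord_recr !big_ord0 /=.
rewrite !D2 !big_ord_recr !big_ord0 /= !D1 !big_ord_recr !big_ord0 !det_mx00 /F /bump /=; ring.
Qed.

End Quaternions.

Section Parallel.
Context (R : realType).
Local Notation V := 'cV[R]_12.
Local Notation Q := (solvmfd R).

Lemma zero_derivative_constant (f : R -> R) (t : R) : 0 <= t ->
  (forall s, 0 <= s <= t -> is_derive s 1 f 0) -> f t = f 0.
Proof.
move=> t0 df.
have cf : {within `[0, t], continuous f}.
  apply: continuous_in_subspaceT => s; rewrite inE /= in_itv /= => /df [d _].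
  by apply: differentiable_continuous; apply/derivable1_diffP.
have [s _] := @MVT_segment _ f (fun=> 0) 0 t t0 (fun s => fun h => df s (subset_itv_oo_cc h)) cf.
by rewrite mul0r => /eqP; rewrite subr_eq0 => /eqP.
Qed.

(** The equation of parallel transport for the components in the frame. *)
Definition parallel_sol (mu eta : R -> V) : Prop :=
  forall t, 0 <= t <= 1 -> derivable eta t 1 /\ 'D_1 eta t = - obata (mu t) (eta t).

Lemma sol_Jt mu eta a : parallel_sol mu eta -> parallel_sol mu (fun s => Jt R a *m eta s).
Proof.
move=> sol t t01; have [d E] := sol t t01.
have [d' E'] := is_derive_mulmx (@derivable_cst _ _ _ (Jt R a) t 1) d.
by split=> //; rewrite E' derive_cst mul0mx add0r E mulmxN obata_Jt.
Qed.

Lemma sol_sub mu e1 e2 : parallel_sol mu e1 -> parallel_sol mu e2 ->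
  parallel_sol mu (e1 - e2).
Proof.
move=> s1 s2 t t01; have [d1 E1] := s1 t t01; have [d2 E2] := s2 t t01.
split; first exact: derivableB.
rewrite deriveB // E1 E2 -opprD; congr (- _).
have [_ obr] := obata_bilinear R.
have -> : (e1 - e2) t = (-1) *: e2 t + e1 t by rewrite scaleN1r addrC.
by rewrite obr scaleN1r addrC.
Qed.

Lemma is_derive_co (eta : R -> V) t k : derivable eta t 1 ->
  is_derive t 1 (fun s => co (eta s) k) (co ('D_1 eta t) k).
Proof.
case: (ltnP k 12) => k12 d.
  have /derivable_mxP /(_ (Ordinal k12) 0) dk := d.
  have E : (fun s => co (eta s) k) = (fun s => eta s (Ordinal k12) 0).
    by apply/funext => s; rewrite (co_ord _ (Ordinal k12)).
  rewrite E; apply: DeriveDef => //.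
  by rewrite (co_ord _ (Ordinal k12)) derive_mx // mxE.
have co_out (v : V) : co v k = 0.
  by rewrite co.unlock; case: insubP => // i; rewrite ltnNge k12.
rewrite (_ : (fun _ => _) = fun=> 0); last by apply/funext.
by rewrite co_out; exact: is_derive_cst.
Qed.

Section Solution.
Variables mu eta : R -> V.
Hypothesis sol : parallel_sol mu eta.

Lemma sol_co (t : R) k : 0 <= t <= 1 ->
  is_derive t 1 (fun s => co (eta s) k) (- co (obata (mu t) (eta t)) k).
Proof. by move=> /sol [d E]; have := is_derive_co k d; rewrite E coN. Qed.

Lemma sol_co_constant k (t : R) : 0 <= t <= 1 ->
  (forall s, 0 <= s <= t -> co (obata (mu s) (eta s)) k = 0) ->
  co (eta t) k = co (eta 0) k.
Proof.
move=> /andP[t0 t1] z; apply: (zero_derivative_constant t0 (f := fun s => co (eta s) k)).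
move=> s st; have := @sol_co s k; rewrite z // oppr0; apply.
by case/andP: st => s0 st; rewrite s0 (le_trans st).
Qed.

(** The components on e_5, ..., e_8 are constant because D has no component there. *)
Lemma sol_middle (t : R) k : 0 <= t <= 1 -> k \in [:: 4; 5; 6; 7]%N ->
  co (eta t) k = co (eta 0) k.
Proof.
move=> t01 hk; apply: sol_co_constant => // s _; move: hk; rewrite !inE.
by move=> /or4P[]/eqP->; rewrite co_vec.
Qed.

(** The derivatives of the components on e_1, ..., e_4 only involve those on
    e_5, ..., e_8. *)
Lemma sol_center k : (forall j, j \in [:: 4; 5; 6; 7]%N -> co (eta 0) j = 0) ->
  k \in [:: 0; 1; 2; 3]%N -> co (eta 1) k = co (eta 0) k.
Proof.
move=> z hk; apply: sol_co_constant => [|s s01]; first by rewrite ler01 lexx.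
have e j : j \in [:: 4; 5; 6; 7]%N -> co (eta s) j = 0.
  by move=> hj; rewrite sol_middle // z.
by move: hk; rewrite !inE => /or4P[]/eqP->; rewrite co_vec //= !e // !mul0r !(addr0, subr0).
Qed.

Definition sqnorm (v : V) : R :=
  co v 8 * co v 8 + co v 9 * co v 9 + co v 10 * co v 10 + co v 11 * co v 11.

(** rho(e_1) is skew. *)
Lemma sol_sqnorm : sqnorm (eta 1) = sqnorm (eta 0).
Proof.
apply: (zero_derivative_constant ler01 (f := fun s => sqnorm (eta s))) => s s01.
have d k := sol_co k s01.
pose h k := (fun s => co (eta s) k).
have D := is_deriveD (is_deriveD (is_deriveD (is_deriveM (d 8%N) (d 8%N))
  (is_deriveM (d 9%N) (d 9%N))) (is_deriveM (d 10%N) (d 10%N))) (is_deriveM (d 11%N) (d 11%N)).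
have D' : is_derive s 1 (fun s => sqnorm (eta s)) _ := D.
apply: (is_derive_eq D').
rewrite !co_vec //= /GRing.scale /=; ring.
Qed.

(** The equation is triangular: the components on e_5, ..., e_8 vanish, then
    those on e_1, ..., e_4, and the norm of the last ones is constant. *)
Lemma sol_unique : eta 0 = 0 -> eta 1 = 0.
Proof.
move=> e0; have n1 := sol_sqnorm.
have z j : co (eta 0) j = 0 by rewrite e0 co0.
have s0 : sqnorm (eta 1) = 0 by rewrite n1 /sqnorm !z; ring.
have sq k : 0 <= co (eta 1) k * co (eta 1) k by rewrite -expr2 sqr_ge0.
have sz k : co (eta 1) k * co (eta 1) k = 0 -> co (eta 1) k = 0.
  by move=> /eqP; rewrite mulf_eq0 orbb => /eqP.
have [q8 q9 q10 q11] := And4 (sq 8%N) (sq 9%N) (sq 10%N) (sq 11%N).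
apply: co_inj => k; rewrite co0; rewrite /sqnorm in s0.
do 4? [case: k => [_|k]; first by rewrite sol_center // z].
do 4? [case: k => [_|k]; first by rewrite sol_middle ?ler01 ?lexx // z].
do 4? [case: k => [_|k]; first by apply: sz; lra].
by [].
Qed.

End Solution.

Section Transport.
Variables (mu : R -> V) (B : 'M[R]_12).
Hypothesis HB : forall v, exists eta, [/\ parallel_sol mu eta, eta 0 = v & eta 1 = B *m v].

(** J maps solutions to solutions, and solutions are unique. *)
Lemma transport_Jt a : B *m Jt R a = Jt R a *m B.
Proof.
apply: mx_ext => v; rewrite -!mulmxA.
have [e [se e0 e1]] := HB v; have [f [sf f0 f1]] := HB (Jt R a *m v).
have := sol_unique (sol_sub sf (sol_Jt a se)).
rewrite !fctE f0 e0 f1 e1 subrr => /(_ erefl) /eqP.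
by rewrite subr_eq0 => /eqP.
Qed.

Lemma transport_middle v k : k \in [:: 4; 5; 6; 7]%N -> co (B *m v) k = co v k.
Proof.
have [e [se <- <-]] := HB v => hk.
by apply: (sol_middle se) => //; rewrite ler01 lexx.
Qed.

Lemma transport_center v k : (forall j, j \in [:: 4; 5; 6; 7]%N -> co v j = 0) ->
  k \in [:: 0; 1; 2; 3]%N -> co (B *m v) k = co v k.
Proof. by have [e [se <- <-]] := HB v => z hk; exact: (sol_center se). Qed.

Lemma transport_sqnorm v : sqnorm (B *m v) = sqnorm v.
Proof. by have [e [se <- <-]] := HB v; exact: (sol_sqnorm se). Qed.

Lemma transport_outer v k : (forall j, (8 <= j)%N -> co v j = 0) ->
  (8 <= k < 12)%N -> co (B *m v) k = 0.
Proof.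
move=> z; have s0 : sqnorm (B *m v) = 0 by rewrite transport_sqnorm /sqnorm !z //; ring.
have sq j : 0 <= co (B *m v) j * co (B *m v) j by rewrite -expr2 sqr_ge0.
have sz j : co (B *m v) j * co (B *m v) j = 0 -> co (B *m v) j = 0.
  by move=> /eqP; rewrite mulf_eq0 orbb => /eqP.
have [q8 q9 q10 q11] := And4 (sq 8%N) (sq 9%N) (sq 10%N) (sq 11%N).
rewrite /sqnorm in s0.
do 8? [case: k => [//|k]].
do 4? [case: k => [_|k]; first by apply: sz; lra].
by [].
Qed.

Lemma co_mul_delta (j : 'I_12) k : (k < 12)%N ->
  co (B *m delta_mx j 0) k = B (inord k) j.
Proof. by move=> k12; rewrite -co_inord // -colE mxE. Qed.

Lemma co_delta_ord (j : 'I_12) k : (k < 12)%N -> co (delta_mx j 0 : V) k = (k == j)%:R.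
Proof.
move=> k12; rewrite -co_inord // mxE eqxx andbT -val_eqE /= inordK //.
Qed.

(** In the blocks (e_1, ..., e_4), (e_5, ..., e_8), (f_1, ..., f_4) the matrix is
    upper triangular with diagonal 1, 1, C. The first column (a, b, c, d) of C has
    norm 1, and the others are its images under J_1, J_2, J_3, so that
    C is the matrix of [det_right_mult]. *)
Lemma transport_det : \det B = 1.
Proof.
pose B' : 'M[R]_(8 + 4) := B.
have eB (i j : 'I_12) : B i j = co (B *m delta_mx j 0) i.
  by rewrite co_mul_delta // inord_val.
have B'E : B' = block_mx (ulsubmx B') (ursubmx B') 0 (drsubmx B').
  rewrite -[LHS]submxK; congr block_mx; apply/matrixP => i j; rewrite !mxE.
  rewrite [LHS](eB (rshift 8 i) (lshift 4 j)); apply: transport_outer => [k k8|].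
    case: (ltnP k 12) => k12; last by rewrite co.unlock insubF // ltnNge k12.
    rewrite co_delta_ord //= (_ : (k == j) = false) //.
    by apply/eqP => kj; have := ltn_ord j; rewrite -kj ltnNge k8.
  have H : (8 <= 8 + i < 8 + 4)%N by rewrite leq_addr ltn_add2l ltn_ord.
  exact: H.
pose P : 'M[R]_(4 + 4) := ulsubmx B'.
have PE : P = block_mx 1%:M (ursubmx P) 0 1%:M.
  have z (j : 'I_8) (j4 : (j < 4)%N) k : k \in [:: 4; 5; 6; 7]%N ->
      co (delta_mx (lshift 4 j : 'I_12) 0 : V) k = 0.
    rewrite !inE => /or4P[]/eqP->; rewrite co_delta_ord //=;
    by rewrite (_ : (_ == _ :> nat) = false) //; apply/eqP => kj; rewrite -kj in j4.
  rewrite -[LHS]submxK; congr block_mx; apply/matrixP => i j; rewrite !mxE.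
  - rewrite [LHS](eB (lshift 4 (lshift 4 i)) (lshift 4 (lshift 4 j))).
    rewrite transport_center; first by rewrite co_delta_ord.
      by apply: z => /=.
    by case: i => [[|[|[|[|]]]]].
  - rewrite [LHS](eB (lshift 4 (rshift 4 i)) (lshift 4 (lshift 4 j))).
    rewrite transport_middle; last by case: i => [[|[|[|[|]]]]].
    by rewrite z //=; case: i => [[|[|[|[|]]]]].
  - rewrite [LHS](eB (lshift 4 (rshift 4 i)) (lshift 4 (rshift 4 j))).
    rewrite transport_middle; last by case: i => [[|[|[|[|]]]]].
    rewrite co_delta_ord; last by case: i => [[|[|[|[|]]]]].
    by congr (_%:R); congr nat_of_bool; exact: eqn_add2l.
have dB : \det B' = \det P * \det (drsubmx B') by rewrite [in LHS]B'E det_ublock.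
have dP : \det P = 1 by rewrite PE det_ublock !det1 mulr1.
rewrite [LHS](dB : \det B = _) dP mul1r.
pose e8 : V := delta_mx (inord 8) 0.
pose a := co (B *m e8) 8; pose b := co (B *m e8) 9.
pose c := co (B *m e8) 10; pose d := co (B *m e8) 11.
have n1 : a ^+ 2 + b ^+ 2 + c ^+ 2 + d ^+ 2 = 1.
  have := transport_sqnorm e8; rewrite /sqnorm -/a -/b -/c -/d !expr2 => ->.
  by rewrite /e8 !co_delta //=; ring.
rewrite (_ : drsubmx B' = \matrix_(i < 4, j < 4) nth 0 (nth [::]
    [:: [:: a; - b; - c; - d]; [:: b; a; d; - c]; [:: c; - d; a; b]; [:: d; c; - b; a]] i) j).
  by rewrite det_right_mult n1 expr1n.
have col j k (v : V) : (k < 4)%N -> (j < 4)%N ->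
  delta_mx (inord (8 + j)) 0 = v -> B (inord (8 + k)) (inord (8 + j)) = co (B *m v) (8 + k).
  by move=> k4 j4 <-; rewrite co_mul_delta // -[12%N]/(8 + 4)%N ltn_add2l.
have JB i (v : V) : B *m (Jt R i *m v) = Jt R i *m (B *m v).
  by rewrite mulmxA transport_Jt -mulmxA.
have E0 : delta_mx (inord 8) 0 = e8 by [].
have Ej (i : 'I_3) j : (j < 12)%N -> (forall k, (k < 12)%N -> co (Jt R i *m e8) k = (k == j)%:R) ->
    delta_mx (inord j) 0 = Jt R i *m e8.
  by move=> j12 H; apply: co_inj => k k12; rewrite H // co_delta.
have E1 : delta_mx (inord 9) 0 = Jt R 0 *m e8.
  apply: Ej => //; rewrite JtE /Jact /=; do 12? [case=> [_|]]; last by [];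
  by rewrite co_vec //= ?co_delta //= ?oppr0.
have E2 : delta_mx (inord 10) 0 = Jt R 1 *m e8.
  apply: Ej => //; rewrite JtE /Jact /=; do 12? [case=> [_|]]; last by [];
  by rewrite co_vec //= ?co_delta //= ?oppr0.
have E3 : delta_mx (inord 11) 0 = Jt R 2 *m e8.
  apply: Ej => //; rewrite JtE /Jact /=; do 12? [case=> [_|]]; last by [];
  by rewrite co_vec //= ?co_delta //= ?oppr0.
apply/matrixP => i j; rewrite !mxE.
rewrite [LHS](_ : _ = B (inord (8 + i)) (inord (8 + j))); last first.
  by congr (B _ _); apply: val_inj; rewrite /= inordK // -[12%N]/(8 + 4)%N ltn_add2l.
case: j => [[|[|[|[|//]]]] j4] /=.
- rewrite (col 0%N i e8) //.
  by case: i => [[|[|[|[|//]]]] i4].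
- rewrite (col 1%N i _ _ _ E1) // JB JtE /Jact /=.
  by case: i => [[|[|[|[|//]]]] i4]; rewrite co_vec.
- rewrite (col 2%N i _ _ _ E2) // JB JtE /Jact /=.
  by case: i => [[|[|[|[|//]]]] i4]; rewrite co_vec.
- rewrite (col 3%N i _ _ _ E3) // JB JtE /Jact /=.
  by case: i => [[|[|[|[|//]]]] i4]; rewrite co_vec.
Qed.

End Transport.
End Parallel.

Section Holonomy.
Context (R : realType).
Local Notation V := 'cV[R]_12.
Local Notation Q := (solvmfd R).
Variable G : Q -> V -> V -> V.
Hypothesis GE : forall x u v, G x u v = christoffel (@obata R) x u v.

(** Near t the field is A (k s) *m eta s in the chart at c t, where k is the curve
    read in this chart. The derivative of A in [is_derive_frame] is cancelled by the
    term in [dact] of the Christoffel symbols. *)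
Lemma parallel_along_sol (c : R -> Q) (W : R -> V) :
  smooth_curve c -> parallel_along G c W ->
  parallel_sol (fun t => coframe (c t) *m velocity c t) (fun t => coframe (c t) *m W t).
Proof.
move=> [U [Uo IU cU]] par t t01.
have It : t \in `[0, 1] by rewrite in_itv.
have [cc sc] := cU t (IU t It).
have [dF EF] := par t It.
pose k s : V := coord (c t) (c s).
pose eta s : V := coframe (c s) *m W s.
have dk : differentiable k t := smooth_near_diff sc.
have kt : k t = rpr (c t) by exact: coord_center.
have near_t : \forall s \near t, chart_ball (rpr (c t)) (c s).
  apply: cc; apply: open_nbhs_nbhs; split; first exact: chart_ball_open.
  exact: chart_ball_center.
have near_F : \forall s \near t, dcoord (c t) (c s) (W s) = A (k s) *m eta s.
  by apply: filterS near_t => s cs; rewrite dcoordE.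
have dAeta : derivable (fun s => A (k s) *m eta s) t 1 by exact: near_eq_derivable near_F dF.
have deta : derivable eta t 1.
  have dN : differentiable (fun s => - k s) t by exact: differentiableN.
  have [d _] := is_derive_mulmx (@derivable_A_comp _ _ (fun s => - k s) t 1 dN) dAeta.
  rewrite (_ : eta = fun s => A (- k s) *m (A (k s) *m eta s)) //.
  by apply/funext => s; rewrite mulmxA A_mulV mul1mx.
split; first exact: deta.
have EA : 'D_1 (fun s => dcoord (c t) (c s) (W s)) t =
    frame (c t) *m (dact (coframe (c t) *m velocity c t) (eta t) + 'D_1 eta t).
  rewrite (near_eq_derive _ near_F).
  have [_ ->] := is_derive_frame dk deta.
  by rewrite kt /velocity derive1E.
move: EF; rewrite derive1E EA GE /christoffel -/(eta t) -mulmxDr => /(congr1 (mulmx (coframe (c t)))).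
rewrite frameKv mulmx0 => E.
apply: co_inj => j _; have := congr1 (fun v : V => co v j) E.
by rewrite !(coD, coN) co0; lra.
Qed.

Definition special (B : 'M[R]_12) : Prop := (forall a, B *m Jt R a = Jt R a *m B) /\ \det B = 1.

Lemma special_mul (B C : 'M[R]_12) : special B -> special C -> special (B *m C).
Proof.
move=> [BJ dB] [CJ dC]; split=> [a|]; last by rewrite det_mulmx dB dC mulr1.
by rewrite -mulmxA CJ !mulmxA BJ.
Qed.

Lemma transport_along_special (c : R -> Q) (B : 'M[R]_12) :
  smooth_curve c -> transport_along G c B ->
  special (coframe (c 1) *m B *m frame (c 0)).
Proof.
move=> sc tB.
have H (v : V) : exists eta, [/\ parallel_sol (fun t => coframe (c t) *m velocity c t) eta,
    eta 0 = v & eta 1 = coframe (c 1) *m B *m frame (c 0) *m v].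
  have [W [pW W0 W1]] := tB (frame (c 0) *m v).
  exists (fun t => coframe (c t) *m W t); split; first exact: parallel_along_sol.
    by rewrite W0 frameKv.
  by rewrite W1 !mulmxA.
by split=> [a|]; [exact: transport_Jt H a|exact: transport_det H].
Qed.

Lemma transport_special x y (B : 'M[R]_12) :
  transport G x y B -> special (coframe y *m B *m frame x).
Proof.
elim=> [|c C B' sc _ sC tB].
  by rewrite mulmx1 frameK; split=> [a|]; rewrite ?mul1mx ?mulmx1 ?det1.
have := special_mul (transport_along_special sc tB) sC.
rewrite (_ : _ *m _ = coframe (c 1) *m (B' *m C) *m frame x) //.
by rewrite -!mulmxA; congr (_ *m (_ *m _)); rewrite !mulmxA coframeK mul1mx.
Qed.

Lemma holonomy_SLH : @holonomy_in_SLH R 3 Q (@JM R) G.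
Proof.
move=> x; exists (frame x); split.
- exact: (mulmx1_unit (coframeK x)).1.
- move=> a; rewrite quatH_Jt (_ : invmx (frame x) = coframe x).
    by rewrite /JM !mulmxA frameK mul1mx -mulmxA frameK mulmx1.
  rewrite -[RHS]mulmx1 -(mulmxV (mulmx1_unit (coframeK x)).1) mulmxA frameK.
  by rewrite mul1mx.
move=> B /transport_special [BJ dB].
have -> : invmx (frame x) = coframe x.
  rewrite -[RHS]mulmx1 -(mulmxV (mulmx1_unit (coframeK x)).1) mulmxA frameK.
  by rewrite mul1mx.
by split=> // a; rewrite quatH_Jt; exact: BJ.
Qed.

End Holonomy.

(** * The quotient is not a nilmanifold *)

Section NonNilpotence.
Context (R : realType).
Local Notation V := 'cV[R]_12.
Local Notation Q := (solvmfd R).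

(** The plane spanned by e_1 and f_1, which is a subset closed under the left
    translations by its elements of the lattice. *)
Definition plane (z : R * R) : solv R :=
  vec 12 (fun k => if k == 0%N then z.1 else if k == 8%N then z.2 else 0).

Lemma plane_continuous : continuous plane.
Proof.
move=> z; apply: (@smooth_near_continuous R (R * R)%type V).
apply: smooth_near_mx => i j.
rewrite (_ : (fun w => _) = fun w : R * R =>
  if i == 0%N :> nat then w.1 else if i == 8%N :> nat then w.2 else 0); last first.
  by apply/funext => w; rewrite /plane (ord1 j) -co_ord co_vec.
case: (nat_of_ord i == 0%N).
  by apply: smooth_near_linear; [move=> a u v; reflexivity|move=> w; exact: cvg_fst].
case: (nat_of_ord i == 8%N); last exact: smooth_near_cst.
by apply: smooth_near_linear; [move=> a u v; reflexivity|move=> w; exact: cvg_snd].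
Qed.

Lemma plane0 : plane (0, 0) = 1%g.
Proof. by apply: co_inj => k k12; rewrite co_vec //= [RHS]co0; do 2?case: ifP. Qed.

Lemma lattice_plane_t : (@lattice R) (plane (pi, 0)).
Proof.
move=> k k12; rewrite co_vec //= /period; case: ifP => _.
  by rewrite divff ?rpred1 // gt_eqF // pi_gt0.
by case: ifP => _; rewrite mul0r rpred0.
Qed.

Lemma lattice_plane_v : (@lattice R) (plane (0, 1)).
Proof.
move=> k k12; rewrite co_vec //= /period; case: ifP => _; first by rewrite mul0r rpred0.
by case: ifP => _; rewrite divr1 ?rpred1 ?rpred0.
Qed.

(** The rotation by pi is - 1. *)
Lemma plane_mul_t s t : (plane (pi, 0) * plane (s, t))%g = plane (s + pi, - t).
Proof.
apply: co_inj; rewrite [(_ * _)%g]/(smul (plane (pi, 0)) (plane (s, t))) /smul.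
do 12? [case=> [_|]]; last by [].
all: rewrite coD AE; do 2! rewrite ?co_vec //=; rewrite ?cospi ?sinpi; ring.
Qed.

Lemma plane_mul_v s t u : (plane (0, u) * plane (s, t))%g = plane (s, t + u).
Proof.
apply: co_inj; rewrite [(_ * _)%g]/(smul (plane (0, u)) (plane (s, t))) /smul.
do 12? [case=> [_|]]; last by [].
all: rewrite coD AE; do 2! rewrite ?co_vec //=; rewrite ?cos0 ?sin0; ring.
Qed.

(** The commutator of b^m with a is b^(- 2 m). *)
Lemma inverted_lower_central (G : groupType) (a b : G) k : (a^-1 * b * a = b^-1)%g ->
  iter k (fun H : set G => commutator_subgroup H [set: G]) [set: G] (b ^+ (2 ^ k))%g.
Proof.
move=> ab; elim: k => [//|k IH] /=.
move=> H [[H1 HM HV] sub].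
set x := (b ^+ (2 ^ k))%g.
have ax : (a^-1 * x * a = x^-1)%g.
  have E : (b ^ a = b^-1)%g by rewrite /conjg mulgA.
  by rewrite -mulgA -[LHS]/(x ^ a)%g conjXg E expVgn.
have -> : (b ^+ (2 ^ k.+1) = (commg x a)^-1)%g.
  rewrite /commg /conjg [(a^-1 * _)%g]mulgA ax invgM !invgK.
  by rewrite expnS mul2n -addnn expgnDr.
by apply: HV; apply: sub; exists x, a; split.
Qed.

Section Nil.
Variables (N : lieGroupType R 12) (Gamma : set N) (q : N -> Q).
Hypothesis nilN : nilpotent_group N.
Hypothesis lat : lattice_quotient Gamma q.

Lemma not_nilmanifold : False.
Proof.
have [dG qG cG] := lat.
have [_ qE _] := qG; have [[G1 GM GV] _] := dG.
have dL := @lattice_discrete R; have qL := @solvmfd_quotient R.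
have [_ pE _] := qL.
have cP := @prj_continuous R.
have [n0 qn0] : exists n0, q n0 = prj (1%g : solv R) by have [surj _ _] := qG; exact: surj.
pose H z : Q := prj (plane z).
have cH : continuous H.
  move=> z; apply: (@continuous_comp _ _ _ plane (@prj R)); first exact: plane_continuous.
  exact: cP.
have [P [cPl qP P0]] := plane_lift dG qG (n0 := n0) cH (etrans qn0 (congr1 (@prj R) (esym plane0))).
have shift (f : R * R -> R * R) : continuous f -> continuous (P \o f).
  by move=> cf z; apply: continuous_comp; [exact: cf|exact: cPl].
have c1 : continuous (fst : R * R -> R) by move=> z; exact: cvg_fst.
have c2 : continuous (snd : R * R -> R) by move=> z; exact: cvg_snd.
have cst' (r : R) : continuous (fun _ : R * R => r) by move=> z; exact: cvg_cst.
have cm1 : continuous (fun z : R * R => (z.1 + pi, z.2)).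
  by apply: continuous_pair => // z; apply: cvgD; [exact: c1|exact: cvg_cst].
have cm2 : continuous (fun z : R * R => (z.1, - z.2)).
  by apply: continuous_pair => // z; apply: cvgN; exact: c2.
have cm3 r : continuous (fun z : R * R => (z.1, z.2 + r)).
  by apply: continuous_pair => // z; apply: cvgD; [exact: c2|exact: cvg_cst].
have [a Ga aE] : exists2 a, Gamma a & forall s t, P (s + pi, t) = (a * P (s, - t))%g.
  have [z|a Ga aE] := lift_unique_all dG qG (shift _ cm2) (shift _ cm1).
    rewrite /= !qP /H; apply/pE; exists (plane (pi, 0)); first exact: lattice_plane_t.
    by rewrite plane_mul_t opprK.
  by exists a => // s t; exact: (aE (s, t)).
have [b Gb bE] : exists2 b, Gamma b & forall s t, P (s, t + 1) = (b * P (s, t))%g.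
  have [z|b Gb bE] := lift_unique_all dG qG cPl (shift _ (cm3 1)).
    rewrite /= !qP /H; apply/pE; exists (plane (0, 1)); first exact: lattice_plane_v.
    by case: z => s t; rewrite plane_mul_v.
  by exists b => // s t; exact: (bE (s, t)).
(* P (pi, 1) computed in two ways gives a = b a b. *)
have ab : (a^-1 * b * a = b^-1)%g.
  have E1 : P (0 + pi, 0 + 1) = (b * a * P (0, 0))%g by rewrite bE aE oppr0 mulgA.
  have E2 : P (0, 0) = (b * P (0, - (0 + 1)))%g by rewrite -bE opprD oppr0 add0r addNr.
  have E3 : P (0 + pi, 0 + 1) = (a * P (0, - (0 + 1)))%g by rewrite aE.
  have E4 : (a = b * a * b)%g.
    apply: (mulIg (P (0, - (0 + 1)))); rewrite -E3 E1 E2.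
    by rewrite !mulgA.
  have E5 : (a^-1 * b * a * b = 1)%g.
    by rewrite -[(a^-1 * b * a)%g]mulgA -mulgA -E4 mulVg.
  by apply: (mulIg b); rewrite E5 mulVg.
have [k nilk] := nilN.
have bk : (b ^+ (2 ^ k))%g = 1%g.
  by have := inverted_lower_central k ab; rewrite nilk.
pose m : R := (2 ^ k)%:R.
have m0 : 0 < m by rewrite ltr0n expn_gt0.
have Pm (s t : R) (j : nat) : P (s, t + j%:R) = (b ^+ j * P (s, t))%g.
  elim: j => [|j IH]; first by rewrite addr0 expg0 mul1g.
  by rewrite -natr1 addrA bE IH expgS mulgA.
(* The two loops of the quotient commute up to homotopy once the second one
   lifts to a loop of N: this torus is made by the multiplication of N. *)
pose F z : Q := q (P (z.1, 0) * n0^-1 * P (0, z.2))%g.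
have cs1 : continuous (fun z : R * R => (z.1, 0 : R)) by exact: continuous_pair.
have cs2 : continuous (fun z : R * R => (0 : R, z.2)) by exact: continuous_pair.
have cF : continuous F.
  have cg : continuous (fun z => P (z.1, 0) * n0^-1 * P (0, z.2))%g.
    apply: continuous_mulg; last exact: shift cs2.
    by apply: continuous_mulg; [exact: shift cs1|move=> z; exact: cvg_cst].
  move=> z; apply: (@continuous_comp _ _ _ _ q _ (cg z)).
  exact: quotient_map_continuous qG _.
have F0 : prj (1%g : solv R) = F (0, 0) by rewrite /F /= P0 mulgVK qn0.
have [L [cL pL L0]] := plane_lift dL qL cF F0.
have shiftL (f : R * R -> R * R) : continuous f -> continuous (L \o f).
  by move=> cf z; apply: continuous_comp; [exact: cf|exact: cL].
have shiftp (f : R * R -> R * R) : continuous f -> continuous (plane \o f).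
  by move=> cf z; apply: continuous_comp; [exact: cf|exact: plane_continuous].
have Ls s : L (s, 0) = plane (s, 0).
  have [z|c _ cE] := lift_unique_all dL qL (shiftL _ cs1) (shiftp _ cs1).
    by rewrite /= pL /F /= P0 mulgVK qP.
  have := cE (0, 0); rewrite /= L0 plane0 mulg1 => c_1.
  by have := cE (s, 0); rewrite /= -c_1 mul1g.
have Lt t : L (0, t) = plane (0, t).
  have [z|c _ cE] := lift_unique_all dL qL (shiftL _ cs2) (shiftp _ cs2).
    by rewrite /= pL /F /= P0 mulgV mul1g qP.
  have := cE (0, 0); rewrite /= L0 plane0 mulg1 => c_1.
  by have := cE (0, t); rewrite /= -c_1 mul1g.
have Lpi s t : L (s + pi, t) = (plane (pi, 0%R) * L (s, t))%g.
  have [z|c _ cE] := lift_unique_all dL qL cL (shiftL _ cm1).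
    rewrite /= !pL /F /= aE oppr0; apply/qE.
    by exists a => //; rewrite !mulgA.
  have := cE (0, 0); rewrite /= L0 mulg1 add0r Ls => ->.
  exact: (cE (s, t)).
have Lm s t : L (s, t + m) = (plane (0%R, m) * L (s, t))%g.
  have [z|c _ cE] := lift_unique_all dL qL cL (shiftL _ (cm3 m)).
    by rewrite /= !pL /F /= Pm bk mul1g.
  have := cE (0, 0); rewrite /= L0 mulg1 add0r Lt => ->.
  exact: (cE (s, t)).
(* L (pi, m) computed in two ways *)
have := Lpi 0 (0 + m); rewrite Lm Lm Lpi L0 !mulg1 => E.
have := congr1 (fun x : V => co x 8) E.
rewrite plane_mul_t plane_mul_v !co_vec //=; lra.
Qed.

End Nil.
End NonNilpotence.

Theorem mainTheorem5 (R : realType) :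
  is_lie_algebra (@g_bracket R) /\
  is_representation (@g_bracket R) (@rho R) /\
  balanced_hkt_lie (@T_bracket R) (@Jt R) (gt R) /\
  ~ abelian_hypercomplex (@T_bracket R) (@Jt R) /\
  exists (S : lieGroupType R 12) (phi : 'M[R]_12),
    simply_connected R S /\
    solvable_group S /\
    is_lie_algebra_of (@T_bracket R) S phi /\
    exists (Gamma : set S) (M : manifoldType R 12) (p : S -> M),
      lattice_quotient Gamma p /\
      exists (J : 'I_3 -> M -> 'M[R]_12) (g : M -> 'M[R]_12),
        induced_structure phi p (@Jt R) (gt R) J g /\
        balanced_hkt J g /\
        (exists G, obata_connection J G) /\
        (forall G, obata_connection J G -> @holonomy_in_SLH R 3 M J G) /\
        ~ nilmanifold M.
Proof.
have TE : @T_bracket R = @bracket R.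
  by apply/funext => x; apply/funext => y; exact: T_bracketE.
split; first exact: g_lie.
split; first exact: rho_rep.
split.
  split.
  - exact: T_lie.
  - by split=> [|a X Y]; rewrite ?TE; [exact: quaternion_Jt|exact: integrable_Jt].
  - exact: inner_product_gt.
  - exact: compatible_gt.
  rewrite TE; exists (@bismut R); last exact: lee_gt.
  split; [exact: bismut_bilinear|exact: bismut_metric|exact: bismut_Jt|exact: bismut_torsion].
split; first by rewrite TE; exact: not_abelian_Jt.
exists (solv R), 1%:M.
split; first exact: solv_simply_connected.
split; first exact: solv_solvable.
split; first exact: solv_lie_algebra.
exists (@lattice R : set (solv R)), (solvmfd R), (@prj R).
split; first exact: solvmfd_lattice_quotient.
exists (@JM R), (@gM R).
split; first exact: induced_M.
split; first exact: balanced_hkt_M.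
split; first by exists (christoffel (@obata R)); exact: obata_M.
split; first by move=> G oG; apply: holonomy_SLH; exact: obata_unique.
by move=> [N [Gamma [q [nilN lat]]]]; exact: not_nilmanifold nilN lat.
Qed.
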